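(* Consider a finite stochastic partial monitoring game with loss matrix $L\in\mathbb{R}^{N\times M}$, feedback matrix $H\in[A]^{N\times M}$ and opponent strategy $p^*\in\mathcal{P}_M$, globally observable, with action $1$ the unique optimal action under $p^*$. Assume the regularity conditions: (1) the set $\mathcal{R}^*_1(p^*,\{S_ip^*,0\})$ is a singleton; (2) with $\mathcal{S}_\delta=\{q\in\mathcal{P}_M:D(S_1p^*\Vert S_1q)\le\delta\}$, one has $\mathrm{cl}(\mathrm{int}(\mathcal{C}_1^c)\cap\mathcal{S}_\delta)=\mathrm{cl}(\mathrm{cl}(\mathcal{C}_1^c)\cap\mathcal{S}_\delta)$ for all $\delta\ge0$ in some neighborhood of $0$. Then the algorithm PM-DMED-Hinge (with any parameters $a,b,c>0$) satisfies $$\mathbb{E}[\mathrm{Regret}(T)]\le C_1(p^*,\{S_ip^*\})\log T+\mathrm{o}(\log T).$$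
   Context: Game: at each round $t$ the learner chooses $i(t)\in[N]$, the outcome $j(t)$ is i.i.d. from $p^*\in\mathcal{P}_M$ (distributions on $[M]$), the loss $l_{i(t),j(t)}$ is unobserved and only $h_{i(t),j(t)}\in[A]$ is observed. $L_i$ = $i$-th row of $L$; $1=\arg\min_iL_i^\top p^*$ uniquely; $\Delta_i=(L_i-L_1)^\top p^*$; $\mathrm{Regret}(T)=\sum_{t=1}^T\Delta_{i(t)}$. $S_i\in\{0,1\}^{A\times M}$ with $(S_i)_{k,j}=1$ iff $h_{i,j}=k$. Global observability: $L_i-L_j\in\bigoplus_k\mathrm{Im}\,S_k^\top$ for all $i,j$. $\mathcal{C}_j=\{q\in\mathcal{P}_M:\forall i\ne j,(L_j-L_i)^\top q\le0\}$, $\mathcal{C}_j^c=\mathcal{P}_M\setminus\mathcal{C}_j$; $\mathcal{C}_{j,\alpha}=\{p\in\mathcal{P}_M:L_j^\top p+\alpha\le\min_{i\ne j}L_i^\top p\}$; $\mathrm{cl},\mathrm{int}$ denote closure and interior (in $\mathcal{P}_M$). $D$ is the KL divergence ($0\log(0/0)=0$), $(x)_+=\max(x,0)$. For distributions $p_i$ on $[A]$ and $\delta_i\ge0$: $\mathcal{R}_j(\{p_i,\delta_i\})=\{\{r_i\}_{i\ne j}\in[0,\infty)^{N-1}:\inf_{q\in\mathrm{cl}(\mathcal{C}_j^c):D(p_j\Vert S_jq)\le\delta_j}\sum_{i\ne j}r_i(D(p_i\Vert S_iq)-\delta_i)_+\ge1\}$; $C_j(p,\{p_i,\delta_i\})=\inf_{\{r_i\}\in\mathcal{R}_j(\{p_i,\delta_i\})}\sum_{i\ne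 j}r_i(L_i-L_j)^\top p$; $\mathcal{R}^*_j(p,\{p_i,\delta_i\})$ = set of $\{r_i\}\in\mathcal{R}_j(\{p_i,\delta_i\})$ attaining this infimum. Write $C_j(p,\{p_i\})=C_j(p,\{p_i,0\})$. $N_i(t)$ = number of rounds before $t$ in which $i$ was chosen; $\hat p_i(t)$ = empirical distribution on $[A]$ of symbols observed when playing $i$ before round $t$. PM-DMED-Hinge (parameters $c>0$, $f(n)=bn^{-1/2}$, $\alpha(t)=a/\log\log t$ with $a,b>0$). Main routine: select each action once; set $Z_C,Z_R\leftarrow[N]$, $Z_N\leftarrow\emptyset$; while $t\le T$: for each $i(t)\in Z_C$ in an arbitrary fixed order, select $i(t)$ and observe the symbol, set $Z_R\leftarrow Z_R\setminus\{i(t)\}$, run the subroutine below (which adds actions to $Z_N$ without duplication), and set $t\leftarrow t+1$; after the for-loop set $Z_C,Z_R\leftarrow Z_N$, $Z_N\leftarrow\emptyset$. Subroutine: (i) compute any $\hat p(t)\in\arg\min_q\sum_iN_i(t)(D(\hat p_i(t)\Vert S_iq)-f(N_i(t)))_+$ and let $\hat i(t)=\arg\min_iL_i^\top\hat p(t)$; (ii) if $\hat i(t)\notin Z_R$ put $\hat i(t)$ into $Z_N$; (iii) if $\hat p(t)\notin\mathcal{C}_{\hat i(t),\alpha(t)}$ or some $i$ has $D(\hat p_i(t)\Vert S_i\hat p(t))>f(N_i(t))$, put all $i\notin Z_R$ into $Z_N$; (iv) if some $i$ has $N_i(t)<c\sqrt{\log t}$, put all actions not in $Z_R$ into $Z_N$;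 (v) if $\{N_i(t)/\log t\}_{i\ne\hat i(t)}\notin\mathcal{R}_{\hat i(t)}(\{\hat p_i(t),f(N_i(t))\})$, compute some $\{r_i^*\}\in\mathcal{R}^*_{\hat i(t)}(\hat p(t),\{\hat p_i(t),f(N_i(t))\})$ and put all $i\notin Z_R$ with $r_i^*>N_i(t)/\log t$ into $Z_N$; if no such $\{r_i^*\}$ exists, put all $i\notin Z_R$ into $Z_N$. *)

(* Defs.v *)
From HB Require Import structures.
From mathcomp Require Import all_boot all_order all_algebra.
From mathcomp Require Import all_classical all_reals all_analysis.
Set Implicit Arguments. Unset Strict Implicit. Unset Printing Implicit Defensive.
Import Order.TTheory GRing.Theory Num.Theory.
Local Open Scope classical_set_scope.
Local Open Scope ring_scope.

Section PartialMonitoring.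
Variable R : realType.
Variables N M A : nat.
Variable L : 'M[R]_(N, M).
Variable h : 'I_N -> 'I_M -> 'I_A.

Definition is_dist n (p : 'I_n -> R) : Prop :=
  (forall k, 0 <= p k) /\ \sum_(k < n) p k = 1.

Definition lossv (i : 'I_N) (p : 'I_M -> R) : R := \sum_(m < M) L i m * p m.

Definition Smx (i : 'I_N) : 'M[R]_(A, M) := \matrix_(k < A, m < M) (h i m == k)%:R.
Definition Sq (i : 'I_N) (q : 'I_M -> R) : 'I_A -> R :=
  fun k => \sum_(m < M) Smx i k m * q m.

Definition globally_observable : Prop :=
  forall i j : 'I_N, exists y : 'I_N -> 'I_A -> R,
    forall m, L i m - L j m = \sum_(k < N) \sum_(a < A) Smx k a m * y k a.

Definition KL (p q : 'I_A -> R) : \bar R :=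
  (\sum_(k < A) (if p k == 0%R then 0
                else if q k == 0%R then +oo
                else (p k * ln (p k / q k))%:E))%E.

Definition hinge (x : \bar R) : \bar R := maxe x 0%E.

Definition Ccell (j : 'I_N) : set ('I_M -> R) :=
  [set q | is_dist q /\ forall i, i != j -> lossv j q - lossv i q <= 0].
Definition Ccomp (j : 'I_N) : set ('I_M -> R) :=
  [set q | is_dist q /\ ~ Ccell j q].
Definition Calpha (j : 'I_N) (alpha : R) : set ('I_M -> R) :=
  [set p | is_dist p /\ forall i, i != j -> lossv j p + alpha <= lossv i p].

Definition relcl (X : set ('I_M -> R)) : set ('I_M -> R) :=
  [set p | is_dist p /\ forall e, 0 < e -> exists q, X q /\ forall m, `|p m - q m| < e].
Definition relint (X : set ('I_M -> R)) : set ('I_M -> R) :=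
  [set p | X p /\ exists e, 0 < e /\
     forall q, is_dist q -> (forall m, `|p m - q m| < e) -> X q].

(* R_j({p_i, delta_i}); a vector {r_i}_{i <> j} is encoded as r : 'I_N -> R with r j = 0 *)
Definition Rset (j : 'I_N) (ps : 'I_N -> 'I_A -> R) (ds : 'I_N -> R) : set ('I_N -> R) :=
  [set r | r j = 0 /\ (forall i, 0 <= r i) /\
     (1 <= ereal_inf
        [set (\sum_(i < N | i != j) (r i)%:E * hinge (KL (ps i) (Sq i q) - (ds i)%:E))%E
        | q in [set q | relcl (Ccomp j) q /\ (KL (ps j) (Sq j q) <= (ds j)%:E)%E]])%E].

Definition costr (j : 'I_N) (p : 'I_M -> R) (r : 'I_N -> R) : R :=
  \sum_(i < N | i != j) r i * (lossv i p - lossv j p).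

Definition Cval (j : 'I_N) (p : 'I_M -> R) (ps : 'I_N -> 'I_A -> R) (ds : 'I_N -> R) : \bar R :=
  ereal_inf [set (costr j p r)%:E | r in Rset j ps ds].

Definition Rstar (j : 'I_N) (p : 'I_M -> R) (ps : 'I_N -> 'I_A -> R) (ds : 'I_N -> R)
  : set ('I_N -> R) :=
  [set r | Rset j ps ds r /\ (costr j p r)%:E = Cval j p ps ds].

Definition Sdelta (j : 'I_N) (pstar : 'I_M -> R) (d : R) : set ('I_M -> R) :=
  [set q | is_dist q /\ (KL (Sq j pstar) (Sq j q) <= d%:E)%E].

Definition history := seq ('I_N * 'I_A).

Definition Ncnt (hs : history) (i : 'I_N) : nat := count (fun s => s.1 == i) hs.
Definition phat (hs : history) (i : 'I_N) : 'I_A -> R :=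
  fun k => (count (fun s => (s.1 == i) && (s.2 == k)) hs)%:R / (Ncnt hs i)%:R.

Variables a b c : R.
Definition fexp (n : nat) : R := b / Num.sqrt (n%:R).
Definition alpha (t : nat) : R := a / ln (ln (t%:R)).

Definition objective (hs : history) (q : 'I_M -> R) : \bar R :=
  (\sum_(i < N) ((Ncnt hs i)%:R)%:E * hinge (KL (phat hs i) (Sq i q) - (fexp (Ncnt hs i))%:E))%E.

Definition is_argmin_obj (hs : history) (q : 'I_M -> R) : Prop :=
  is_dist q /\ forall q', is_dist q' -> (objective hs q <= objective hs q')%E.

(* selection rules (the "any"/"some" choices of the algorithm), as functions of
   the round t and the history before round t *)
Variable psel : nat -> history -> ('I_M -> R).
Variable isel : nat -> history -> 'I_N.
Variable rsel : nat -> history -> option ('I_N -> R).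
Variable ordr : seq 'I_N.
Variable i0 : 'I_N.                               (* unused default *)

Definition psel_ok : Prop :=
  forall t hs, (exists q, is_argmin_obj hs q) -> is_argmin_obj hs (psel t hs).
Definition isel_ok : Prop :=
  forall t hs i, lossv (isel t hs) (psel t hs) <= lossv i (psel t hs).
Definition rsel_ok : Prop :=
  forall t hs,
    let ps := phat hs in let ds := fun i => fexp (Ncnt hs i) in
    match rsel t hs with
    | Some r => Rstar (isel t hs) (psel t hs) ps ds r
    | None => Rstar (isel t hs) (psel t hs) ps ds = set0
    end.

(* the subroutine at round t (hs = history before round t, zr = current Z_R);
   returns the set of actions added to Z_N *)
Definition subroutine (t : nat) (hs : history) (zr : {set 'I_N}) : {set 'I_N} :=
  let p := psel t hs in
  let ih := isel t hs in
  let notR := ~: zr in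
  let ps := phat hs in
  let ds := fun i => fexp (Ncnt hs i) in
  let rv := fun i : 'I_N => (if i == ih then 0 else (Ncnt hs i)%:R / ln (t%:R) : R) in
  (if ih \notin zr then [set ih]%SET else finset.set0)
  :|: (if `[< ~ Calpha ih (alpha t) p \/
              exists i, ((fexp (Ncnt hs i))%:E < KL (ps i) (Sq i p))%E >]
       then notR else finset.set0)
  :|: (if `[< exists i, (Ncnt hs i)%:R < c * Num.sqrt (ln (t%:R)) >]
       then notR else finset.set0)
  :|: (if `[< ~ Rset ih ps ds rv >] then
         match rsel t hs with
         | Some r => [set i in notR | rv i < r i]%SET
         | None => notR
         end
       else finset.set0).

Record state := State {
  st_hist : history;
  st_zc : seq 'I_N;        (* actions of Z_C still to be played in this loop *)
  st_zr : {set 'I_N};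
  st_zn : {set 'I_N};
  st_init : bool           (* true during the initial "select each action once" *)
}.

Definition init_state : state := State [::] ordr [set: 'I_N]%SET finset.set0 true.

Definition cur_action (s : state) : 'I_N := head i0 (st_zc s).

Definition step (s : state) (j : 'I_M) : state :=
  let i := cur_action s in
  let t := (size (st_hist s)).+1 in
  let hs' := rcons (st_hist s) (i, h i j) in
  let zc' := behead (st_zc s) in
  if st_init s then
    (if nilp zc' then State hs' ordr [set: 'I_N]%SET finset.set0 false
     else State hs' zc' (st_zr s) (st_zn s) true)
  else
    let zr' := st_zr s :\ i in
    let zn' := st_zn s :|: subroutine t (st_hist s) zr' in
    if nilp zc' then State hs' [seq k <- ordr | k \in zn'] zn' finset.set0 false
    else State hs' zc' zr' zn' false.

Fixpoint run (s : state) (outs : seq 'I_M) : seq 'I_N :=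
  match outs with
  | [::] => [::]
  | j :: o => cur_action s :: run (step s j) o
  end.

Definition actions (outs : seq 'I_M) : seq 'I_N := run init_state outs.

End PartialMonitoring.

Section Regret.
Variable R : realType.
Variables N M A : nat.

Definition gap (L : 'M[R]_(N, M)) (pstar : 'I_M -> R) (i1 i : 'I_N) : R :=
  lossv L i pstar - lossv L i1 pstar.

Definition expected_regret (L : 'M[R]_(N, M)) (h : 'I_N -> 'I_M -> 'I_A)
  (pstar : 'I_M -> R) (i1 : 'I_N) (a b c : R)
  psel isel rsel (ordr : seq 'I_N) (T : nat) : R :=
  \sum_(w : {ffun 'I_T -> 'I_M})
     (\prod_(t < T) pstar (w t)) *
     \sum_(i <- actions L h a b c psel isel rsel ordr i1 [seq w t | t <- enum 'I_T])
        gap L pstar i1 i.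
End Regret.

(* Main.v *)
(* Idea. A regret-producing play is caused by an earlier insertion in Z_N. As
   long as all empirical distributions are within KL radius f of the truth and
   no action is undersampled, p^* minimizes the objective with value 0, so that
   the estimate is consistent with p^*, and action k <> 1 is inserted only
   while N_k < r*_k log t; by compactness and uniqueness of the optimizer the
   computed r*_k is at most the true one plus epsilon. Undersampled actions
   cost O(sqrt(log T)). All other insertions are charged to a pair (i, n) such
   that the estimate of i after n samples is inaccurate: such an estimate survives only polynomially many (in n)
   insertions, because the optimal vectors r* are bounded by log t and
   N_i >= c sqrt(log t), or else p^* is rejected at level log t, which happens
   for at most prod_i exp(n_i (D_i - f(n_i))) rounds with given sample sizes
   n_i of the inaccurate actions. Finally exp(n D) is at most (n+1)^A times the
   likelihood ratio of Laplace's predictor, a supermartingale jointly over the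
   actions, so the total charge is bounded in expectation by
   (sum_n (n+1)^(A+4) exp(- b sqrt n))^N. *)

(* A union bound over rounds is out of reach: sample sizes may be as small as [c * sqrt (ln t)], and
   there the bound on the probability of an inaccurate estimate, about exp(- b sqrt n), is not
   summable in t. Rounds are therefore counted per sample size: whatever is scheduled is played
   within 2N + 1 further rounds, so an action is scheduled with a given sample size in boundedly
   many rounds only. The delicate case is an inaccurate [i] while the exploration rule schedules
   another action k'. The margin [alpha t] keeps r* of order (log log t)^3, so k' has at most (log
   t)^2 samples, which is of order n^4; this is the 4 in A + 4. All counting is done path by path
   against the final history, and a charge of the form t <= V costs at most V rounds, so expectation
   enters only through the mean of a product of weights. On the analytic side the obstacle is
   infinite divergences, at which the constraints defining [Rset] are not continuous in the data;
   alternatives are moved slightly towards [pstar] before limits are taken. *)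
Require Import Defs.
From HB Require Import structures.
From mathcomp Require Import all_boot all_order all_algebra.
From mathcomp Require Import all_classical all_reals all_analysis.
From mathcomp Require Import zify ring lra.
Import Order.TTheory GRing.Theory Num.Theory.
Import numFieldNormedType.Exports.
Local Open Scope classical_set_scope.
Local Open Scope ring_scope.
Set Implicit Arguments. Unset Strict Implicit. Unset Printing Implicit Defensive.

(** * Relative entropy with real values *)

Section RelativeEntropy.
Context {R : realType} {n : nat}.
Implicit Types p q : 'I_n -> R.

Definition ac p q := forall k, q k = 0 -> p k = 0.

(** Real-valued so that limits and convexity live in [R]. It agrees with [KL] only under [ac];
    elsewhere the values of division and [ln] at 0 make it a meaningless finite number. *)
Definition dkl p q : R := \sum_k p k * ln (p k / q k).

Lemma KL_ac p q : ac p q -> KL p q = (dkl p q)%:E.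
Proof.
move=> acpq; rewrite /KL /dkl -sumEFin; apply: eq_bigr => k _.
case: eqP => [->|pk0]; first by rewrite mul0r.
by case: eqP => // /acpq.
Qed.

Lemma KL_nac p q : ~ ac p q -> KL p q = +oo%E.
Proof.
move=> nac; have [k [qk pk]] : exists k, q k = 0 /\ p k <> 0.
  apply: contrapT => H; apply: nac => k qk; apply: contrapT => pk.
  by apply: H; exists k.
rewrite /KL; apply/eqP; rewrite esum_eqy; last first.
  by move=> i _; case: ifP => // _; case: ifP.
apply/existsP; exists k => /=.
by rewrite qk eqxx; have /eqP/negbTE -> := pk.
Qed.

Lemma KL_le p q (x : R) : (KL p q <= x%:E)%E -> ac p q /\ dkl p q <= x.
Proof.
have [a|na] := pselect (ac p q); first by rewrite KL_ac // lee_fin.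
by rewrite KL_nac // leye_eq.
Qed.

Lemma dist_le1 p k : is_dist p -> p k <= 1.
Proof.
move=> [p0 <-]; rewrite (bigD1 k) //= lerDl; exact: sumr_ge0.
Qed.

Lemma ac_gt0 p q k : is_dist q -> ac p q -> 0 < p k -> 0 < q k.
Proof.
move=> [q0 _] a pk; rewrite lt0r q0 andbT; apply/eqP => /a pk0.
by move: pk; rewrite pk0 ltxx.
Qed.

Lemma ln_le_sub1 (x : R) : 0 < x -> ln x <= x - 1.
Proof.
move=> x0; have := expR_ge1Dx (ln x); rewrite lnK ?posrE //; lra.
Qed.

(** Termwise [ln x <= x - 1] at [x = sqrt (q k / p k)]; since both masses are 1, the sum of squares
    equals the sum of [2 * p k - 2 * sqrt (p k) * sqrt (q k)]. *)
Lemma hellinger_dkl p q : is_dist p -> is_dist q -> ac p q ->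
  \sum_k (Num.sqrt (p k) - Num.sqrt (q k)) ^+ 2 <= dkl p q.
Proof.
move=> dp dq a; have [p0 p1] := dp; have [q0 q1] := dq.
have E : \sum_k (Num.sqrt (p k) - Num.sqrt (q k)) ^+ 2
   = \sum_k (2 * p k - 2 * (Num.sqrt (p k) * Num.sqrt (q k))).
  apply/eqP; rewrite -subr_eq0 -sumrB.
  under eq_bigr => k _.
    rewrite (_ : _ - _ = q k - p k); last first.
      have := sqr_sqrtr (p0 k); have := sqr_sqrtr (q0 k).
      move: (Num.sqrt _) (Num.sqrt _) => x y <- <-; ring.
    over.
  by rewrite sumrB p1 q1 subrr.
rewrite E; apply: ler_sum => k _.
have := p0 k; rewrite le0r => /orP[/eqP ->|pk].
  by rewrite sqrtr0 !(mul0r,mulr0) subrr.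
have qk := ac_gt0 dq a pk.
have sp : 0 < Num.sqrt (p k) by rewrite sqrtr_gt0.
have sq : 0 < Num.sqrt (q k) by rewrite sqrtr_gt0.
have xE : p k / q k = (Num.sqrt (q k) / Num.sqrt (p k)) ^- 2.
  by rewrite exprMn exprVn !sqr_sqrtr // invfM invrK mulrC.
have x0 : 0 < Num.sqrt (q k) / Num.sqrt (p k) by rewrite divr_gt0.
rewrite xE lnV ?posrE ?exprn_gt0 // lnXn //.
have := ln_le_sub1 x0; move: (ln _) => l Hl.
rewrite -[X in _ <= X * _](sqr_sqrtr (p0 k)) -[X in 2 * X - _](sqr_sqrtr (p0 k)).
rewrite mulr2n.
have H : (Num.sqrt (p k)) ^+ 2 * l <= Num.sqrt (q k) * Num.sqrt (p k) - Num.sqrt (p k) ^+ 2.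
  have -> : Num.sqrt (q k) * Num.sqrt (p k) - Num.sqrt (p k) ^+ 2 =
    Num.sqrt (p k) ^+2 * (Num.sqrt (q k) / Num.sqrt (p k) - 1) by field; rewrite gt_eqF.
  by rewrite ler_wpM2l // sqr_ge0.
lra.
Qed.

Lemma dkl_ge0 p q : is_dist p -> is_dist q -> ac p q -> 0 <= dkl p q.
Proof.
move=> dp dq a; apply: le_trans (hellinger_dkl dp dq a).
by apply: sumr_ge0 => k _; exact: sqr_ge0.
Qed.

(** A weak Pinsker inequality: [p k - q k] factors into a difference of square roots, controlled by
    the Hellinger bound, and a sum of square roots, at most 2. *)
Lemma pinsker p q (x : R) k : is_dist p -> is_dist q -> ac p q -> dkl p q <= x ->
  `|p k - q k| <= 2 * Num.sqrt x.
Proof.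
move=> dp dq a dx; have [p0 p1] := dp; have [q0 q1] := dq.
have H : (Num.sqrt (p k) - Num.sqrt (q k)) ^+ 2 <= x.
  apply: le_trans dx; apply: le_trans (hellinger_dkl dp dq a).
  by rewrite (bigD1 k) //= lerDl; apply: sumr_ge0 => i _; exact: sqr_ge0.
have -> : p k - q k = (Num.sqrt (p k) - Num.sqrt (q k)) * (Num.sqrt (p k) + Num.sqrt (q k)).
  by rewrite -subr_sqr !sqr_sqrtr.
rewrite normrM mulrC; apply: ler_pM => //.
  rewrite ger0_norm ?addr_ge0 ?sqrtr_ge0 //.
  have s1 (y : R) : y <= 1 -> Num.sqrt y <= 1.
    by move=> y1; rewrite -[leRHS]sqrtr1; exact: ler_wsqrtr.
  have := s1 _ (dist_le1 k dp); have := s1 _ (dist_le1 k dq); lra.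
by rewrite -sqrtr_sqr; exact: ler_wsqrtr.
Qed.

Lemma dkl0_eq p q : is_dist p -> is_dist q -> ac p q -> dkl p q <= 0 -> p =1 q.
Proof.
move=> dp dq a d0 k; have := pinsker k dp dq a d0.
by rewrite sqrtr0 mulr0 normr_le0 subr_eq0 => /eqP.
Qed.

(* ln x <= x - 1, applied to q k / p k *)
Lemma dkl_term_ge p q k : is_dist p -> is_dist q -> ac p q ->
  - 1 <= p k * ln (p k / q k).
Proof.
move=> dp dq a; have := dp.1 k; rewrite le0r => /orP[/eqP ->|pk].
  by rewrite mul0r; lra.
have qk := ac_gt0 dq a pk.
rewrite -[p k / q k]invrK lnV ?posrE ?invr_gt0 ?divr_gt0 // invf_div mulrN lerN2.
apply: (@le_trans _ _ (p k * (q k / p k - 1))).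
  by rewrite ler_pM2l // ln_le_sub1 // divr_gt0.
rewrite mulrBr mulrCA divff ?gt_eqF // !mulr1.
have := dist_le1 k dq; lra.
Qed.

Definition mix (e : R) p q : 'I_n -> R := fun k => (1 - e) * p k + e * q k.

Lemma mix_dist e p q : 0 <= e -> e <= 1 -> is_dist p -> is_dist q -> is_dist (mix e p q).
Proof.
move=> e0 e1 [p0 p1] [q0 q1]; split.
  by move=> k; rewrite addr_ge0 // mulr_ge0 // subr_ge0.
by rewrite big_split -!mulr_sumr /= p1 q1 !mulr1 subrK.
Qed.

(** Shrinking the reference law by a factor [x] has an additive cost, so a strict entropy constraint
    survives a small move of the reference. *)
Lemma dkl_scale_le p q q' (x : R) : is_dist p -> is_dist q -> is_dist q' ->
  ac p q -> 0 < x -> (forall k, x * q k <= q' k) ->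
  ac p q' /\ dkl p q' <= dkl p q - ln x.
Proof.
move=> dp dq dq' a x0 H.
have a' : ac p q'.
  move=> k q'k; have := H k; rewrite q'k => h; apply: a; apply/eqP.
  by rewrite eq_le dq.1 andbT -(pmulr_rle0 _ x0).
split=> //; rewrite /dkl -[ln x]mul1r -dp.2 mulr_suml -sumrB.
apply: ler_sum => k _; have := dp.1 k; rewrite le0r => /orP[/eqP ->|pk].
  by rewrite !mul0r subrr.
have qk := ac_gt0 dq a pk; have q'k := ac_gt0 dq' a' pk.
rewrite -mulrBr ler_pM2l // -ln_div ?posrE ?divr_gt0 // ler_ln ?posrE ?divr_gt0 //.
rewrite -mulrA -invfM ler_pM2l // lef_pV2 ?posrE ?mulr_gt0 // mulrC; exact: H.
Qed.

(** Convexity of [- ln] from its tangent at the mixed value: the weighted right-hand sides of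
    [ln x <= x - 1] add up to 0. *)
Lemma dkl_mix_le e p q q' : 0 <= e -> e <= 1 ->
  is_dist p -> is_dist q -> is_dist q' -> ac p q -> ac p q' ->
  dkl p (mix e q q') <= (1 - e) * dkl p q + e * dkl p q'.
Proof.
move=> e0 e1 dp dq dq' a a'; rewrite /dkl !mulr_sumr -big_split /=.
apply: ler_sum => k _; have := dp.1 k; rewrite le0r => /orP[/eqP ->|pk].
  by rewrite !mul0r !mulr0 addr0.
have qk := ac_gt0 dq a pk; have q'k := ac_gt0 dq' a' pk.
have mk : 0 < mix e q q' k.
  rewrite /mix; move: e0; rewrite le0r => /orP[/eqP ->|e0].
    by rewrite subr0 mul1r mul0r addr0.
  by rewrite ltr_wpDl ?mulr_gt0 // mulr_ge0 ?subr_ge0 // ltW.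
rewrite mulrCA [e * _]mulrCA -mulrDr ler_pM2l //.
rewrite !ln_div ?posrE //.
have h1 := ln_le_sub1 (divr_gt0 qk mk); have h2 := ln_le_sub1 (divr_gt0 q'k mk).
rewrite !ln_div ?posrE // in h1 h2.
have h1' : (1 - e) * (ln (q k) - ln (mix e q q' k)) <= (1 - e) * (q k / mix e q q' k - 1).
  by rewrite ler_wpM2l // subr_ge0.
have h2' : e * (ln (q' k) - ln (mix e q q' k)) <= e * (q' k / mix e q q' k - 1).
  by rewrite ler_wpM2l.
have : (1 - e) * (q k / mix e q q' k - 1) + e * (q' k / mix e q q' k - 1) = 0.
  have mE : (1 - e) * q k + e * q' k = mix e q q' k by [].
  rewrite !mulrBr !mulr1 !mulrA addrACA -mulrDl mE divff ?gt_eqF //; ring.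
lra.
Qed.

End RelativeEntropy.

(** * Cells, their complements, and admissible vectors *)

Section Cells.
Context {R : realType} {N M A : nat}.
Variables (L : 'M[R]_(N, M)) (h : 'I_N -> 'I_M -> 'I_A).
Implicit Types (p q : 'I_M -> R) (i j k : 'I_N) (ps : 'I_N -> 'I_A -> R) (ds r : 'I_N -> R).

Lemma Sq_dist i q : is_dist q -> is_dist (Sq h i q).
Proof.
move=> [q0 q1]; split.
  move=> k; apply: sumr_ge0 => m _; rewrite mxE mulr_ge0 //.
rewrite exchange_big /= -q1; apply: eq_bigr => m _.
rewrite -mulr_suml (bigD1 (h i m)) //= mxE eqxx big1 ?addr0 ?mul1r // => k /negbTE.
by rewrite mxE eq_sym => ->.
Qed.

Lemma Sq_ge i q m : is_dist q -> q m <= Sq h i q (h i m).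
Proof.
move=> [q0 _]; rewrite /Sq (bigD1 m) //= mxE eqxx mul1r lerDl.
by apply: sumr_ge0 => m' _; rewrite mxE mulr_ge0.
Qed.

Lemma Sq_mix i e p q a : Sq h i (mix e p q) a = mix e (Sq h i p) (Sq h i q) a.
Proof.
rewrite /mix /Sq !mulr_sumr -big_split /=; apply: eq_bigr => m _; ring.
Qed.

Lemma lossv_mix i e p q : lossv L i (mix e p q) = (1 - e) * lossv L i p + e * lossv L i q.
Proof.
rewrite /mix /lossv !mulr_sumr -big_split /=; apply: eq_bigr => m _; ring.
Qed.

Lemma lossv_dist i p q (e : R) : (forall m, `|p m - q m| <= e) ->
  `|lossv L i p - lossv L i q| <= (\sum_m `|L i m|) * e.
Proof.
move=> H; rewrite /lossv -sumrB; apply: le_trans (ler_norm_sum _ _ _) _.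
rewrite mulr_suml; apply: ler_sum => m _.
by rewrite -mulrBr normrM ler_wpM2l.
Qed.

Lemma CcompP j q : Ccomp L j q <->
  is_dist q /\ exists k, k != j /\ lossv L k q < lossv L j q.
Proof.
split=> [[dq H]|[dq [k [kj lk]]]]; split => //.
  apply: contrapT => H'; apply: H; split=> // i ij.
  by rewrite subr_le0 leNgt; apply/negP => li; apply: H'; exists i.
by move=> [_ /(_ k kj)]; rewrite subr_le0 leNgt lk.
Qed.

Lemma Ccomp_sub_relcl j q : Ccomp L j q -> relcl (Ccomp L j) q.
Proof.
move=> H; split=> [|e e0]; first by case: H.
by exists q; split=> // m; rewrite subrr normr0.
Qed.

(* The closure of the complement of a cell is a finite union of half-simplices,
   over the actions k whose open half-simplex is nonempty. *)
Lemma relcl_CcompP j q : relcl (Ccomp L j) q ->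
  is_dist q /\ exists k, [/\ k != j, lossv L k q <= lossv L j q &
    exists q', is_dist q' /\ lossv L k q' < lossv L j q'].
Proof.
move=> [dq H]; split=> //; apply: contrapT => nH.
pose B := 1 + \sum_i \sum_m `|L i m|.
have B0 : 0 < B.
  by rewrite ltr_pwDl //; apply: sumr_ge0 => i _; apply: sumr_ge0.
have BE i : \sum_m `|L i m| <= B.
  rewrite /B (bigD1 i) //=.
  have : 0 <= \sum_(j0 < N | j0 != i) \sum_m `|L j0 m|.
    by apply: sumr_ge0 => i' _; apply: sumr_ge0.
  lra.
(* Each loss moves by at most half of any positive gap within this radius, so an action beating [j]
   at a nearby point cannot be strictly worse than [j] at [q]. *)
have [e e0 He] : exists2 e, 0 < e & forall k, lossv L j q < lossv L k q ->
    B * e <= (lossv L k q - lossv L j q) / 2.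
  exists (\big[Num.min/1]_(k | lossv L j q < lossv L k q) ((lossv L k q - lossv L j q) / 2 / B)).
    apply: lt_bigmin => // k lk; rewrite !divr_gt0 // subr_gt0 //.
  move=> k lk; rewrite mulrC -ler_pdivlMr //.
  by apply: bigmin_le_cond.
have [q' [Cq' qq']] := H e e0; have /CcompP[dq' [k [kj lk]]] := Cq'.
have lk' : lossv L j q < lossv L k q.
  rewrite ltNge; apply/negP => lk'; apply: nH; exists k; split=> //.
  by exists q'.
have Hk := He k lk'.
have D i : `|lossv L i q - lossv L i q'| <= B * e.
  apply: le_trans (lossv_dist i (fun m => ltW (qq' m))) _.
  by rewrite ler_wpM2r // ltW.
have := D j; have := D k; rewrite !ler_norml => /andP[_ h1] /andP[h2 _]; lra.
Qed.

Lemma mix_Ccomp j k e q q' : k != j -> is_dist q -> is_dist q' -> 0 < e -> e <= 1 ->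
  lossv L k q <= lossv L j q -> lossv L k q' < lossv L j q' -> Ccomp L j (mix e q q').
Proof.
move=> kj dq dq' e0 e1 lk lk'; apply/CcompP; split; first exact: mix_dist (ltW e0) _ _ _.
exists k; split=> //; rewrite !lossv_mix ler_ltD //.
  by rewrite ler_wpM2l // subr_ge0.
by rewrite ltr_pM2l.
Qed.

Lemma relcl_idem (X : set ('I_M -> R)) q : is_dist q ->
  (forall e, 0 < e -> exists q', relcl X q' /\ forall m, `|q m - q' m| < e) -> relcl X q.
Proof.
move=> dq H; split=> // e e0.
have [q' [[_ Xq'] qq']] := H _ (divr_gt0 e0 (ltr0Sn _ 1)).
have [q'' [Xq'' q'q'']] := Xq' _ (divr_gt0 e0 (ltr0Sn _ 1)).
exists q''; split=> // m; have -> : q m - q'' m = (q m - q' m) + (q' m - q'' m) by ring.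
apply: le_lt_trans (ler_normD _ _) _; rewrite [e]splitr; exact: ltrD.
Qed.

Definition feas j ps ds q :=
  [/\ relcl (Ccomp L j) q, ac (ps j) (Sq h j q) & dkl (ps j) (Sq h j q) <= ds j].

Definition excess ps ds i q : R := Num.max (dkl (ps i) (Sq h i q) - ds i) 0.

Lemma excess_ge0 ps ds i q : 0 <= excess ps ds i q.
Proof. by rewrite /excess le_max lexx orbT. Qed.

(** Where some [r i > 0] meets an infinite divergence the sum is [+oo] and the constraint is free;
    where [r i = 0] the product with infinity is 0. Only alternatives with finite active divergences
    remain, and there the arithmetic is real. *)
Lemma RsetP j ps ds r : Rset L h j ps ds r <->
  [/\ r j = 0, forall i, 0 <= r i &
    forall q, feas j ps ds q -> (forall i, i != j -> 0 < r i -> ac (ps i) (Sq h i q)) ->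
      1 <= \sum_(i | i != j) r i * excess ps ds i q].
Proof.
have hE i q : ac (ps i) (Sq h i q) ->
    hinge (KL (ps i) (Sq h i q) - (ds i)%:E)%E = (excess ps ds i q)%:E.
  by move=> a; rewrite /hinge KL_ac // /excess EFin_max.
have sE q : (forall i, 0 <= r i) -> (forall i, i != j -> 0 < r i -> ac (ps i) (Sq h i q)) ->
   (\sum_(i < N | i != j) (r i)%:E * hinge (KL (ps i) (Sq h i q) - (ds i)%:E))%E =
   (\sum_(i | i != j) r i * excess ps ds i q)%:E.
  move=> r0 a; rewrite -sumEFin; apply: eq_bigr => i ij.
  have := r0 i; rewrite le0r => /orP[/eqP ->|ri]; first by rewrite mul0e mul0r.
  by rewrite hE ?EFinM //; exact: a.
split=> [[rj [r0 H]]|[rj r0 H]].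
  split=> // q [Kq aq dq] a; rewrite -lee_fin -sE //; apply: le_trans H _.
  by apply: ereal_inf_lbound; exists q => //; split => //=; rewrite KL_ac // lee_fin.
split=> //; split=> //; apply/ereal_infP => _ [q [Kq /KL_le[aq dq]] <-].
have [a|na] := pselect (forall i, i != j -> 0 < r i -> ac (ps i) (Sq h i q)).
  by rewrite sE // lee_fin; exact: H.
have [i [ij ri nac]] : exists i, [/\ i != j, 0 < r i & ~ ac (ps i) (Sq h i q)].
  apply: contrapT => H'; apply: na => i ij ri; apply: contrapT => nac.
  by apply: H'; exists i.
rewrite (_ : (\sum_(_ < _ | _) _)%E = +oo%E) ?leey //; apply/eqP; rewrite esum_eqy; last first.
  move=> k kj; rewrite -ltNye; apply: (@lt_le_trans _ _ 0%E) => //.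
  by rewrite mule_ge0 ?lee_fin // /hinge le_max lexx orbT.
apply/existsP; exists i => /=; rewrite unfold_in ij /= KL_nac //= /hinge addye // maxye.
by rewrite gt0_muley ?lte_fin.
Qed.

Lemma Rset_up j ps ds r r' : Rset L h j ps ds r -> r' j = 0 -> (forall i, r i <= r' i) ->
  Rset L h j ps ds r'.
Proof.
move=> /RsetP[rj r0 H] r'j rr'; apply/RsetP; split=> //.
  by move=> i; exact: le_trans (rr' i).
move=> q Fq a; apply: le_trans (H q Fq _) _.
  by move=> i ij ri; apply: a => //; exact: lt_le_trans (rr' i).
by apply: ler_sum => i _; rewrite ler_wpM2r // excess_ge0.
Qed.

Lemma RstarP j p ps ds r : Rstar L h j p ps ds r <->
  Rset L h j ps ds r /\ forall r', Rset L h j ps ds r' -> costr L j p r <= costr L j p r'.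
Proof.
split=> [[Rr E]|[Rr H]]; split=> //.
  by move=> r' Rr'; rewrite -lee_fin E; apply: ereal_inf_lbound; exists r'.
apply/eqP; rewrite eq_le; apply/andP; split; last by apply: ereal_inf_lbound; exists r.
by apply/ereal_infP => _ [r' Rr' <-]; rewrite lee_fin; exact: H.
Qed.

End Cells.

(* Limits along an ultrafilter replace the extraction of subsequences. *)
Lemma ultra_nat : exists U : set_system nat, UltraFilter U /\ \oo `<=` U.
Proof. exact: ultraFilterLemma. Qed.

(** * Compactness of the simplex and semicontinuity of the relative entropy *)

Section UltraLimits.
Context {R : realType} {U : set_system nat} {UU : UltraFilter U}.

Lemma ultra_cvg (u : nat -> R) (B : R) : (\forall n \near U, `|u n| <= B) ->
  exists l : R, u n @[n --> U] --> l.
Proof.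
move=> uB; have PU := @ultra_proper _ U UU.
have F : fmap u U `[- B, B]%classic.
  by apply: filterS uB => n /=; rewrite in_itv /= -ler_norml.
have [l [_ cl]] := @segment_compact R (- B) B (fmap u U) _ F.
exists l => V Vl; have [//|UC] := in_ultra_setVsetC (u @^-1` V) UU.
by have [x [/= ]] := cl (~` V) V UC Vl.
Qed.

Lemma ultra_lim_unique (u : nat -> R) (l l' : R) :
  u n @[n --> U] --> l -> u n @[n --> U] --> l' -> l = l'.
Proof.
have PU := @ultra_proper _ U UU; move=> H H'.
by apply: (cvg_unique _ H H'); exact: Rhausdorff.
Qed.

Lemma cvg_sumr (I : finType) (P : pred I) (f : I -> nat -> R) (l : I -> R) :
  (forall i, P i -> f i n @[n --> U] --> l i) ->
  \sum_(i | P i) f i n @[n --> U] --> \sum_(i | P i) l i.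
Proof.
move=> H; have PU := @ultra_proper _ U UU.
apply: cvg_big; [exact: add_continuous | exact: H].
Qed.

Lemma cvg_posp (u : nat -> R) (l : R) : u n @[n --> U] --> l ->
  Num.max (u n) 0 @[n --> U] --> Num.max l 0.
Proof.
move=> ul; have PU := @ultra_proper _ U UU.
apply/cvgrPdist_lt => e e0; have /cvgrPdist_lt/(_ e e0) := ul.
apply: filterS => n; apply: le_lt_trans.
have h1 := ler_norm (l - u n); have h2 := ler_norm (u n - l); rewrite distrC in h2.
rewrite ler_norml.
have [h3|h3] := leP l 0; have [h4|h4] := leP (u n) 0; lra.
Qed.

(** On a letter with [p a = 0] a positive [p_ n a] against a much smaller [q_ n a] would be
    uncontrolled, hence the support hypothesis; on the other letters [ac] keeps the denominator away
    from 0. *)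
Lemma cvg_dkl k (p_ q_ : nat -> 'I_k -> R) (p q : 'I_k -> R) : is_dist p -> is_dist q ->
  (forall a, p_ n a @[n --> U] --> p a) -> (forall a, q_ n a @[n --> U] --> q a) ->
  (\forall n \near U, forall a, p a = 0 -> p_ n a = 0) -> ac p q ->
  dkl (p_ n) (q_ n) @[n --> U] --> dkl p q.
Proof.
move=> dp dq cp cq z acpq; have PU := @ultra_proper _ U UU.
apply: cvg_sumr => a _; have := dp.1 a; rewrite le0r => /orP[/eqP pa|pa].
  rewrite pa mul0r; apply: cvg_near_cst; apply: filterS z => n /(_ a pa) ->.
  by rewrite mul0r.
have qa := ac_gt0 dq acpq pa.
apply: cvgM; first exact: cp.
apply: (@continuous_cvg _ R R U _ (fun n => p_ n a / q_ n a) (@ln R)).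
  by apply: continuous_ln; rewrite divr_gt0.
by apply: cvgM; [exact: cp | apply: cvgV; [rewrite gt_eqF | exact: cq]].
Qed.

(* Where p charges a letter, p ln (p / q) <= B + n bounds q from below, so that
   absolute continuity survives in the limit. *)
Lemma dkl_lsc k (p_ q_ : nat -> 'I_k -> R) (p q : 'I_k -> R) (b_ : nat -> R) (b : R) :
  is_dist p -> is_dist q ->
  (forall n, is_dist (p_ n)) -> (forall n, is_dist (q_ n)) ->
  (forall a, p_ n a @[n --> U] --> p a) -> (forall a, q_ n a @[n --> U] --> q a) ->
  (forall n, ac (p_ n) p) -> (forall n, ac (p_ n) (q_ n)) ->
  (forall n, dkl (p_ n) (q_ n) <= b_ n) -> b_ n @[n --> U] --> b ->
  ac p q /\ dkl p q <= b.
Proof.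
move=> dp dq dp_ dq_ cp cq a_ aq_ db cb; have PU := @ultra_proper _ U UU.
have acpq : ac p q.
  move=> a qa; apply/eqP; rewrite eq_le dp.1 andbT leNgt; apply/negP => pa.
  have bb : \forall n \near U, b_ n <= b + 1.
    have /cvgrPdist_lt/(_ 1 ltr01) := cb; apply: filterS => n.
    rewrite distrC => /ltW /(le_trans (ler_norm _)); lra.
  have pp : \forall n \near U, p a / 2 <= p_ n a.
    have pa2 : 0 < p a / 2 by rewrite divr_gt0.
    have /cvgrPdist_lt/(_ _ pa2) := cp a; apply: filterS => n.
    move=> /ltW /(le_trans (ler_norm _)); lra.
  (* Every other letter contributes at least -1 to the divergence, which leaves at most
     [|b| + 1 + k] for the letter [a]. *)
  pose C := (`|b| + 1 + k%:R) / (p a / 2).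
  have C0 : 0 <= `|b| + 1 + k%:R :> R by rewrite !addr_ge0.
  have qq : \forall n \near U, p a / 2 * expR (- C) <= q_ n a.
    apply: filterS2 bb pp => n bn pn.
    have pn0 : 0 < p_ n a by apply: lt_le_trans pn; rewrite divr_gt0.
    have qn0 := ac_gt0 (dq_ n) (aq_ n) pn0.
    have H : p_ n a * ln (p_ n a / q_ n a) <= `|b| + 1 + k%:R.
      have : dkl (p_ n) (q_ n) <= `|b| + 1.
        by apply: le_trans (db n) _; apply: le_trans bn _; rewrite lerD2r ler_norm.
      rewrite /dkl (bigD1 a) //=.
      have : - k%:R <= \sum_(i < k | i != a) p_ n i * ln (p_ n i / q_ n i).
        apply: (@le_trans _ _ (\sum_(i < k | i != a) (-1))).
          rewrite sumr_const mulNrn lerN2 ler_nat; apply: leq_trans (max_card _) _.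
          by rewrite card_ord.
        by apply: ler_sum => i _; apply: dkl_term_ge.
      lra.
    have Hl : ln (p_ n a / q_ n a) <= C.
      have : ln (p_ n a / q_ n a) <= (`|b| + 1 + k%:R) / p_ n a by rewrite ler_pdivlMr // mulrC.
      move=> /le_trans; apply; rewrite ler_wpM2l // lef_pV2 ?posrE //; lra.
    have : p_ n a / q_ n a <= expR C by rewrite -[leLHS]lnK ?posrE ?divr_gt0 // ler_expR.
    rewrite ler_pdivrMr // => H2; rewrite expRN ler_pdivrMr ?expR_gt0 // [leRHS]mulrC.
    exact: le_trans pn H2.
  have := @cvgr_to_ge _ U PU _ _ _ _ (cq a) qq; rewrite qa leNgt mulr_gt0 ?expR_gt0 ?divr_gt0 //.
split=> //; apply: ler_cvg_to _ cb _.
  apply: (@cvg_dkl k p_ q_ p q) => //.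
  by apply: nearW => n a pa; exact: a_.
by apply: nearW.
Qed.

Lemma dist_cvg k (q_ : nat -> 'I_k -> R) (q : 'I_k -> R) :
  (forall n, is_dist (q_ n)) -> (forall a, q_ n a @[n --> U] --> q a) -> is_dist q.
Proof.
move=> dq cq; have PU := @ultra_proper _ U UU; split.
  move=> a; apply: cvgr_to_ge (cq a) _; apply: nearW => n; exact: (dq n).1.
have H : \sum_(a < k) q_ n a @[n --> U] --> \sum_a q a.
  by apply: cvg_sumr => a _; exact: cq.
apply: ultra_lim_unique H _.
by apply: cvg_near_cst; apply: nearW => n; exact: (dq n).2.
Qed.

Lemma dist_compact k (q_ : nat -> 'I_k -> R) : (forall n, is_dist (q_ n)) ->
  exists q, is_dist q /\ forall a, q_ n a @[n --> U] --> q a.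
Proof.
move=> dq; have PU := @ultra_proper _ U UU.
have /choice[q Hq] : forall a, exists l : R, q_ n a @[n --> U] --> l.
  move=> a; apply: (@ultra_cvg _ 1); apply: nearW => n.
  by rewrite ger0_norm ?(dq n).1 // dist_le1.
by exists q; split=> //; exact: dist_cvg Hq.
Qed.

End UltraLimits.

(** * The feasible set for data close to the truth *)

Section Perturbation.
Context {R : realType} {N M A : nat}.
Variables (L : 'M[R]_(N, M)) (h : 'I_N -> 'I_M -> 'I_A) (pstar : 'I_M -> R) (i1 : 'I_N).
Hypothesis dstar : is_dist pstar.
Implicit Types (p q : 'I_M -> R) (i j k : 'I_N) (ps : 'I_N -> 'I_A -> R) (ds r : 'I_N -> R).

Local Notation S := (Sq h).
Local Notation star i := (Sq h i pstar).

Section Limits.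
Context {U : set_system nat} {UU : UltraFilter U}.

Lemma lossv_cvg i (q_ : nat -> 'I_M -> R) q : (forall m, q_ n m @[n --> U] --> q m) ->
  lossv L i (q_ n) @[n --> U] --> lossv L i q.
Proof.
have PU := @ultra_proper _ U UU.
by move=> cq; apply: cvg_sumr => m _; apply: cvgM; [exact: cvg_cst | exact: cq].
Qed.

Lemma Sq_cvg i (q_ : nat -> 'I_M -> R) q a : (forall m, q_ n m @[n --> U] --> q m) ->
  S i (q_ n) a @[n --> U] --> S i q a.
Proof.
have PU := @ultra_proper _ U UU.
by move=> cq; apply: cvg_sumr => m _; apply: cvgM; [exact: cvg_cst | exact: cq].
Qed.

Lemma harmonic_squeeze (u : nat -> R) (l : R) : \oo `<=` U ->
  (forall n, `|u n - l| <= harmonic n) -> u n @[n --> U] --> l.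
Proof.
move=> hU H; have PU := @ultra_proper _ U UU.
apply/cvgrPdist_lt => e e0.
have /cvgrPdist_lt/(_ e e0)/hU := @cvg_harmonic R; apply: filterS => n.
rewrite sub0r normrN ger0_norm ?harmonic_ge0 // => /(le_lt_trans (H n)).
by rewrite distrC.
Qed.

End Limits.

Lemma harmonic_le1 n : harmonic n <= 1 :> R.
Proof. by rewrite /harmonic /= invf_le1 // ler1n. Qed.

(* Some opponent strategy preferring k cannot be told from pstar by playing i1. *)
Definition confusable k :=
  exists p', [/\ is_dist p', S i1 p' =1 star i1 & lossv L k p' <= lossv L i1 p'].

Lemma not_confusable_far k : ~ confusable k -> exists rho : R, 0 < rho /\
  forall q, is_dist q -> (forall a, `|S i1 q a - star i1 a| <= rho) ->
    lossv L i1 q < lossv L k q.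
Proof.
move=> nc; apply: contrapT => H.
have /choice[q_ Hq] : forall n, exists q, [/\ is_dist q,
    forall a, `|S i1 q a - star i1 a| <= harmonic n & lossv L k q <= lossv L i1 q].
  move=> n; apply: contrapT => H'; apply: H; exists (harmonic n); split=> //.
    exact: harmonic_gt0.
  move=> q dq Hq; rewrite ltNge; apply/negP => lk; apply: H'; by exists q.
have [U [UU hU]] := ultra_nat; have PU := @ultra_proper _ U UU.
have [q [dq cq]] := @dist_compact R U UU _ q_ (fun n => let: And3 d _ _ := Hq n in d).
apply: nc; exists q; split=> //.
  move=> a; have Hc := @Sq_cvg U UU i1 q_ q a cq.
  have Hd : S i1 (q_ n) a @[n --> U] --> star i1 a.
    by apply: harmonic_squeeze => // n; have [_ + _] := Hq n; apply.
  exact: ultra_lim_unique Hc Hd.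
apply: (@ler_cvg_to nat U PU R _ _ _ _ (@lossv_cvg U UU k q_ q cq) (@lossv_cvg U UU i1 q_ q cq)).
by apply: nearW => n; have [] := Hq n.
Qed.

Lemma uniform_radius (I : finType) (P : I -> R -> Prop) :
  (forall x : I, exists rho : R, 0 < rho /\ forall rho' : R, rho' <= rho -> P x rho') ->
  exists rho : R, 0 < rho /\ forall (x : I) (rho' : R), rho' <= rho -> P x rho'.
Proof.
move=> /choice[rho_ H]; exists (\big[Num.min/1]_x rho_ x); split.
  by apply: lt_bigmin => // x _; have [] := H x.
move=> x rho' le_rho; apply: (H x).2; apply: le_trans le_rho _; exact: bigmin_le.
Qed.

(** The properties of good empirical data: [nd_ac] reflects that symbols of probability 0 are never
    observed, and the strictness of [nd_opt] leaves room to move feasible points. *)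
Record near_data (rho : R) ps ds : Prop := NearData {
  nd_dist : forall i, is_dist (ps i);
  nd_ac : forall i, ac (ps i) (star i);
  nd_close : forall i a, `|ps i a - star i a| <= rho;
  nd_pos : forall i, 0 <= ds i;
  nd_le : forall i, ds i <= rho;
  nd_opt : dkl (ps i1) (star i1) < ds i1 }.

(* Feasible points can be pushed, inside the feasible set, to points where all
   the relative entropies are finite: a half-simplex meeting the feasible set
   contains a point indistinguishable from pstar, and a small move from it into
   the open half-simplex stays feasible because of the strict inequality
   [nd_opt]. *)
Lemma feas_mix : exists rho0 : R, 0 < rho0 /\ forall rho ps ds, rho <= rho0 ->
  near_data rho ps ds -> forall q, feas L h i1 ps ds q ->
  exists q', [/\ is_dist q', forall i, ac (ps i) (S i q') &
    forall e, 0 < e -> e <= 1 -> feas L h i1 ps ds (mix e q q')].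
Proof.
have [rho1 [rho1_gt0 H1]] : exists rho, 0 < rho /\ forall k q, is_dist q ->
     (forall a, `|S i1 q a - star i1 a| <= rho) ->
     lossv L k q <= lossv L i1 q -> confusable k.
  have [|rho [rho_gt0 H]] := @uniform_radius 'I_N (fun k rho =>
   forall q, is_dist q -> (forall a, `|S i1 q a - star i1 a| <= rho) ->
     lossv L k q <= lossv L i1 q -> confusable k); last first.
    by exists rho; split=> // k; exact: H.
  move=> k; have [c|nc] := pselect (confusable k).
    by exists 1; split.
  have [rho [rho_gt0 H]] := not_confusable_far nc; exists rho; split=> // rho' le_rho q dq Hq.
  rewrite leNgt H // => a; exact: le_trans le_rho.
(* A feasible [q] has [S i1 q] within [2 * sqrt rho0] of [ps i1], which is within [rho0] of the
   truth; each distance is allotted half of [rho1]. *)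
have [rho0 [rho0_gt0 [rho0_le]]] : exists rho0 : R, 0 < rho0 /\ rho0 <= rho1 / 2 /\ 2 * Num.sqrt rho0 <= rho1 / 2.
  exists (Num.min (rho1 / 2) ((rho1 / 4) ^+ 2)); split; last split.
  - by rewrite lt_min divr_gt0 //= exprn_gt0 // divr_gt0.
  - by rewrite ge_min lexx.
  - have : Num.sqrt (Num.min (rho1 / 2) ((rho1 / 4) ^+ 2)) <= rho1 / 4.
      have r4 : 0 <= rho1 / 4 by lra.
      rewrite -[leRHS](ger0_norm r4) -sqrtr_sqr.
      by apply: ler_wsqrtr; rewrite ge_min lexx orbT.
    lra.
move=> rho0_sq.
exists rho0; split=> // rho ps ds le_rho [dps aps cps ds0 dsle dopt] q [Kq aq dq].
have [distq [k [kj lk [q1 [dq1 lq1]]]]] := relcl_CcompP Kq.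
have [p' [dp' Sp' lp']] : confusable k.
  apply: (H1 k q) => // a.
  have := pinsker a (dps i1) (Sq_dist h i1 distq) aq dq; have := cps i1 a.
  have : Num.sqrt (ds i1) <= Num.sqrt rho0 by apply: ler_wsqrtr; apply: le_trans (dsle _) le_rho.
  have -> : S i1 q a - star i1 a = (ps i1 a - star i1 a) - (ps i1 a - S i1 q a) by ring.
  have := ler_normB (ps i1 a - star i1 a) (ps i1 a - S i1 q a); lra.
pose gamma := ds i1 - dkl (ps i1) (star i1).
have g0 : 0 < gamma by rewrite subr_gt0.
(* With [1 - e = expR (- gamma)], a law that is at least [1 - e] times the true one costs no more
   than the slack [gamma]. *)
have [e [e0 e1 He]] : exists e : R, [/\ 0 < e, e < 1 & - ln (1 - e) <= gamma].
  exists (1 - expR (- gamma)); split.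
  - by rewrite subr_gt0 -expR0 ltr_expR oppr_lt0.
  - by rewrite ltrBlDr ltrDl expR_gt0.
  - by rewrite opprB addrC subrK expRK opprK.
pose u := mix e p' q1.
have du : is_dist u by apply: mix_dist => //; exact: ltW.
(* A small weight on [pstar] makes all divergences finite; it is chosen so small that [k] is still
   strictly preferred. *)
have [k' k'0 k'le] : exists2 f : R, 0 < f <= 1 & lossv L k (mix f u pstar) < lossv L i1 (mix f u pstar).
  pose d := lossv L i1 u - lossv L k u.
  have d0 : 0 < d.
    rewrite subr_gt0 !lossv_mix ler_ltD // ?ltr_pM2l // ler_wpM2l // subr_ge0 ltW //.
  pose c := `|lossv L k pstar - lossv L i1 pstar| + d.
  have c0 : 0 < c by rewrite ltr_wpDl.
  exists (d / 2 / c); first rewrite !divr_gt0 //= ler_pdivrMr // mul1r.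
    have : 0 <= `|lossv L k pstar - lossv L i1 pstar| by []. rewrite /c; lra.
  rewrite !(lossv_mix _ _ (d / 2 / c)).
  have e2 : (d / 2 / c) * (lossv L k pstar - lossv L i1 pstar + d) <= d / 2.
    rewrite -mulrA ger_pMr ?divr_gt0 // mulrC ler_pdivrMr // mul1r /c lerD2r.
    exact: ler_norm.
  rewrite -subr_gt0; move: e2; move: (d / 2 / c) => f e2.
  rewrite (_ : _ - _ = d - f * (lossv L k pstar - lossv L i1 pstar + d)); last by rewrite /d; ring.
  lra.
case/andP: k'0 => k'0 k'1.
pose q' := mix k' u pstar.
have dq' : is_dist q' by apply: mix_dist => //; exact: ltW.
have aq' i : ac (ps i) (S i q').
  have [] := @dkl_scale_le R A (ps i) (star i) (S i q') k' (dps i) _ _ (aps i) k'0 _ => //.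
  - exact: Sq_dist.
  - exact: Sq_dist.
  - move=> a; rewrite Sq_mix /mix lerDr mulr_ge0 // ?subr_ge0 //.
    by have [+ _] := Sq_dist h i du; apply.
exists q'; split=> // f f0 f1.
have dd : dkl (ps i1) (S i1 q') <= ds i1.
  have [] := @dkl_scale_le R A (ps i1) (star i1) (S i1 q') (1 - e) (dps i1) _ _ (aps i1) _ _ => //.
  - exact: Sq_dist.
  - exact: Sq_dist.
  - by rewrite subr_gt0.
  - move=> a; rewrite Sq_mix /mix Sq_mix /mix Sp'.
    have [h1 _] := Sq_dist h i1 dq1; have [h2 _] := Sq_dist h i1 dstar.
    have := h1 a; have := h2 a; move: (star i1 a) (S i1 q1 a) => x y x0 y0.
    have : 0 <= (1 - k') * (e * y) by rewrite !mulr_ge0 // ?subr_ge0 // ltW.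
    have : 0 <= k' * e * x by rewrite !mulr_ge0 // ltW.
    lra.
  - by move=> _ /le_trans; apply; rewrite -lerBrDl.
have dm : is_dist (mix f q q') by apply: mix_dist => //; exact: ltW.
split.
- by apply: Ccomp_sub_relcl; apply: (@mix_Ccomp _ _ _ L i1 k).
- move=> a; rewrite Sq_mix /mix => m0.
  have [h1 _] := Sq_dist h i1 distq; have [h2 _] := Sq_dist h i1 dq'.
  apply: (aq' i1); apply/eqP; rewrite eq_le h2 andbT -(pmulr_rle0 _ f0).
  have : 0 <= (1 - f) * S i1 q a by rewrite mulr_ge0 // subr_ge0.
  lra.
- rewrite (_ : S i1 _ = mix f (S i1 q) (S i1 q')); last by apply: funext => a; rewrite Sq_mix.
  apply: le_trans (dkl_mix_le (ltW f0) f1 (dps i1) (Sq_dist h i1 distq) (Sq_dist h i1 dq') aq (aq' i1)) _.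
  have -> : ds i1 = (1 - f) * ds i1 + f * ds i1 by ring.
  by rewrite lerD // ler_wpM2l // ?subr_ge0 // ltW.
Qed.

End Perturbation.

(** * Existence and stability of the optimal vectors *)

Section Optimizers.
Context {R : realType} {N M A : nat}.
Variables (L : 'M[R]_(N, M)) (h : 'I_N -> 'I_M -> 'I_A) (pstar : 'I_M -> R) (i1 : 'I_N).
Hypothesis dstar : is_dist pstar.
Implicit Types (p q : 'I_M -> R) (i j k : 'I_N) (ps : 'I_N -> 'I_A -> R) (ds r : 'I_N -> R).

Local Notation S := (Sq h).
Local Notation star i := (Sq h i pstar).

Lemma le_of_mix (x y : R) : (forall e, 0 < e -> e <= 1 -> 1 <= (1 - e) * x + e * y) -> 1 <= x.
Proof.
move=> H; rewrite leNgt; apply/negP => x1.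
have := normr_ge0 y; have := ler_norm y => y1 y0.
pose e := (1 - x) / (1 - x + `|y| + 1).
have d0 : 0 < 1 - x + `|y| + 1 by lra.
have := H e _ _; rewrite /e divr_gt0 ?subr_gt0 // ler_pdivrMr // mul1r.
move=> /(_ isT); have -> : 1 - x <= 1 - x + `|y| + 1 by lra.
move=> /(_ isT).
have -> : (1 - (1 - x) / (1 - x + `|y| + 1)) * x + (1 - x) / (1 - x + `|y| + 1) * y
   = x + (1 - x) * ((y - x) / (1 - x + `|y| + 1)) by ring.
have : (y - x) / (1 - x + `|y| + 1) < 1 by rewrite ltr_pdivrMr // mul1r; lra.
move=> f1; have : (1 - x) * ((y - x) / (1 - x + `|y| + 1)) < (1 - x) * 1 by rewrite ltr_pM2l // subr_gt0.
lra.
Qed.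

Lemma excess_mix ps ds i e q q' : 0 <= e -> e <= 1 -> is_dist (ps i) ->
  is_dist q -> is_dist q' -> ac (ps i) (S i q) -> ac (ps i) (S i q') ->
  excess h ps ds i (mix e q q') <= (1 - e) * excess h ps ds i q + e * excess h ps ds i q'.
Proof.
move=> e0 e1 dp dq dq' a a'; rewrite ge_max; apply/andP; split; last first.
  by rewrite addr_ge0 // mulr_ge0 ?excess_ge0 // subr_ge0.
rewrite (_ : S i _ = mix e (S i q) (S i q')); last by apply: funext => b; rewrite Sq_mix.
apply: (@le_trans _ _ ((1 - e) * (dkl (ps i) (S i q) - ds i) + e * (dkl (ps i) (S i q') - ds i))).
  have := dkl_mix_le e0 e1 dp (Sq_dist h i dq) (Sq_dist h i dq') a a'; lra.
by rewrite lerD // ler_wpM2l ?subr_ge0 // /excess le_max lexx.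
Qed.

Lemma Sq_mix_ac (p : 'I_A -> R) i e q q' : 0 < e -> e <= 1 -> is_dist q -> is_dist q' ->
  ac p (S i q') -> ac p (S i (mix e q q')).
Proof.
move=> e0 e1 dq dq' a b; rewrite Sq_mix /mix => m0; apply: a.
have [h1 _] := Sq_dist h i dq; have [h2 _] := Sq_dist h i dq'.
apply/eqP; rewrite eq_le h2 andbT -(pmulr_rle0 _ e0).
have : 0 <= (1 - e) * S i q b by rewrite mulr_ge0 // subr_ge0.
lra.
Qed.

Lemma costr_ge p r (i : 'I_N) : (forall k, k != i1 -> lossv L i1 p <= lossv L k p) ->
  (forall k, 0 <= r k) -> i != i1 -> r i * (lossv L i p - lossv L i1 p) <= costr L i1 p r.
Proof.
move=> Hp r0 ij; rewrite /costr (bigD1 i) //= lerDl; apply: sumr_ge0 => k /andP[kj _].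
by rewrite mulr_ge0 // subr_ge0 Hp.
Qed.

(** A minimizing sequence is bounded because all cost coefficients are positive. Its limit may
    vanish at an [i] where the sequence does not, so constraints are passed to the limit at mixtures
    with finite divergences; convexity of the excess then lets the mixing weight tend to 0. *)
Lemma Rstar_nonempty : exists rho0 : R, 0 < rho0 /\ forall rho ps ds p, rho <= rho0 ->
  near_data h pstar i1 rho ps ds -> (forall i, i != i1 -> lossv L i1 p < lossv L i p) ->
  (exists r, Rset L h i1 ps ds r) -> exists r, Rstar L h i1 p ps ds r.
Proof.
have [rho0 [rho0_gt0 H0]] := @feas_mix R N M A L h pstar i1 dstar.
exists rho0; split=> // rho ps ds p le_rho nd Hp [r0 Rr0].
pose X := [set costr L i1 p r | r in Rset L h i1 ps ds].
have X0 : has_lbound X.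
  exists 0 => _ [r [rj [rp _]] <-]; apply: sumr_ge0 => i ij.
  by rewrite mulr_ge0 // subr_ge0 ltW // Hp.
have hX : has_inf X by split=> //; exists (costr L i1 p r0); exists r0.
have /choice[r_ Hr] : forall n, exists r, Rset L h i1 ps ds r /\ costr L i1 p r < inf X + harmonic n.
  move=> n; have [_ [r Rr <-] cr] := inf_adherent (harmonic_gt0 n) hX.
  by exists r.
have [U [UU hU]] := ultra_nat; have PU := @ultra_proper _ U UU.
have /choice[r Hrl] : forall i, exists l : R, r_ n i @[n --> U] --> l.
  move=> i; have [->|ij] := eqVneq i i1.
    exists 0; apply: cvg_near_cst; apply: nearW => n; by have [[]] := Hr n.
  have g0 : 0 < lossv L i p - lossv L i1 p by rewrite subr_gt0 Hp.
  apply: (@ultra_cvg _ _ _ _ ((inf X + 1) / (lossv L i p - lossv L i1 p))); apply: nearW => n.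
  have [[rj [rp _]] cr] := Hr n.
  rewrite ger0_norm // ler_pdivlMr //; apply: (@le_trans _ _ (costr L i1 p (r_ n))).
    by apply: costr_ge => // k kj; rewrite ltW // Hp.
  by apply: ltW; apply: lt_le_trans cr _; rewrite lerD2l harmonic_le1.
exists r; apply/RstarP; split; last first.
  move=> r' Rr'; apply: (@le_trans _ _ (inf X)); last first.
    by apply: ge_inf => //; exists r'.
  apply/ler_addgt0Pr => e e0.
  have ce : costr L i1 p (r_ n) @[n --> U] --> costr L i1 p r.
    by apply: cvg_sumr => i _; apply: cvgM; [exact: Hrl | exact: cvg_cst].
  apply: cvgr_to_le ce _.
  have /cvgrPdist_lt/(_ e e0)/hU := @cvg_harmonic R; apply: filterS => n.
  rewrite sub0r normrN ger0_norm ?harmonic_ge0 // => he.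
  by have [_ cr] := Hr n; apply: ltW; apply: lt_trans cr _; rewrite ltrD2l.
apply/RsetP; split.
- apply: (@ultra_lim_unique _ U _ (fun n => r_ n i1)) => //.
  by apply: cvg_near_cst; apply: nearW => n; have [[]] := Hr n.
- move=> i; apply: cvgr_to_ge (Hrl i) _; apply: nearW => n; by have [[_ []]] := Hr n.
move=> q Fq aq; have [Kq _ _] := Fq; have [dq _] := Kq.
have [q' [dq' aq' Fm]] := H0 _ _ _ le_rho nd q Fq.
have rge0 i : 0 <= r i.
  apply: cvgr_to_ge (Hrl i) _; apply: nearW => n; by have [[_ []]] := Hr n.
apply: (@le_of_mix _ (\sum_(i < N | i != i1) r i * excess h ps ds i q')) => e e0 e1.
have H1 : 1 <= \sum_(i < N | i != i1) r i * excess h ps ds i (mix e q q').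
  have ce : \sum_(i < N | i != i1) r_ n i * excess h ps ds i (mix e q q') @[n --> U] -->
     \sum_(i < N | i != i1) r i * excess h ps ds i (mix e q q').
    by apply: cvg_sumr => i _; apply: cvgM; [exact: Hrl | exact: cvg_cst].
  apply: cvgr_to_ge ce _; apply: nearW => n; have [Rr _] := Hr n.
  have /RsetP[_ _ ] := Rr; apply; first exact: Fm.
  by move=> i ij _; exact: Sq_mix_ac.
apply: le_trans H1 _; rewrite !mulr_sumr -big_split /=; apply: ler_sum => i ij.
have := rge0 i; rewrite le0r => /orP[/eqP ->|ri]; first by rewrite !mul0r !mulr0 addr0.
rewrite mulrCA [e * _]mulrCA -mulrDr ler_pM2l //.
apply: excess_mix => //; [exact: ltW | exact: (nd_dist nd) | exact: aq].
Qed.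

Variable ropt : 'I_N -> R.
Hypothesis Ropt : Rstar L h i1 pstar (fun i => star i) (fun _ => 0) = [set ropt].
Hypothesis opt : forall i, i != i1 -> lossv L i1 pstar < lossv L i pstar.

Let Rset_ropt : Rset L h i1 (fun i => star i) (fun _ => 0) ropt.
Proof. by have [] : Rstar L h i1 pstar (fun i => star i) (fun _ => 0) ropt by rewrite Ropt. Qed.

Definition inflate (e : R) : 'I_N -> R := fun i => if i == i1 then 0 else ropt i + e.

(** Suppose it fails for data tending to the truth. Every inflated coefficient is at least [e], so a
    sum below 1 bounds each excess by [1 / e] and semicontinuity applies. The limits [x i] of the
    excesses satisfy [sum (ropt + e) * x <= 1 <= sum ropt * x], so all of them vanish, which
    contradicts the second inequality. *)
Lemma Rset_inflate (e : R) : 0 < e -> exists rho0 : R, 0 < rho0 /\ forall rho ps ds, rho <= rho0 ->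
  near_data h pstar i1 rho ps ds -> Rset L h i1 ps ds (inflate e).
Proof.
move=> e0; apply: contrapT => H; have /RsetP[rj r0 Hr] := Rset_ropt.
have infE i : i != i1 -> inflate e i = ropt i + e by rewrite /inflate => /negbTE ->.
have inf0 i : 0 <= inflate e i.
  by rewrite /inflate; case: ifP => // _; rewrite addr_ge0 // ltW.
have /choice[x_ Hx] : forall n, exists x : ('I_N -> 'I_A -> R) * ('I_N -> R) * ('I_M -> R),
    [/\ near_data h pstar i1 (harmonic n) x.1.1 x.1.2, feas L h i1 x.1.1 x.1.2 x.2,
      forall i, i != i1 -> ac (x.1.1 i) (S i x.2) &
      \sum_(i | i != i1) inflate e i * excess h x.1.1 x.1.2 i x.2 < 1].
  move=> n; apply: contrapT => H'; apply: H; exists (harmonic n); split; first exact: harmonic_gt0.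
  move=> rho ps ds le_rho nd; apply/RsetP; split=> //; first by rewrite /inflate eqxx.
  move=> q Fq aq; rewrite leNgt; apply/negP => Hs; apply: H'; exists (ps, ds, q) => /=; split=> //.
    case: nd => *; split=> //; move=> *; exact: le_trans le_rho.
  by move=> i ij; apply: aq => //; rewrite infE // ltr_wpDl.
pose ps_ n := (x_ n).1.1; pose ds_ n := (x_ n).1.2; pose q_ n := (x_ n).2.
have nd_ n : near_data h pstar i1 (harmonic n) (ps_ n) (ds_ n) by have [] := Hx n.
have Fq_ n : feas L h i1 (ps_ n) (ds_ n) (q_ n) by have [] := Hx n.
have aq_ n i : ac (ps_ n i) (S i (q_ n)).
  have [->|ij] := eqVneq i i1; first by have [] := Fq_ n.
  by have [_ _ + _] := Hx n; apply.
have Sx n : \sum_(i | i != i1) inflate e i * excess h (ps_ n) (ds_ n) i (q_ n) < 1 by have [] := Hx n.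
have [U [UU hU]] := ultra_nat; have PU := @ultra_proper _ U UU.
have dq_ n : is_dist (q_ n) by have [[]] := Fq_ n.
have [q [dq cq]] := @dist_compact R U UU _ q_ dq_.
have /choice[x Hxl] : forall i, exists l : R, i != i1 ->
    excess h (ps_ n) (ds_ n) i (q_ n) @[n --> U] --> l.
  move=> i; have [->|ij] := eqVneq i i1; first by exists 0.
  have [l Hl] : exists l : R, excess h (ps_ n) (ds_ n) i (q_ n) @[n --> U] --> l.
    apply: (@ultra_cvg _ _ _ _ (1 / e)); apply: nearW => n.
    rewrite ger0_norm ?excess_ge0 // ler_pdivlMr //; apply: ltW; apply: le_lt_trans (Sx n).
    rewrite (bigD1 i) //= ler_wpDr //.
      by apply: sumr_ge0 => k _; rewrite mulr_ge0 // excess_ge0.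
    by rewrite mulrC ler_wpM2r ?excess_ge0 // infE // lerDr.
  by exists l.
have x0 i : i != i1 -> 0 <= x i.
  by move=> ij; apply: cvgr_to_ge (Hxl i ij) _; apply: nearW => n; exact: excess_ge0.
have cds i : ds_ n i @[n --> U] --> (0 : R).
  apply: harmonic_squeeze => // n; rewrite subr0 ger0_norm; last exact: (nd_pos (nd_ n)).
  exact: (nd_le (nd_ n)).
have cps i a : ps_ n i a @[n --> U] --> star i a.
  by apply: harmonic_squeeze => // n; exact: (nd_close (nd_ n)).
have lsc i (b_ : nat -> R) (b : R) : (forall n, dkl (ps_ n i) (S i (q_ n)) <= b_ n) ->
    b_ n @[n --> U] --> b -> ac (star i) (S i q) /\ dkl (star i) (S i q) <= b.
  apply: (@dkl_lsc _ _ UU _ (fun n => ps_ n i) (fun n => S i (q_ n))) => //.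
  - exact: Sq_dist.
  - exact: Sq_dist.
  - by move=> n; exact: (nd_dist (nd_ n)).
  - by move=> n; exact: Sq_dist.
  - by move=> a; exact: Sq_cvg.
  - by move=> n; exact: (nd_ac (nd_ n)).
have lx i : i != i1 -> ac (star i) (S i q) /\ dkl (star i) (S i q) <= x i.
  move=> ij; apply: (lsc i (fun n => excess h (ps_ n) (ds_ n) i (q_ n) + ds_ n i)).
    by move=> n; rewrite -lerBlDr /excess le_max lexx.
  by rewrite -[x i]addr0; apply: cvgD; [exact: Hxl | exact: cds].
have [a1 d1] := lsc i1 (fun n => ds_ n i1) 0 (fun n => let: And3 _ _ d := Fq_ n in d) (cds i1).
have Fq : feas L h i1 (fun i => star i) (fun _ => 0) q.
  split=> //; apply: relcl_idem => // d d0.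
  have : \forall n \near U, forall m : 'I_M, `|q m - q_ n m| < d.
    by apply: filter_forall => m; have /cvgrPdist_lt/(_ d d0) := cq m.
  move=> /filter_ex[n Hn]; exists (q_ n); split=> //; by have [] := Fq_ n.
have S1 := Hr q Fq (fun i ij _ => (lx i ij).1).
have S2 : \sum_(i | i != i1) inflate e i * x i <= 1.
  have ce : \sum_(i | i != i1) inflate e i * excess h (ps_ n) (ds_ n) i (q_ n) @[n --> U] -->
     \sum_(i | i != i1) inflate e i * x i.
    by apply: cvg_sumr => i ij; apply: cvgM; [exact: cvg_cst | exact: Hxl].
  by apply: cvgr_to_le ce _; apply: nearW => n; exact: ltW.
have S3 : 1 <= \sum_(i | i != i1) ropt i * x i.
  apply: le_trans S1 _; apply: ler_sum => i ij; rewrite ler_wpM2l // ge_max x0 // andbT subr0.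
  by have [] := lx i ij.
have S4 : \sum_(i | i != i1) inflate e i * x i = \sum_(i | i != i1) ropt i * x i + \sum_(i | i != i1) e * x i.
  by rewrite -big_split; apply: eq_bigr => i ij; rewrite infE // mulrDl.
have S5 : \sum_(i | i != i1) e * x i = 0.
  apply/eqP; rewrite eq_le sumr_ge0 ?andbT; last by move=> i ij; rewrite mulr_ge0 ?x0 // ltW.
  lra.
have S6 i : i != i1 -> x i = 0.
  move=> ij; have /eqP := S5; rewrite psumr_eq0; last by move=> k kj; rewrite mulr_ge0 ?x0 // ltW.
  by move=> /allP/(_ i); rewrite mem_index_enum ij mulf_eq0 gt_eqF //= => /(_ isT)/eqP.
move: S3; rewrite big1 ?ler10 // => i ij; by rewrite S6 // mulr0.
Qed.

Hypothesis reg2 : relcl (relint (Ccomp L i1) `&` Sdelta h i1 pstar 0)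
  = relcl (relcl (Ccomp L i1) `&` Sdelta h i1 pstar 0).

(* Regularity condition (2) matters where some relative entropy is infinite:
   r i * excess is then discontinuous at r i = 0. *)
Lemma feas_approx q : feas L h i1 (fun i => star i) (fun _ => 0) q ->
  forall e : R, 0 < e -> exists q', [/\ Ccomp L i1 q', S i1 q' =1 star i1,
    forall i, ac (star i) (S i q') & forall m, `|q m - q' m| < e].
Proof.
move=> [Kq aq dq] e e0; have [dstq _] := Kq.
have : relcl (relcl (Ccomp L i1) `&` Sdelta h i1 pstar 0) q.
  split=> // d d0; exists q; split; last by move=> m; rewrite subrr normr0.
  by split=> //; split=> //; rewrite KL_ac // lee_fin.
rewrite -reg2 => -[_ /(_ _ (divr_gt0 e0 (ltr0Sn _ 1)))].
move=> [q' [[[Cq' [e' [e'0 Hq']]] [dq' /KL_le[a' d']]] qq']].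
have S' := dkl0_eq (Sq_dist h i1 dstar) (Sq_dist h i1 dq') a' d'.
have [f [f0 f1 fe fe']] : exists f : R, [/\ 0 < f, f <= 1, f < e' & f < e / 2].
  exists (Num.min 1 (Num.min e' (e / 2)) / 2).
  have m0 : 0 < Num.min 1 (Num.min e' (e / 2)) by rewrite !lt_min ltr01 e'0 divr_gt0.
  have m1 : Num.min 1 (Num.min e' (e / 2)) <= 1 by rewrite ge_min lexx.
  have m2 : Num.min 1 (Num.min e' (e / 2)) <= e' by rewrite !ge_min lexx orbT.
  have m3 : Num.min 1 (Num.min e' (e / 2)) <= e / 2 by rewrite !ge_min lexx !orbT.
  split; lra.
have q'm m : `|q' m - mix f q' pstar m| <= f.
  have -> : q' m - mix f q' pstar m = f * (q' m - pstar m) by rewrite /mix; ring.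
  rewrite normrM ger0_norm ?(ltW f0) // ger_pMr //.
  have := dstar.1 m; have := dq'.1 m; have := dist_le1 m dstar; have := dist_le1 m dq'.
  by move=> *; rewrite ler_norml; apply/andP; split; lra.
have dm : is_dist (mix f q' pstar) by apply: mix_dist => //; exact: ltW.
exists (mix f q' pstar); split.
- by apply: Hq' => // m; exact: le_lt_trans fe.
- by move=> a; rewrite Sq_mix /mix -S'; ring.
- by move=> i; apply: Sq_mix_ac.
- move=> m; rewrite (_ : _ - _ = (q m - q' m) + (q' m - mix f q' pstar m)); last by ring.
  apply: le_lt_trans (ler_normD _ _) _; rewrite [e]splitr; apply: ltrD => //.
  exact: le_lt_trans fe'.
Qed.

(** Optimizers for data tending to the truth have a limit that is admissible and costs at most as
    much as [ropt]; uniqueness identifies it with [ropt]. *)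
Lemma Rstar_le (k : 'I_N) (e : R) : 0 < e -> exists rho0 : R, 0 < rho0 /\
  forall rho ps ds p r, rho <= rho0 -> near_data h pstar i1 rho ps ds ->
    (forall i, `|(lossv L i p - lossv L i1 p) - (lossv L i pstar - lossv L i1 pstar)| <= rho) ->
    Rstar L h i1 p ps ds r -> r k <= ropt k + e.
Proof.
move=> e0; apply: contrapT => H.
have /choice[x_ Hx] : forall n, exists x : ('I_N -> 'I_A -> R) * ('I_N -> R) * ('I_M -> R) * ('I_N -> R),
    [/\ near_data h pstar i1 (harmonic n) x.1.1.1 x.1.1.2,
      forall i, `|(lossv L i x.1.2 - lossv L i1 x.1.2) - (lossv L i pstar - lossv L i1 pstar)| <= harmonic n,
      Rstar L h i1 x.1.2 x.1.1.1 x.1.1.2 x.2 & ropt k + e <= x.2 k].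
  move=> n; apply: contrapT => H'; apply: H; exists (harmonic n); split; first exact: harmonic_gt0.
  move=> rho ps ds p r le_rho nd cp Rr; rewrite leNgt; apply/negP => Hk.
  apply: H'; exists (ps, ds, p, r) => /=; split=> //; last exact: ltW.
    case: nd => *; split=> //; move=> *; exact: le_trans le_rho.
  by move=> i; exact: le_trans le_rho.
pose ps_ n := (x_ n).1.1.1; pose ds_ n := (x_ n).1.1.2; pose p_ n := (x_ n).1.2; pose r_ n := (x_ n).2.
have nd_ n : near_data h pstar i1 (harmonic n) (ps_ n) (ds_ n) by have [] := Hx n.
have Rr_ n : Rstar L h i1 (p_ n) (ps_ n) (ds_ n) (r_ n) by have [] := Hx n.
pose D i := lossv L i pstar - lossv L i1 pstar.
pose D_ n i := lossv L i (p_ n) - lossv L i1 (p_ n).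
have D0 i : i != i1 -> 0 < D i by move=> ij; rewrite subr_gt0 opt.
have DD n i : `|D_ n i - D i| <= harmonic n by have [_ + _ _] := Hx n; apply.
have [U [UU hU]] := ultra_nat; have PU := @ultra_proper _ U UU.
have cD i : D_ n i @[n --> U] --> D i by apply: harmonic_squeeze.
have small (d : R) : 0 < d -> \forall n \near U, harmonic n <= d.
  move=> d0; have /cvgrPdist_lt/(_ d d0)/hU := @cvg_harmonic R; apply: filterS => n.
  by rewrite sub0r normrN ger0_norm ?harmonic_ge0 // => /ltW.
have r0_ n i : 0 <= r_ n i by have [[_ []]] := Rr_ n.
(* Comparison with the inflated vector bounds the optimal costs from above; [d] tends to 0 only
   after the data do. *)
have upper d : 0 < d -> \forall n \near U, costr L i1 (p_ n) (r_ n) <= costr L i1 (p_ n) (inflate d).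
  move=> d0; have [rho0 [rho0_gt0 H0]] := Rset_inflate d0.
  apply: filterS (small _ rho0_gt0) => n hn; have /RstarP[_] := Rr_ n; apply.
  exact: H0 hn (nd_ n).
have cinf d : costr L i1 (p_ n) (inflate d) @[n --> U] --> costr L i1 pstar (inflate d).
  by apply: cvg_sumr => i _; apply: cvgM; [exact: cvg_cst | exact: cD].
have /choice[r Hrl] : forall i, exists l : R, r_ n i @[n --> U] --> l.
  move=> i; have [->|ij] := eqVneq i i1.
    exists 0; apply: cvg_near_cst; apply: nearW => n; by have [[]] := Rr_ n.
  have Di2 : 0 < D i / 2 by rewrite divr_gt0 // D0.
  pose B := costr L i1 pstar (inflate 1) + 1.
  have Bn : \forall n \near U, costr L i1 (p_ n) (inflate 1) <= B.
    have /cvgrPdist_lt/(_ 1 ltr01) := cinf 1; apply: filterS => n.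
    rewrite distrC => /ltW/(le_trans (ler_norm _)); rewrite /B; lra.
  apply: (@ultra_cvg _ _ _ _ (B / (D i / 2))).
  have sD : \forall n \near U, forall l : 'I_N, l != i1 -> D l / 2 <= D_ n l.
    apply: filter_forall => l; have [->|lj] := eqVneq l i1; first by apply: nearW.
    have l2 : 0 < D l / 2 by rewrite divr_gt0 // D0.
    apply: filterS (small _ l2) => n hn _; have := le_trans (DD n l) hn.
    rewrite ler_norml => /andP[]; lra.
  apply: filterS3 (upper 1 ltr01) Bn sD => n un bn sn.
  rewrite ger0_norm // ler_pdivlMr //; apply: (@le_trans _ _ (costr L i1 (p_ n) (r_ n))); last exact: le_trans bn.
  apply: (@le_trans _ _ (r_ n i * D_ n i)); first by rewrite ler_wpM2l // sn.
  apply: costr_ge => // l lj; rewrite -subr_ge0; apply: le_trans (sn l lj).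
  by rewrite divr_ge0 // ltW // D0.
have r0 i : 0 <= r i by apply: cvgr_to_ge (Hrl i) _; apply: nearW => n; exact: r0_.
have cr : costr L i1 (p_ n) (r_ n) @[n --> U] --> costr L i1 pstar r.
  by apply: cvg_sumr => i _; apply: cvgM; [exact: Hrl | exact: cD].
have costle : costr L i1 pstar r <= costr L i1 pstar ropt.
  have DS : 0 <= \sum_(i | i != i1) D i by apply: sumr_ge0 => i ij; rewrite ltW // D0.
  apply/ler_addgt0Pr => d d0.
  have d'0 : 0 < d / (1 + \sum_(i | i != i1) D i) by rewrite divr_gt0 // ltr_wpDr.
  apply: le_trans (@ler_cvg_to nat U PU R _ _ _ _ cr (cinf _) (upper _ d'0)) _.
  rewrite /costr (eq_bigr (fun i => ropt i * D i + d / (1 + \sum_(i | i != i1) D i) * D i)); last first.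
    by move=> i /negbTE ij; rewrite /inflate ij mulrDl.
  rewrite big_split /= lerD2l -mulr_sumr mulrAC ler_pdivrMr ?ltr_wpDr //.
  by rewrite ler_pM2l // lerDr.
have Rr : Rset L h i1 (fun i => star i) (fun _ => 0) r.
  apply/RsetP; split=> //.
    apply: (@ultra_lim_unique _ U _ (fun n => r_ n i1)) => //.
    by apply: cvg_near_cst; apply: nearW => n; have [[]] := Rr_ n.
  (* Such a [q'] is feasible for all the perturbed data by [nd_opt], and its divergences are finite,
     so its constraint passes to the limit. A general [q] is then reached through [feas_approx]. *)
  have step q' : Ccomp L i1 q' -> S i1 q' =1 star i1 -> (forall i, ac (star i) (S i q')) ->
      1 <= \sum_(i | i != i1) r i * excess h (fun i => star i) (fun _ => 0) i q'.
    move=> Cq' S' a'; have [dq' _] := Cq'.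
    have ce : \sum_(i | i != i1) r_ n i * excess h (ps_ n) (ds_ n) i q' @[n --> U] -->
       \sum_(i | i != i1) r i * excess h (fun i => star i) (fun _ => 0) i q'.
      apply: cvg_sumr => i ij; apply: cvgM; first exact: Hrl.
      apply: cvg_posp; apply: cvgB; last first.
        apply: harmonic_squeeze => // n; rewrite subr0 ger0_norm; last exact: (nd_pos (nd_ n)).
        exact: (nd_le (nd_ n)).
      apply: (@cvg_dkl _ _ _ _ (fun n => ps_ n i) (fun _ => S i q')) => //; try exact: Sq_dist.
      - by move=> a; apply: harmonic_squeeze => // n; exact: (nd_close (nd_ n)).
      - by move=> a; exact: cvg_cst.
      - by apply: nearW => n a sa; exact: (nd_ac (nd_ n)).
    apply: cvgr_to_ge ce _; apply: nearW => n.
    have /RstarP[/RsetP[_ _ + ] _] := Rr_ n; apply; last first.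
      by move=> i _ _ a sa; apply: (nd_ac (nd_ n)); exact: a'.
    have SE : S i1 q' = star i1 by apply: funext.
    split; [exact: Ccomp_sub_relcl | by rewrite SE; exact: (nd_ac (nd_ n)) |].
    by rewrite SE ltW // (nd_opt (nd_ n)).
  move=> q Fq aq; have [[dq _] _ _] := Fq.
  have /choice[q_ Hq] := fun n => feas_approx Fq (harmonic_gt0 n).
  have cq m : q_ n m @[n --> U] --> q m.
    by apply: harmonic_squeeze => // n; rewrite distrC ltW //; have [_ _ _] := Hq n; apply.
  have ce : \sum_(i | i != i1) r i * excess h (fun i => star i) (fun _ => 0) i (q_ n) @[n --> U] -->
       \sum_(i | i != i1) r i * excess h (fun i => star i) (fun _ => 0) i q.
    apply: cvg_sumr => i ij; have := r0 i; rewrite le0r => /orP[/eqP ->|ri].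
      by rewrite mul0r; apply: cvg_near_cst; apply: nearW => n; rewrite mul0r.
    apply: cvgM; first exact: cvg_cst.
    apply: cvg_posp; apply: cvgB; last exact: cvg_cst.
    apply: (@cvg_dkl _ _ _ _ (fun n => star i) (fun n => S i (q_ n))); try exact: Sq_dist.
    - by move=> a; exact: cvg_cst.
    - by move=> a; exact: Sq_cvg.
    - by apply: nearW => n a ->.
    - exact: aq.
  apply: cvgr_to_ge ce _; apply: nearW => n; have [Cq Sq' aq' _] := Hq n; exact: step.
have : Rstar L h i1 pstar (fun i => star i) (fun _ => 0) r.
  apply/RstarP; split=> // r' Rr'; apply: le_trans costle _.
  by have : Rstar L h i1 pstar (fun i => star i) (fun _ => 0) ropt; [rewrite Ropt | move=> /RstarP[_]; apply].
rewrite Ropt /= => rE.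
have : ropt k + e <= r k.
  by apply: cvgr_to_ge (Hrl k) _; apply: nearW => n; have [] := Hx n.
rewrite rE; lra.
Qed.

End Optimizers.

(** * Growth of iterated logarithms and decay of the tolerance *)

Section Growth.
Context {R : realType}.

Lemma expR_ge_pow (C : R) n : exists B, 0 < B /\ forall u, B <= u -> C * u ^+ n <= expR u.
Proof.
exists (`|C| * (n.+1)`!%:R + 1); split; first by rewrite ltr_wpDl // mulr_ge0.
move=> u Bu; have f0 : 0 < (n.+1)`!%:R :> R by rewrite ltr0n fact_gt0.
have B0 : 0 <= `|C| * (n.+1)`!%:R by rewrite mulr_ge0.
have u0 : 0 <= u by lra.
have := expR_ge1Dxn n u0; rewrite exprS => H.
have : C * u ^+ n <= u * u ^+ n / (n.+1)`!%:R.
  rewrite mulrAC ler_wpM2r ?exprn_ge0 // ler_pdivlMr //.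
  apply: (@le_trans _ _ (`|C| * (n.+1)`!%:R)); last by lra.
  by rewrite ler_wpM2r // ?ler_norm // ltW.
lra.
Qed.

Lemma near_ln_ge (B : R) : \forall t \near \oo, B <= ln (t%:R : R).
Proof.
apply: filterS (nbhs_infty_ger (expR B)) => t Bt.
by rewrite -[leLHS]expRK ler_ln ?posrE ?expR_gt0 // (lt_le_trans (expR_gt0 B)).
Qed.

Lemma near_lnln_ge (B : R) : \forall t \near \oo, B <= ln (ln (t%:R : R)).
Proof.
apply: filterS (near_ln_ge (expR B)) => t Bt.
by rewrite -[leLHS]expRK ler_ln ?posrE ?expR_gt0 // (lt_le_trans (expR_gt0 B)).
Qed.

Lemma fexp_le (b c y x : R) n : 0 < b -> 0 < c -> 0 < y -> c * Num.sqrt x <= n%:R ->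
  ((b / y) ^+ 2 / c) ^+ 2 <= x -> fexp b n <= y.
Proof.
move=> b0 c0 y0 cn Hx; rewrite /fexp.
have z0 : 0 < (b / y) ^+ 2 / c by rewrite divr_gt0 // exprn_gt0 // divr_gt0.
have H1 : (b / y) ^+ 2 / c <= Num.sqrt x.
  by rewrite -[leLHS](ger0_norm (ltW z0)) -sqrtr_sqr; exact: ler_wsqrtr.
have H2 : (b / y) ^+ 2 <= n%:R by apply: le_trans cn; rewrite [leRHS]mulrC -ler_pdivrMr.
have H3 : b / y <= Num.sqrt n%:R.
  have by0 : 0 <= b / y by rewrite divr_ge0 // ltW.
  by rewrite -[leLHS](ger0_norm by0) -sqrtr_sqr; exact: ler_wsqrtr.
rewrite ler_pdivrMr; first by rewrite mulrC -ler_pdivrMr.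
by apply: lt_le_trans H3; rewrite divr_gt0.
Qed.

End Growth.

Section Histories.
Context {R : realType} {N A : nat}.
Implicit Types (hs : history N A) (i : 'I_N).

Lemma phat_dist hs i : (0 < Ncnt hs i)%N -> is_dist (phat R hs i).
Proof.
move=> n0; split; first by move=> k; rewrite /phat divr_ge0.
rewrite /phat -mulr_suml -natr_sum.
rewrite (_ : (\sum_(k < A) count (fun s => (s.1 == i) && (s.2 == k)) hs)%N = Ncnt hs i).
  by rewrite divff // pnatr_eq0 -lt0n.
rewrite /Ncnt; elim: hs {n0} => [|s hs IH] /=; first by rewrite big1.
rewrite big_split /= IH; congr addn.
case: (s.1 == i) => /=; last by rewrite big1.
by rewrite (bigD1 s.2) //= eqxx big1 // => k; rewrite eq_sym => /negbTE ->.
Qed.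

End Histories.

(** * What the estimates imply at a single round *)

Section Rounds.
Context {R : realType} {N M A : nat}.
Variables (L : 'M[R]_(N, M)) (h : 'I_N -> 'I_M -> 'I_A) (pstar : 'I_M -> R) (i1 : 'I_N).
Hypothesis dstar : is_dist pstar.
Hypothesis GO : globally_observable L h.
Implicit Types (p q : 'I_M -> R) (i j k : 'I_N).

Local Notation S := (Sq h).
Local Notation star i := (Sq h i pstar).

(** Global observability makes loss differences linear functions of the feedback laws; [Y] dominates
    the coefficients, with 1 added for positivity. *)
Lemma observability : exists Y : R, 0 < Y /\ forall p q (d : R),
  0 <= d -> (forall k a, `|S k p a - S k q a| <= d) ->
  forall i j, `|(lossv L i p - lossv L j p) - (lossv L i q - lossv L j q)| <= Y * d.
Proof.
have /choice[y Hy] : forall x : 'I_N * 'I_N, exists y : 'I_N -> 'I_A -> R,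
    forall m, L x.1 m - L x.2 m = \sum_(k < N) \sum_(a < A) Smx R h k a m * y k a.
  by move=> [i j]; exact: GO.
pose Y := 1 + \sum_x \sum_(k < N) \sum_(a < A) `|y x k a|.
have Y0 x : 0 <= \sum_(k < N) \sum_(a < A) `|y x k a|.
  by apply: sumr_ge0 => k _; apply: sumr_ge0.
exists Y; split; first by rewrite ltr_pwDl //; apply: sumr_ge0 => x _.
move=> p q d d0 H i j.
have E r : lossv L i r - lossv L j r = \sum_(k < N) \sum_(a < A) y (i, j) k a * S k r a.
  rewrite /lossv -sumrB.
  under eq_bigr => m _ do rewrite -mulrBl (Hy (i, j)) mulr_suml.
  rewrite exchange_big /=; apply: eq_bigr => k _.
  under eq_bigr => m _ do rewrite mulr_suml.
  rewrite exchange_big /=; apply: eq_bigr => a _.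
  by rewrite /Sq mulr_sumr; apply: eq_bigr => m _; ring.
rewrite !E -sumrB; apply: (@le_trans _ _ (\sum_(k < N) \sum_(a < A) `|y (i, j) k a| * d)).
  apply: le_trans (ler_norm_sum _ _ _) _; apply: ler_sum => k _.
  rewrite -sumrB; apply: le_trans (ler_norm_sum _ _ _) _; apply: ler_sum => a _.
  by rewrite -mulrBr normrM ler_wpM2l.
under eq_bigr => k _ do rewrite -mulr_suml.
rewrite -mulr_suml ler_wpM2r // /Y (bigD1 (i, j)) //= addrA ler_wpDr //.
  by apply: sumr_ge0.
by rewrite lerDr.
Qed.

Variables (a b c : R).
Hypotheses (a0 : 0 < a) (b0 : 0 < b) (c0 : 0 < c).

Definition sampled (t : nat) (hs : history N A) :=
  forall i, (0 < Ncnt hs i)%N /\ c * Num.sqrt (ln t%:R) <= (Ncnt hs i)%:R.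

Local Notation ds hs := (fun i => fexp b (Ncnt hs i)).

Lemma fexp_ge0 n : 0 <= fexp b n.
Proof. by rewrite /fexp divr_ge0 ?sqrtr_ge0 // ltW. Qed.

Lemma near_fexp (y : R) : 0 < y -> \forall t \near \oo, forall hs, sampled t hs ->
  forall i, fexp b (Ncnt hs i) <= y.
Proof.
move=> y0; apply: filterS (near_ln_ge (((b / y) ^+ 2 / c) ^+ 2)) => t Ht hs sh i.
by have [_ si] := sh i; exact: fexp_le si Ht.
Qed.

Lemma consistent_close (ps : 'I_N -> 'I_A -> R) (es : 'I_N -> R) (x : R) p q :
  (forall i, is_dist (ps i)) -> is_dist p -> is_dist q ->
  (forall i, es i <= x) ->
  (forall i, ac (ps i) (S i p) /\ dkl (ps i) (S i p) <= es i) ->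
  (forall i, ac (ps i) (S i q) /\ dkl (ps i) (S i q) <= es i) ->
  forall i d, `|S i p d - S i q d| <= 4 * Num.sqrt x.
Proof.
move=> dps dp dq ex Hp Hq i d.
have [ap kp] := Hp i; have [aq kq] := Hq i.
have h1 := pinsker d (dps i) (Sq_dist h i dp) ap (le_trans kp (ex i)).
have h2 := pinsker d (dps i) (Sq_dist h i dq) aq (le_trans kq (ex i)).
have -> : S i p d - S i q d = (ps i d - S i q d) - (ps i d - S i p d) by ring.
apply: le_trans (ler_normB _ _) _; lra.
Qed.

(* A consistent margin [alpha t] makes every alternative strategy detectable
   with accuracy of order alpha^2, so a multiple of alpha^-2 is admissible and
   the optimal vector is at most of order alpha^-3. *)
Lemma near_Rstar_le_ln : \forall t \near \oo, forall hs j p r, sampled t hs ->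
  Calpha L j (alpha a t) p ->
  (forall i, (KL (phat R hs i) (S i p) <= (fexp b (Ncnt hs i))%:E)%E) ->
  Rstar L h j p (phat R hs) (ds hs) r -> forall k, r k <= ln t%:R.
Proof.
have [Y [Y0 HY]] := observability.
pose Lm := \sum_i \sum_m `|L i m|.
have Lm0 : 0 <= Lm by apply: sumr_ge0 => i _; apply: sumr_ge0.
(* The tolerance [y] below is of order [u ^ -2] and [fexp_le] asks for [ln t] of order [y ^ -4],
   whence the power 8. [K2] gathers the constants of the cubic bound on [r k]. *)
pose K1 := (b / (a / (8 * Y)) ^+ 2) ^+ 4 / c ^+ 2.
pose K2 := (N%:R * (8 * Y ^+ 2) * (2 * Lm)) / a ^+ 3.
have [B1 [B1_gt0 HB1]] := expR_ge_pow K1 8.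
have [B2 [B2_gt0 HB2]] := expR_ge_pow K2 3.
apply: filterS2 (near_lnln_ge B1) (near_lnln_ge B2) => t t1 t2 hs j p r sh [dp Cp] KLp Rr k.
set u := ln (ln t%:R) in t1 t2.
have u0 : 0 < u by exact: lt_le_trans t1.
have eu : expR u = ln t%:R.
  rewrite /u lnK // posrE ltNge; apply/negP => /ln0 u0'.
  by move: u0; rewrite /u u0' ltxx.
have al : alpha a t = a / u by [].
have al0 : 0 < a / u by rewrite divr_gt0.
pose y := (a / (8 * Y) / u) ^+ 2.
have y0 : 0 < y by rewrite exprn_gt0 // !divr_gt0 // mulr_gt0.
have fy i : fexp b (Ncnt hs i) <= y.
  have [_ si] := sh i; apply: fexp_le si _ => //.
  rewrite -eu; apply: le_trans (HB1 u t1); rewrite le_eqVlt; apply/orP; left; apply/eqP.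
  rewrite /y /K1; field; rewrite !gt_eqF //= ?mulr_gt0 //.
have dph i : is_dist (phat R hs i) by apply: phat_dist; have [] := sh i.
have sq_y : Num.sqrt y = a / (8 * Y) / u.
  by rewrite sqrtr_sqr ger0_norm // !divr_ge0 // ?mulr_ge0 // ltW.
(* Otherwise [observability] would make the loss differences of [k'] and [j] at [p] and [q] closer
   than the margin. The divergence of [i] is at least [9 * y]: one [y] absorbs the tolerance,
   [8 * y] is left. An arbitrary upper bound [B] serves both for [i = j] and for [i != j]. *)
have key q : relcl (Ccomp L j) q -> exists i, forall B : R, ac (phat R hs i) (S i q) ->
    dkl (phat R hs i) (S i q) <= B -> 0 <= B -> (a / u) ^+ 2 / (8 * Y ^+ 2) + y <= B.
  move=> Kq; have [dq [k' [k'j lk' _]]] := relcl_CcompP Kq.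
  have [i [d Hd]] : exists i d, a / u / Y <= `|S i p d - S i q d|.
    apply: contrapT => nH.
    have [e [e0 e1 He]] : exists e : R, [/\ 0 <= e, e < a / u / Y & forall i d, `|S i p d - S i q d| <= e].
      exists (\big[Num.max/0]_(x : 'I_N * 'I_A) `|S x.1 p x.2 - S x.1 q x.2|); split.
      - by elim/big_ind : _ => // x x' h1 h2; rewrite le_max h1.
      - apply: bigmax_lt => [|x _]; first by rewrite divr_gt0.
        by rewrite ltNge; apply/negP => h'; apply: nH; exists x.1, x.2.
      - by move=> i d; exact: (@le_bigmax _ _ _ 0 (fun x : 'I_N * 'I_A => `|S x.1 p x.2 - S x.1 q x.2|) (i, d)).
    have := HY p q e e0 He k' j; rewrite leNgt => /negP; apply.
    apply: (@lt_le_trans _ _ (a / u)); first by rewrite mulrC -ltr_pdivlMr.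
    apply: le_trans (ler_norm _); have := Cp k' k'j; rewrite al; lra.
  exists i => B aq dB B0.
  have h1 : `|phat R hs i d - S i p d| <= 2 * Num.sqrt y.
    have [ap kp] := KL_le (KLp i).
    exact: pinsker (dph i) (Sq_dist h i dp) ap (le_trans kp (fy i)).
  have h2 := pinsker d (dph i) (Sq_dist h i dq) aq dB.
  have h3 : a / u / Y <= 2 * Num.sqrt y + 2 * Num.sqrt B.
    apply: le_trans Hd _; rewrite (_ : S i p d - S i q d = (phat R hs i d - S i q d) - (phat R hs i d - S i p d)); last by ring.
    apply: le_trans (ler_normB _ _) _; lra.
  have ey : 8 * Num.sqrt y = a / u / Y by rewrite sq_y; field; rewrite !gt_eqF.
  have s0 : 0 <= Num.sqrt y by exact: sqrtr_ge0.
  have h4 : 3 * Num.sqrt y <= Num.sqrt B by lra.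
  have h5 : 9 * y <= B.
    have : (3 * Num.sqrt y) ^+ 2 <= Num.sqrt B ^+ 2.
      by rewrite lerXn2r ?nnegrE ?mulr_ge0 ?sqrtr_ge0.
    rewrite exprMn (sqr_sqrtr B0) (sqr_sqrtr (ltW y0)); lra.
  have -> : (a / u) ^+ 2 / (8 * Y ^+ 2) = 8 * y.
    rewrite /y; field; by rewrite !gt_eqF.
  lra.
have z0 : 0 < (a / u) ^+ 2 / (8 * Y ^+ 2) by rewrite !(divr_gt0, exprn_gt0, mulr_gt0).
(* The inverse of the surplus [8 * y], so that a single term of the sum already reaches 1. *)
pose r0 : 'I_N -> R := fun i => if i == j then 0 else (8 * Y ^+ 2) / (a / u) ^+ 2.
have w0 : 0 < (8 * Y ^+ 2) / (a / u) ^+ 2 by rewrite !(divr_gt0, exprn_gt0, mulr_gt0).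
have Rr0 : Rset L h j (phat R hs) (ds hs) r0.
  have r0p i : 0 <= r0 i by rewrite /r0; case: ifP => // _; exact: ltW.
  apply/RsetP; split=> //; first by rewrite /r0 eqxx.
  move=> q [Kq aj dj] aq; have [i Hi] := key q Kq.
  have [ij|ij] := eqVneq i j.
    have := Hi (ds hs j); rewrite ij => /(_ aj dj (fexp_ge0 _)); have := fy j; lra.
  have ai : ac (phat R hs i) (S i q) by apply: aq => //; rewrite /r0 (negbTE ij).
  have dq : is_dist q by case: Kq.
  have H := Hi _ ai (lexx _) (dkl_ge0 (dph i) (Sq_dist h i dq) ai).
  rewrite (bigD1 i) //= ler_wpDr //.
    by apply: sumr_ge0 => l _; rewrite mulr_ge0 // excess_ge0.
  rewrite {1}/r0 (negbTE ij) -ler_pdivrMl // mulr1 invf_div.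
  apply: (@le_trans _ _ (dkl (phat R hs i) (S i q) - ds hs i)); last by rewrite /excess le_max lexx.
  have := fy i; lra.
have /RstarP[Rr' Hmin] := Rr; have [rj [rp _]] := Rr'.
have [->|kj] := eqVneq k j; first by rewrite rj -eu ltW // expR_gt0.
have Lb i q : is_dist q -> `|lossv L i q| <= Lm.
  move=> dq; apply: le_trans (ler_norm_sum _ _ _) _.
  apply: (@le_trans _ _ (\sum_m `|L i m|)).
    apply: ler_sum => m _; rewrite normrM (ger0_norm (dq.1 m)).
    by rewrite -[leRHS]mulr1 ler_wpM2l // dist_le1.
  rewrite /Lm (bigD1 i) //= lerDl; apply: sumr_ge0 => l _; exact: sumr_ge0.
have c1 : costr L j p r0 <= N%:R * (8 * Y ^+ 2) * (2 * Lm) / (a / u) ^+ 2.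
  apply: (@le_trans _ _ (\sum_(i < N) (8 * Y ^+ 2) / (a / u) ^+ 2 * (2 * Lm))); last first.
    rewrite sumr_const card_ord -mulr_natl le_eqVlt; apply/orP; left; apply/eqP; ring.
  rewrite /costr big_mkcond; apply: ler_sum => i _.
  case: ifPn => [ij|_]; last by rewrite mulr_ge0 ?(ltW w0) // mulr_ge0.
  rewrite /r0 (negbTE ij) ler_pM2l //.
  have := Lb i p dp; have := Lb j p dp; rewrite !ler_norml => /andP[? ?] /andP[? ?]; lra.
(* By the margin a unit of [r k] costs at least [a / u], while [r0] costs order [u ^ 2]; hence the
   cubic bound. *)
have c2 : (a / u) * r k <= costr L j p r.
  apply: (@le_trans _ _ (r k * (lossv L k p - lossv L j p))).
    by rewrite mulrC ler_wpM2l // lerBrDl; have := Cp k kj; rewrite al.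
  apply: costr_ge => // l lj; have := Cp l lj; rewrite al; lra.
rewrite -eu; apply: le_trans (HB2 u t2).
rewrite -(ler_pM2l al0); apply: le_trans c2 _; apply: le_trans (Hmin _ Rr0) _.
apply: le_trans c1 _; rewrite le_eqVlt; apply/orP; left; apply/eqP.
rewrite /K2; field; by rewrite !gt_eqF.
Qed.

Hypothesis opt : forall i, i != i1 -> lossv L i1 pstar < lossv L i pstar.
Variable ropt : 'I_N -> R.
Hypothesis Ropt : Rstar L h i1 pstar (fun i => star i) (fun _ => 0) = [set ropt].
Hypothesis reg2 : relcl (relint (Ccomp L i1) `&` Sdelta h i1 pstar 0)
  = relcl (relcl (Ccomp L i1) `&` Sdelta h i1 pstar 0).
Variables (psel : nat -> history N A -> 'I_M -> R) (isel : nat -> history N A -> 'I_N).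
Hypotheses (psel_spec : psel_ok h b psel) (isel_spec : isel_ok L psel isel).

Definition accurate (hs : history N A) :=
  forall i, ac (phat R hs i) (star i) /\ dkl (phat R hs i) (star i) < fexp b (Ncnt hs i).

Lemma objective_ge0 hs q : (0 <= objective h b hs q)%E.
Proof.
by apply: sume_ge0 => i _; rewrite mule_ge0 ?lee_fin // /hinge le_max lexx orbT.
Qed.

Lemma accurate_objective hs : accurate hs -> objective h b hs pstar = 0%E.
Proof.
move=> acc; apply: big1 => i _; have [ai di] := acc i.
rewrite KL_ac // /hinge -EFinB max_r ?mule0 // lee_fin subr_le0; exact: ltW.
Qed.

Lemma objective0_KL hs q : (forall i, (0 < Ncnt hs i)%N) -> objective h b hs q = 0%E ->
  forall i, (KL (phat R hs i) (S i q) <= (fexp b (Ncnt hs i))%:E)%E.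
Proof.
move=> n0 E i; rewrite leNgt; apply/negP => Hi.
have : (0 < objective h b hs q)%E.
  rewrite /objective (bigD1 i) //=; apply: (@lt_le_trans _ _ ((Ncnt hs i)%:R%:E * hinge (KL (phat R hs i) (S i q) - (fexp b (Ncnt hs i))%:E))%E).
    rewrite mule_gt0 ?lte_fin ?ltr0n // /hinge lt_max; apply/orP; left.
    by rewrite sube_gt0.
  rewrite leeDl //; apply: sume_ge0 => k _.
  by rewrite mule_ge0 ?lee_fin // /hinge le_max lexx orbT.
by rewrite E ltxx.
Qed.

Lemma near_accurate (e : R) : 0 < e -> \forall t \near \oo, forall hs, sampled t hs -> accurate hs ->
  [/\ isel t hs = i1, Calpha L i1 (alpha a t) (psel t hs),
    forall i, (KL (phat R hs i) (S i (psel t hs)) <= (fexp b (Ncnt hs i))%:E)%E,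
    exists r, Rstar L h i1 (psel t hs) (phat R hs) (ds hs) r &
    forall r, Rstar L h i1 (psel t hs) (phat R hs) (ds hs) r -> forall k, r k <= ropt k + e].
Proof.
move=> e0; have [Y [Y0 HY]] := observability.
have [rho1 [rho1_gt0 H1]] := @Rstar_nonempty R N M A L h pstar i1 dstar.
have [rho2 [rho2_gt0 H2]] := @Rset_inflate R N M A L h pstar i1 dstar ropt Ropt 1 ltr01.
have [rho3 [rho3_gt0 H3]] := @uniform_radius R 'I_N (fun k rho => forall ps ds p r,
    near_data h pstar i1 rho ps ds ->
    (forall i, `|(lossv L i p - lossv L i1 p) - (lossv L i pstar - lossv L i1 pstar)| <= rho) ->
    Rstar L h i1 p ps ds r -> r k <= ropt k + e)
  (fun k => let: ex_intro rho0 (conj p0 H) := Rstar_le dstar Ropt opt reg2 k e0 in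
     ex_intro _ rho0 (conj p0 (fun rho le ps ds p r => H rho ps ds p r le))).
have [D [D0 HD]] : exists D : R, 0 < D /\ forall i, i != i1 -> D <= lossv L i pstar - lossv L i1 pstar.
  exists (\big[Num.min/1]_(i | i != i1) (lossv L i pstar - lossv L i1 pstar)); split.
    by apply: lt_bigmin => // i ij; rewrite subr_gt0 opt.
  by move=> i ij; exact: bigmin_le_cond.
pose rho := Num.min (Num.min rho1 rho2) (Num.min rho3 (D / 4)).
have rho_gt0 : 0 < rho by rewrite !lt_min rho1_gt0 rho2_gt0 rho3_gt0 divr_gt0.
have le1 : rho <= rho1 by rewrite /rho !ge_min lexx.
have le2 : rho <= rho2 by rewrite /rho !ge_min lexx !orbT.
have le3 : rho <= rho3 by rewrite /rho !ge_min lexx !orbT.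
have le4 : rho <= D / 4 by rewrite /rho !ge_min lexx !orbT.
have x0 : 0 < rho / (4 * Y + 2) by rewrite divr_gt0 // addr_gt0 // mulr_gt0.
(* The factor [4 * Y + 2] covers both uses of [sqrt y]: empirical laws deviate from the truth by
   [2 * sqrt y], loss gaps by [4 * Y * sqrt y]. *)
pose y := Num.min rho ((rho / (4 * Y + 2)) ^+ 2).
have y0 : 0 < y by rewrite lt_min rho_gt0 exprn_gt0.
have yrho : y <= rho by rewrite ge_min lexx.
have sy : (4 * Y + 2) * Num.sqrt y <= rho.
  rewrite mulrC -ler_pdivlMr; last by rewrite addr_gt0 // mulr_gt0.
  rewrite -[leRHS](ger0_norm (ltW x0)) -sqrtr_sqr; apply: ler_wsqrtr.
  by rewrite ge_min lexx orbT.
have s0 : 0 <= Num.sqrt y := sqrtr_ge0 y.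
have Ys0 : 0 <= Y * Num.sqrt y by rewrite mulr_ge0 // ltW.
apply: filterS2 (near_fexp y0) (near_lnln_ge (2 * a / D + 1)) => t Ht tu hs sh acc.
have u0 : 0 < ln (ln t%:R) :> R by apply: lt_le_trans tu; rewrite ltr_wpDl // divr_ge0 ?mulr_ge0 // ltW.
have aD : alpha a t <= D / 2.
  rewrite /alpha ler_pdivrMr //.
  have -> : a = D / 2 * (2 * a / D) by field; rewrite gt_eqF.
  by rewrite ler_pM2l ?divr_gt0 //; lra.
have n0 i : (0 < Ncnt hs i)%N by have [] := sh i.
have dph i : is_dist (phat R hs i) by apply: phat_dist.
have fy i := Ht hs sh i.
set p := psel t hs.
have [dp pmin] : is_argmin_obj h b hs p.
  apply: psel_spec; exists pstar; split=> // q' _.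
  by rewrite accurate_objective // objective_ge0.
have KLp : forall i, (KL (phat R hs i) (S i p) <= (fexp b (Ncnt hs i))%:E)%E.
  apply: objective0_KL => //; apply/eqP; rewrite eq_le objective_ge0 andbT.
  by rewrite -(accurate_objective acc); exact: pmin.
have nd : near_data h pstar i1 rho (phat R hs) (ds hs).
  split=> //.
  - by move=> i; have [] := acc i.
  - move=> i d; have [ai di] := acc i.
    apply: le_trans (pinsker d (dph i) (Sq_dist h i dstar) ai (le_trans (ltW di) (fy i))) _; lra.
  - by move=> i; exact: fexp_ge0.
  - by move=> i; exact: le_trans (fy i) yrho.
  - by have [] := acc i1.
have close i : `|(lossv L i p - lossv L i1 p) - (lossv L i pstar - lossv L i1 pstar)| <= rho.
  apply: le_trans (HY p pstar (4 * Num.sqrt y) _ _ i i1) _; first by rewrite mulr_ge0.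
    apply: (consistent_close (ps := phat R hs) (es := ds hs)) => //.
      by move=> k; exact: KL_le.
    by move=> k; have [ai di] := acc k; split=> //; exact: ltW.
  lra.
have gapp i : i != i1 -> lossv L i1 p + D / 2 <= lossv L i p.
  move=> ij; have := close i; have := HD i ij; rewrite ler_norml => ? /andP[? ?]; lra.
split=> //.
- apply/eqP; apply: contraT => ij; have := isel_spec t hs i1; rewrite leNgt => /negP[].
  by apply: lt_le_trans (gapp _ ij); rewrite ltrDl divr_gt0.
- by split=> // i ij; apply: le_trans (gapp i ij); rewrite lerD2l.
- apply: (H1 rho _ _ _ le1 nd).
    by move=> i ij; apply: lt_le_trans (gapp i ij); rewrite ltrDl divr_gt0.
  by exists (inflate i1 ropt 1); exact: H2 le2 nd.
- by move=> r Rr k; exact: (H3 k _ le3 _ _ _ _ nd close Rr).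
Qed.

End Rounds.

(** * Scheduling: invariants of the loop and waiting times *)

Section Runs.
Context {R : realType} {N M A : nat}.
Variables (L : 'M[R]_(N, M)) (h : 'I_N -> 'I_M -> 'I_A) (a b c : R).
Variables (psel : nat -> history N A -> 'I_M -> R) (isel : nat -> history N A -> 'I_N).
Variables (rsel : nat -> history N A -> option ('I_N -> R)) (ordr : seq 'I_N) (i0 : 'I_N).
Hypothesis ordr_perm : perm_eq ordr (enum 'I_N).
Implicit Types (s : state N A) (k : 'I_N) (o : seq 'I_M).

Local Notation stp := (step L h a b c psel isel rsel ordr i0).
Local Notation cur := (cur_action i0).

Definition subr s : {set 'I_N} :=
  subroutine L h a b c psel isel rsel (size (st_hist s)).+1 (st_hist s) (st_zr s :\ cur s).

Definition cnt k s := Ncnt (st_hist s) k.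

(** Plays to which the algorithm is already committed; [cnt + pend] is a potential that, once
    initialization is over, only insertions increase. *)
Definition pend k s : nat := (k \in st_zc s) + (k \in st_zn s).

(** Includes the actions that a rule selects but does not insert because they still wait in [Z_R]:
    these are played soon as well. *)
Definition sched k s := (k \in subr s) || (k \in st_zr s :\ cur s).

Definition wf s : Prop :=
  [/\ st_zc s != [::], uniq (st_zc s) &
   if st_init s then st_zn s = finset.set0 /\ forall k, (cnt k s + (k \in st_zc s))%N = 1%N
   else (forall k, (0 < cnt k s)%N) /\ forall k, (k \in st_zr s) = (k \in st_zc s)].

Lemma subroutine_notin t hs (zr : {set 'I_N}) k :
  k \in subroutine L h a b c psel isel rsel t hs zr -> k \notin zr.
Proof.
rewrite /subroutine !inE => /orP[/orP[/orP[]|]|].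
- by case: ifP => [nz|_]; rewrite !inE // => /eqP ->.
- by case: ifP => _; rewrite !inE.
- by case: ifP => _; rewrite !inE.
- by case: ifP => _; rewrite ?inE //; case: rsel => [r|]; rewrite !inE // => /andP[].
Qed.

Lemma isel_subroutine t hs (zr : {set 'I_N}) : isel t hs \notin zr ->
  isel t hs \in subroutine L h a b c psel isel rsel t hs zr.
Proof. by move=> nz; rewrite /subroutine nz !inE eqxx. Qed.

Lemma mem_ordr k : k \in ordr.
Proof. by rewrite (perm_mem ordr_perm) mem_enum. Qed.

Lemma uniq_ordr : uniq ordr.
Proof. by rewrite (perm_uniq ordr_perm) enum_uniq. Qed.

Lemma size_uniq_ord (zc : seq 'I_N) : uniq zc -> (size zc <= N)%N.
Proof. by move=> u; rewrite -[leqRHS](card_ord N) -(card_uniqP u) max_card. Qed.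

Lemma hist_step s j : st_hist (stp s j) = rcons (st_hist s) (cur s, h (cur s) j).
Proof. by rewrite /step; case: ifP => _; case: ifP. Qed.

Lemma cnt_step k s j : cnt k (stp s j) = (cnt k s + (cur s == k))%N.
Proof. by rewrite /cnt /Ncnt hist_step -cats1 count_cat /= addn0. Qed.

Lemma wf_init : wf (init_state A ordr).
Proof.
split=> /=; last by split=> // k; rewrite mem_ordr.
  by have := mem_ordr i0; case: ordr.
exact: uniq_ordr.
Qed.

Lemma zc_cons s : st_zc s != [::] -> st_zc s = cur s :: behead (st_zc s).
Proof. by rewrite /cur_action; case: (st_zc s). Qed.

Lemma wf_step s j : wf s -> wf (stp s j).
Proof.
move=> [zc0 uz Hs].
have ub : uniq (behead (st_zc s)) by move: uz; rewrite {1}(zc_cons zc0) /= => /andP[].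
have cb : cur s \notin behead (st_zc s) by move: uz; rewrite {1}(zc_cons zc0) /= => /andP[].
have mb k : (k \in st_zc s) = (k == cur s) || (k \in behead (st_zc s)) by rewrite {1}(zc_cons zc0) inE.
move: Hs (fun k => cnt_step k s j); rewrite /wf /step; case: (st_init s) => -[H1 H2] Hc.
  case: ifP Hc => [/nilP nb|nb] Hc /=; rewrite ?nb; split=> //=.
  - by have := mem_ordr i0; case: ordr.
  - exact: uniq_ordr.
  - split=> k; last by rewrite inE mem_ordr.
    rewrite Hc; have := H2 k; rewrite mb nb in_nil orbF eq_sym; case: (_ == _) => /=; lia.
  - by apply/negP => /eqP E; move: nb; rewrite E.
  - split=> // k; rewrite Hc; have := H2 k; rewrite mb [k == _]eq_sym.
    by case: eqP => [<-|_]; rewrite ?(negbTE cb) /= ?orbF ?addn0.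
have H1' k : (0 < cnt k s + (cur s == k))%N by rewrite addn_gt0 H1.
have zrE k : (k \in st_zr s :\ cur s) = (k \in behead (st_zc s)).
  by rewrite !inE H2 mb; case: eqP => [->|]; rewrite ?(negbTE cb).
case: ifP Hc => [/nilP nb|nb] Hc /=; split=> //=.
(* The next [Z_C] is not empty: at the end of a loop [Z_R] is empty, so the empirically best action
   is inserted. *)
- have nz : isel (size (st_hist s)).+1 (st_hist s) \notin st_zr s :\ cur s by rewrite zrE nb.
  have := isel_subroutine nz; set x := isel _ _ => Hx.
  apply/eqP => E; have : x \in ([::] : seq 'I_N) by rewrite -E mem_filter mem_ordr andbT (finset.in_setU _ (st_zn s)) Hx orbT.
  by [].
- exact: filter_uniq uniq_ordr.
- by split=> [k|k]; rewrite ?Hc // mem_filter mem_ordr andbT.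
- by apply/negP => /eqP E; move: nb; rewrite E.
- by split=> k; rewrite ?Hc.
Qed.

(** For a pending [k], a bound on the rounds before it is played: an action of [Z_N] waits for the
    rest of this loop and then for fewer than [N] actions. *)
Definition wait k s := if k \in st_zc s then index k (st_zc s) else (size (st_zc s) + N)%N.

Definition pending k s := (k \in st_zc s) || (k \in st_zn s).

Lemma wait_le k s : wf s -> (wait k s <= 2 * N)%N.
Proof.
move=> [_ uz _]; have sz := size_uniq_ord uz; rewrite /wait; case: ifP => [|_].
  rewrite -index_mem => /ltnW/leq_trans; apply; apply: leq_trans sz _; exact: leq_pmull.
by rewrite mul2n -addnn leq_add2r.
Qed.

Lemma sched_pending k s j : wf s -> ~~ st_init s -> sched k s -> pending k (stp s j).
Proof.
move=> [zc0 uz Hs] ni; move: Hs; rewrite (negbTE ni) => -[_ zrE].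
rewrite /sched /pending /step (negbTE ni) -/(subr s).
case: ifP => nb /=.
  rewrite mem_filter mem_ordr andbT finset.in_set0 orbF (finset.in_setU _ (st_zn s)) (finset.in_setD1 _ (st_zr s)) zrE.
  case/orP => [->|]; first by rewrite orbT.
  by rewrite {1}(zc_cons zc0) (nilP nb) mem_seq1 => /andP[/negbTE ->].
rewrite (finset.in_setU _ (st_zn s)) (finset.in_setD1 _ (st_zr s)) zrE => /orP[->|]; first by rewrite !orbT.
by rewrite {1}(zc_cons zc0) in_cons => /andP[/negbTE ->] /= ->.
Qed.

Lemma pending_step k s j : wf s -> ~~ st_init s -> pending k s ->
  cur s = k \/ pending k (stp s j) /\ (wait k (stp s j) < wait k s)%N.
Proof.
move=> Ws ni; have Ws' := wf_step j Ws.
have [-> _|nk] := eqVneq (cur s) k; first by left.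
move=> pk; right; move: Ws' pk; have [zc0 uz _] := Ws.
have kc : (k \in st_zc s) = (k \in behead (st_zc s)).
  by rewrite {1}(zc_cons zc0) inE eq_sym (negbTE nk).
have zcE := zc_cons zc0.
rewrite /pending /wait /step (negbTE ni) kc; case: ifP => nb /=.
  rewrite (nilP nb) in_nil /= mem_filter mem_ordr andbT finset.in_set0 orbF (finset.in_setU _ (st_zn s)) => -[_ uz' _] zk.
  rewrite zk /=; split=> //; rewrite zcE /= (nilP nb) /=.
  have : (index k [seq k0 <- ordr | k0 \in st_zn s :|: subr s] < N)%N.
    apply: leq_trans (size_uniq_ord uz'); by rewrite index_mem mem_filter mem_ordr andbT (finset.in_setU _ (st_zn s)) zk.
  by move=> H; apply: leq_trans H _; exact: leq_addl.
move=> _ H; split; first by case/orP: H => H; rewrite ?H // (finset.in_setU _ (st_zn s)) H orbT.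
case: ifP => kb; last by rewrite [X in (_ < size X + _)%N]zcE /=; lia.
by rewrite [X in (_ < index _ X)%N]zcE /= (negbTE nk).
Qed.

Fixpoint trace s o : seq (state N A) :=
  if o is j :: o' then s :: trace (stp s j) o' else [::].

Definition final s o := foldl stp s o.

Lemma trace_cnt_gt k m s o : (m < cnt k s)%N ->
  count (fun x => [&& ~~ st_init x, sched k x & cnt k x == m]) (trace s o) = 0%N.
Proof.
elim: o s => //= j o IH s Hm; rewrite IH; last by rewrite cnt_step; lia.
by rewrite gtn_eqF //= !andbF.
Qed.

Lemma init_step s j : ~~ st_init s -> ~~ st_init (stp s j).
Proof. by move=> ni; rewrite /step (negbTE ni); case: ifP. Qed.

Lemma trace_pending k m s o : wf s -> ~~ st_init s -> pending k s -> cnt k s = m ->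
  (count (fun x => [&& ~~ st_init x, sched k x & cnt k x == m]) (trace s o) <= (wait k s).+1)%N.
Proof.
elim: o s => //= j o IH s Ws ni pk cm.
have [ck|[pk' wk]] := pending_step j Ws ni pk.
  rewrite trace_cnt_gt ?addn0; first by case: (_ && _).
  by rewrite cnt_step ck eqxx cm addn1.
have [ck|ck] := eqVneq (cur s) k.
  rewrite trace_cnt_gt ?addn0; first by case: (_ && _).
  by rewrite cnt_step ck eqxx cm addn1.
have := IH _ (wf_step j Ws) (init_step j ni) pk' _.
rewrite cnt_step (negbTE ck) addn0 => /(_ cm).
case: (_ && _) => /=; lia.
Qed.

(** A scheduled action is pending from the next round on and played within [2 * N + 1] rounds; its
    count then leaves [m] for good. This is what allows rounds to be charged to sample sizes. *)
Lemma trace_sched k m s o : wf s ->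
  (count (fun x => [&& ~~ st_init x, sched k x & cnt k x == m]) (trace s o) <= 2 * N + 2)%N.
Proof.
elim: o s => //= j o IH s Ws.
case: (boolP [&& _, _ & _]) => [/and3P[ni sk /eqP cm]|_]; last exact: IH (wf_step j Ws).
have [ck|ck] := eqVneq (cur s) k.
  by rewrite trace_cnt_gt ?cnt_step ?ck ?eqxx ?cm ?addn1 //; lia.
have := @trace_pending k m _ o (wf_step j Ws) (init_step j ni) (sched_pending j Ws ni sk) _.
rewrite cnt_step (negbTE ck) addn0 => /(_ cm); have := wait_le k (wf_step j Ws) => /=; lia.
Qed.

(** Here [x] stands for inserted now, [y] for in [Z_N], [z] for in the rest of [Z_C], and [w] for
    played now. *)
Lemma pend_arith (x y z w : bool) n : (x -> ~~ z) ->
  (n + w + (z + (y || x)) <= n + (w + z + y) + x)%N /\ (x -> n + w + (z + (y || x)) <= n + 2)%N.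
Proof. by case: x; case: y; case: z; case: w => H /=; split=> //; (lia || move: (H isT)). Qed.

Lemma pend_step k s j : wf s -> ~~ st_init s ->
  (cnt k (stp s j) + pend k (stp s j) <= cnt k s + pend k s + (k \in subr s))%N /\
  (k \in subr s -> cnt k (stp s j) + pend k (stp s j) <= cnt k s + 2)%N.
Proof.
move=> [zc0 uz Hs] ni; move: Hs; rewrite (negbTE ni) => -[_ zrE].
have nsub : k \in subr s -> k \notin st_zr s :\ cur s by exact: subroutine_notin.
have mb : (k \in st_zc s) = (k == cur s) || (k \in behead (st_zc s)) by rewrite {1}(zc_cons zc0) inE.
have cb : cur s \notin behead (st_zc s) by move: uz; rewrite {1}(zc_cons zc0) /= => /andP[].
have nsub' : k \in subr s -> k \notin behead (st_zc s).
  move=> /nsub; rewrite !inE zrE mb; by case: eqP => [->|].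
have zE : (k \in st_zc s) = ((cur s == k) + (k \in behead (st_zc s)))%N :> nat.
  by rewrite mb eq_sym; case: eqP => [<-|]; rewrite ?(negbTE cb).
rewrite !cnt_step /pend zE.
have [EC EN] : ((k \in st_zc (stp s j)) + (k \in st_zn (stp s j)) =
    (k \in behead (st_zc s)) + (k \in st_zn s :|: subr s))%N /\ True.
  split=> //; rewrite /step (negbTE ni) -/(subr s); case: ifP => [/nilP nb|nb] //=.
  by rewrite nb mem_filter mem_ordr andbT finset.in_set0 in_nil addn0.
rewrite EC (finset.in_setU _ (st_zn s)); exact: pend_arith.
Qed.

Lemma total_init k s : wf s -> st_init s -> (cnt k s + pend k s)%N = 1%N.
Proof. by move=> [_ _]; move=> + i; rewrite i /pend => -[-> H]; rewrite inE addn0. Qed.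

Lemma total_step_init k s j : wf s -> st_init s ->
  (cnt k (stp s j) + pend k (stp s j) <= 2)%N.
Proof.
move=> Ws si; have Ws' := wf_step j Ws.
have [i'|i'] := boolP (st_init (stp s j)); first by rewrite total_init.
have [_ _ ] := Ws; rewrite si => -[zn0 /(_ k) H].
have : (pend k (stp s j) <= 1)%N.
  by move: i'; rewrite /pend /step si; case: ifP => //= _ _; rewrite inE addn0; case: (_ \in _).
have [zc0 _ _] := Ws; move: H; rewrite cnt_step {1}(zc_cons zc0) inE [k == _]eq_sym.
by case: (_ == _) => /=; lia.
Qed.

(* Each play of k is paid for by an insertion of k in Z_N; an insertion made
   while k has fewer than B samples keeps the total below B + 2. *)
Lemma cnt_final_le (B : R) k s o (K : nat) : 0 <= B -> wf s ->
  (cnt k s + pend k s)%:R <= B + 2 + K%:R ->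
  (cnt k (final s o) + pend k (final s o))%:R <=
    B + 2 + K%:R + (count (fun x => [&& ~~ st_init x, k \in subr x & ~~ ((cnt k x)%:R < B)]) (trace s o))%:R.
Proof.
move=> B0; elim: o s K => /= [|j o IH] s K Ws H; first by rewrite addr0.
have [si|ni] /= := boolP (st_init s).
  rewrite add0n; apply: IH (wf_step j Ws) _.
  have := total_step_init k j Ws si; rewrite -(ler_nat R) => /le_trans; apply.
  by rewrite -addrA addrCA lerDl addr_ge0.
have [h1 h2] := pend_step k j Ws ni.
have [kb|kb] := boolP ((k \in subr s) && _).
  rewrite [X in _ <= _ + X]natrD addrA.
  have -> : B + 2 + K%:R + 1 = B + 2 + K.+1%:R by rewrite -(natr1 K); ring.
  apply: IH (wf_step j Ws) _; case/andP: kb => ks _.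
  move: h1; rewrite ks -(ler_nat R) => /le_trans; apply.
  have E : (cnt k s + pend k s + true)%:R = (cnt k s + pend k s)%:R + 1 :> R by rewrite natrD.
  rewrite E -(natr1 K); lra.
rewrite add0n; apply: IH (wf_step j Ws) _.
case: (boolP (k \in subr s)) kb h1 h2 => /= [ks|nk].
  rewrite negbK => cB _ /(_ isT); rewrite -(ler_nat R) => /le_trans; apply.
  have K0 : (0 : R) <= K%:R by [].
  rewrite natrD; lra.
by move=> _; rewrite addn0 => h1 _; apply: le_trans H; rewrite ler_nat.
Qed.

End Runs.

(** * The insertion rules as propositions *)

Section Subroutine.
Context {R : realType} {N M A : nat}.
Variables (L : 'M[R]_(N, M)) (h : 'I_N -> 'I_M -> 'I_A) (a b c : R).
Variables (psel : nat -> history N A -> 'I_M -> R) (isel : nat -> history N A -> 'I_N).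
Variables (rsel : nat -> history N A -> option ('I_N -> R)).
Variables (t : nat) (hs : history N A) (zr : {set 'I_N}).
Implicit Types (k : 'I_N).

Local Notation sub := (subroutine L h a b c psel isel rsel t hs zr).

Definition rate : 'I_N -> R :=
  fun k => if k == isel t hs then 0 else (Ncnt hs k)%:R / ln (t%:R).

Definition unsure := ~ Calpha L (isel t hs) (alpha a t) (psel t hs) \/
  exists i, ((fexp b (Ncnt hs i))%:E < KL (phat R hs i) (Sq h i (psel t hs)))%E.

Definition undersampled := exists i, (Ncnt hs i)%:R < c * Num.sqrt (ln (t%:R)).

Definition unexplored :=
  ~ Rset L h (isel t hs) (phat R hs) (fun i => fexp b (Ncnt hs i)) rate.

Lemma subroutine_all k : k \notin zr ->
  unsure \/ undersampled \/ unexplored /\ rsel t hs = None -> k \in sub.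
Proof.
rewrite /subroutine -/unsure -/undersampled -/rate -/unexplored => nz [H|[H|[H E]]].
- by move/asboolP : H => ->; rewrite !inE nz !orbT.
- by move/asboolP : H => ->; rewrite !inE nz !orbT.
- by move/asboolP : H => ->; rewrite E !inE nz !orbT.
Qed.

Lemma subroutine_some k r : k \notin zr -> unexplored -> rsel t hs = Some r ->
  rate k < r k -> k \in sub.
Proof.
rewrite /subroutine -/unsure -/undersampled -/rate -/unexplored => nz /asboolP -> -> H.
by rewrite !inE nz H !orbT.
Qed.

Lemma subroutineP k : k \in sub ->
  [\/ k = isel t hs, unsure, undersampled | unexplored /\
    if rsel t hs is Some r then rate k < r k else True].
Proof.
rewrite /subroutine -/unsure -/undersampled -/rate -/unexplored !inE.
move=> /orP[/orP[/orP[]|]|].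
- by case: ifP => _; rewrite !inE // => /eqP ->; constructor 1.
- by case: asboolP => H; rewrite ?finset.in_set0 // => _; constructor 2.
- by case: asboolP => H; rewrite ?finset.in_set0 // => _; constructor 3.
- case: asboolP => H; last by rewrite finset.in_set0.
  by case: rsel => [r|] H'; constructor 4; split=> //; move: H'; rewrite !inE => /andP[].
Qed.

End Subroutine.

(** * Every late insertion of a well-sampled suboptimal action has a cause *)

Section BadRounds.
Context {R : realType} {N M A : nat}.
Variables (L : 'M[R]_(N, M)) (h : 'I_N -> 'I_M -> 'I_A) (pstar : 'I_M -> R) (i1 : 'I_N).
Hypothesis dstar : is_dist pstar.
Hypothesis GO : globally_observable L h.
Hypothesis opt : forall i, i != i1 -> lossv L i1 pstar < lossv L i pstar.
Variable ropt : 'I_N -> R.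
Hypothesis Ropt : Rstar L h i1 pstar (fun i => Sq h i pstar) (fun _ => 0) = [set ropt].
Hypothesis reg2 : relcl (relint (Ccomp L i1) `&` Sdelta h i1 pstar 0)
  = relcl (relcl (Ccomp L i1) `&` Sdelta h i1 pstar 0).
Variables (a b c : R).
Hypotheses (a0 : 0 < a) (b0 : 0 < b) (c0 : 0 < c).
Variables (psel : nat -> history N A -> 'I_M -> R) (isel : nat -> history N A -> 'I_N).
Variables (rsel : nat -> history N A -> option ('I_N -> R)) (ordr : seq 'I_N).
Hypotheses (psel_spec : psel_ok h b psel) (isel_spec : isel_ok L psel isel).
Hypothesis rsel_spec : rsel_ok L h b psel isel rsel.

Local Notation S := (Sq h).
Local Notation star i := (Sq h i pstar).
Local Notation ds hs := (fun i => fexp b (Ncnt hs i)).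
Local Notation subr := (subr L h a b c psel isel rsel i1).
Local Notation sched := (sched L h a b c psel isel rsel i1).

Definition possible (hs : history N A) := all (fun s => 0 < Sq h s.1 pstar s.2) hs.

Lemma possible_ac hs i : possible hs -> ac (phat R hs i) (star i).
Proof.
move=> /allP H d sd; rewrite /phat (_ : count _ hs = 0%N) ?mul0r //.
apply/eqP; rewrite -leqn0 leqNgt -has_count; apply/negP => /hasP[[i' d'] /H /=] + /andP[/eqP E /eqP E'].
by rewrite /= in E E' *; rewrite E E' sd ltxx.
Qed.

Lemma ropt_ge0 k : 0 <= ropt k.
Proof.
have : Rstar L h i1 pstar (fun i => star i) (fun _ => 0) ropt by rewrite Ropt.
by move=> [[_ [+ _]] _]; apply.
Qed.

Variable C : nat.
Hypothesis HC : c^-1 ^+ 4 + 1 <= C%:R.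

(* What explains that a suboptimal action is scheduled at round t although it
   has at least (ropt k + e) log t samples: some action is undersampled; or the
   estimate of some i is inaccurate and the algorithm is about to play either i
   or an action with few samples compared to i; or the data are so misleading
   that they rule out pstar at level log t. *)
Definition charged (s : state N A) : Prop :=
  let t := (size (st_hist s)).+1 in
  [\/ exists i, sched i s /\ (cnt i s)%:R < c * Num.sqrt (ln t%:R),
      exists i k', [/\ fexp b (cnt i s) <= dkl (phat R (st_hist s) i) (star i), sched k' s &
        (cnt k' s <= C * (cnt i s).+1 ^ 4)%N] |
      t%:R <= \prod_i expR ((cnt i s)%:R * excess h (phat R (st_hist s)) (ds (st_hist s)) i pstar)].

Lemma near_charged (e : R) : 0 < e -> \forall t \near \oo, forall s : state N A,
  (size (st_hist s)).+1 = t -> (forall i, 0 < cnt i s)%N -> possible (st_hist s) ->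
  forall k, k != i1 -> k \in subr s -> ~~ ((cnt k s)%:R < (ropt k + e) * ln t%:R) ->
  charged s.
Proof.
move=> e0; have na := @near_accurate R N M A L h pstar i1 dstar GO a b c a0 b0 c0 opt ropt Ropt reg2
  psel isel psel_spec isel_spec e e0.
have nl := @near_Rstar_le_ln R N M A L h GO a b c a0 b0 c0.
apply: filterS3 na nl (near_ln_ge (1 : R)) => t Ha Hl lt1 s st n0 ok k ki ks kB.
rewrite /charged st.
have l0 : 0 < ln t%:R :> R by exact: lt_le_trans lt1.
have t0 : 0 < t%:R :> R by rewrite -st ltr0n.
pose hs := st_hist s.
have schedP i : (i \notin st_zr s :\ cur_action i1 s -> i \in subr s) -> sched i s.
  by rewrite /sched; case: (boolP (i \in st_zr s :\ _)) => [_ _|_ H]; rewrite ?orbT // H.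
have subE : subr s = subroutine L h a b c psel isel rsel t hs (st_zr s :\ cur_action i1 s).
  by rewrite /subr st.
have [[i Hi]|nIV] := pselect (undersampled c t hs).
  constructor 1; exists i; split=> //; apply: schedP => nz.
  by rewrite subE; apply: subroutine_all => //; right; left; exists i.
have sh : sampled c t hs.
  by move=> i; split; [exact: n0 | rewrite leNgt; apply/negP => Hi; apply: nIV; exists i].
have aci i : ac (phat R hs i) (star i) by exact: possible_ac.
have dph i : is_dist (phat R hs i) by apply: phat_dist; exact: n0.
have rs := rsel_spec t hs.
have rateE i : i != isel t hs -> rate isel t hs i = (Ncnt hs i)%:R / ln t%:R :> R.
  by rewrite /rate => /negbTE ->.
have [acc|nacc] := pselect (accurate h pstar b hs).
  (* With accurate data no rule can have inserted [k]: the best action is [i1], the estimate is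
     safe, and exploration asks for fewer samples than [k] has. *)
  exfalso; have [iE Ca KLp [r Rr] Rle] := Ha hs sh acc.
  move: ks; rewrite subE => /subroutineP[kE|[//|[i]]|//|[_]].
  - by move: ki; rewrite kE iE eqxx.
  - by rewrite iE in Ca *.
  - by rewrite ltNge KLp.
  - move: rs => /=; case: rsel => [r'|]; rewrite iE => Rr'; last by move=> _; have : set0 r by rewrite -Rr'.
    rewrite rateE ?iE // ltr_pdivrMr // => Hk.
    move/negP: kB; apply; apply: lt_le_trans Hk _.
    by rewrite ler_pM2r //; exact: Rle.
have [i Hi] : exists i, fexp b (cnt i s) <= dkl (phat R hs i) (star i).
  apply: contrapT => H; apply: nacc => i; split=> //.
  by rewrite ltNge; apply/negP => Hi; apply: H; exists i.
have selfP i' : (cnt i' s <= C * (cnt i' s).+1 ^ 4)%N.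
  have C0 : (0 < C)%N.
    rewrite -(ltr_nat R); apply: lt_le_trans HC; rewrite ltr_wpDl ?ltr01 //.
    by rewrite exprn_ge0 // invr_ge0 ltW.
  apply: leq_trans (leq_pmull _ C0); apply: leq_trans (leqnSn _) _.
  by rewrite -[leqLHS]expn1 leq_pexp2l.
(* This rule takes every available action, so the inaccurate [i] is scheduled itself and is charged
   to its own sample size. *)
have [u|nu] := pselect (unsure L h a b psel isel t hs).
  constructor 2; exists i, i; split=> //; apply: schedP => nz.
  by rewrite subE; apply: subroutine_all => //; left.
have Ca : Calpha L (isel t hs) (alpha a t) (psel t hs).
  by apply: contrapT => H; apply: nu; left.
have KLp i' : (KL (phat R hs i') (S i' (psel t hs)) <= (fexp b (Ncnt hs i'))%:E)%E.
  by rewrite leNgt; apply/negP => H; apply: nu; right; exists i'.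
have [ux|nux] := pselect (unexplored L h b isel t hs).
  constructor 2; move: rs => /=; case E: (rsel t hs) => [r|] Rr; last first.
    exists i, i; split=> //; apply: schedP => nz.
    by rewrite subE; apply: subroutine_all => //; right; right.
  (* Admissible vectors are closed upwards: rates dominating [r] everywhere would be admissible. *)
  have [k' Hk'] : exists k', rate isel t hs k' < r k'.
    apply: contrapT => H; apply: ux; have [Rr' _] := Rr; apply: Rset_up Rr' _ _.
      by rewrite /rate eqxx.
    by move=> i'; rewrite leNgt; apply/negP => Hi'; apply: H; exists i'.
  have k'i : k' != isel t hs.
    apply/eqP => E'; move: Hk'; rewrite E' /rate eqxx.
    by have [[-> _] _] := Rr; rewrite ltxx.
  exists i, k'; split=> //.
    by apply: schedP => nz; rewrite subE; exact: subroutine_some ux E Hk'.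
  (* The count of [k'] is below [ln t ^ 2], and [sqrt (ln t)] is at most [cnt i / c]; this gives the
     fourth power and the term [c^-1 ^+ 4] in [C]. *)
  move: Hk'; rewrite rateE // ltr_pdivrMr // => Hk'.
  have Hr := Hl hs (isel t hs) (psel t hs) r sh Ca KLp Rr k'.
  rewrite -(ler_nat R); apply: (@le_trans _ _ (ln t%:R ^+ 2)).
    by apply: ltW; apply: lt_le_trans Hk' _; rewrite expr2 ler_pM2r.
  have [_ si] := sh i; rewrite -/(cnt i s) in si.
  have s2 : ln t%:R = Num.sqrt (ln t%:R) ^+ 2 :> R by rewrite sqr_sqrtr // ltW.
  have si' : Num.sqrt (ln t%:R) <= c^-1 * (cnt i s)%:R.
    by rewrite -ler_pdivrMl ?invr_gt0 // invrK.
  rewrite s2 -exprM; apply: (@le_trans _ _ ((c^-1 * (cnt i s)%:R) ^+ 4)).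
    by rewrite lerXn2r // ?nnegrE ?sqrtr_ge0 // mulr_ge0 // invr_ge0 ltW.
  have c4 : 0 <= c^-1 ^+ 4 by rewrite exprn_ge0 // invr_ge0 ltW.
  rewrite exprMn natrM natrX; apply: ler_pM; rewrite ?exprn_ge0 //.
  - by rewrite invr_ge0 ltW.
  - by apply: le_trans HC; rewrite lerDl.
  - by rewrite lerXn2r ?nnegrE // ler_nat.
have kE : k = isel t hs.
  by move: ks; rewrite subE => /subroutineP[|//|//|[]].
have ksch : sched k s by rewrite /sched ks.
have [Hk|Hk] := leP (fexp b (cnt k s)) (dkl (phat R hs k) (star k)).
  by constructor 2; exists k, k.
constructor 3.
(* As [i1] beats [k] under [pstar], and the data of [k] are accurate, [pstar] is one of the
   alternatives that the current rates exclude. *)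
have /RsetP[_ _ /(_ pstar)] := contrapT nux; rewrite -kE => H.
have Fp : feas L h k (phat R hs) (ds hs) pstar.
  split=> //; last exact: ltW.
  apply: Ccomp_sub_relcl; apply/CcompP; split=> //; exists i1; split; first by rewrite eq_sym.
  exact: opt.
have {}H := H Fp (fun i' _ _ => aci i').
rewrite -[leLHS]lnK ?posrE // -expR_sum ler_expR.
rewrite -[leLHS]mul1r; apply: (@le_trans _ _ ((\sum_(i' | i' != k) rate isel t hs i' * excess h (phat R hs) (ds hs) i' pstar) * ln t%:R)).
  by rewrite ler_pM2r.
rewrite mulr_suml [leRHS](bigD1 k) //= ler_wpDl //; first by rewrite mulr_ge0 // excess_ge0.
apply: ler_sum => i' i'k; rewrite rateE -?kE //.
by rewrite mulrAC divfK // gt_eqF.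
Qed.

End BadRounds.

(** * Likelihood ratios of Laplace's predictor *)

Lemma expn_fact_superadd (x y : nat) :
  (x ^ x * y ^ y * (x + y)`! <= (x + y) ^ (x + y) * (x`! * y`!))%N.
Proof.
have := bin_fact (leq_addr y x); rewrite addKn => <-.
rewrite mulnA leq_mul2r; apply/orP; right.
rewrite expnDn (bigD1 (Ordinal (leq_addl x y : (y < (x + y).+1)%N))) //= addnK.
have -> : 'C(x + y, x) = 'C(x + y, y) by rewrite -[RHS]bin_sub ?leq_addl // addnK.
by rewrite mulnC leq_addr.
Qed.

(** In other words, a multinomial law gives probability at most 1 to the type equal to its own
    frequencies. *)
Lemma multinomial_bound (I : Type) (r : seq I) (f : I -> nat) :
  (\prod_(i <- r) f i ^ f i * (\sum_(i <- r) f i)`! <=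
   (\sum_(i <- r) f i) ^ (\sum_(i <- r) f i) * \prod_(i <- r) (f i)`!)%N.
Proof.
elim: r => [|i r IH]; first by rewrite !big_nil.
rewrite !big_cons; set x := f i; set s := (\sum_(_ <- _) _)%N in IH *.
set p := (\prod_(_ <- _) _)%N in IH *; set q := (\prod_(_ <- _) _)%N in IH *.
have sf : (0 < s`!)%N by exact: fact_gt0.
rewrite -(leq_pmul2r sf); apply: (@leq_trans (x ^ x * (x + s)`! * (s ^ s * q))).
  have -> : (x ^ x * p * (x + s)`! * s`! = x ^ x * (x + s)`! * (p * s`!))%N by lia.
  by rewrite leq_mul2l IH orbT.
have -> : (x ^ x * (x + s)`! * (s ^ s * q) = x ^ x * s ^ s * (x + s)`! * q)%N by lia.
have -> : ((x + s) ^ (x + s) * (x`! * q) * s`! = (x + s) ^ (x + s) * (x`! * s`!) * q)%N by lia.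
by rewrite leq_mul2r expn_fact_superadd orbT.
Qed.

Lemma factD_le (n k : nat) : ((n + k)`! <= n.+1 ^ k * (k`! * n`!))%N.
Proof.
elim: k => [|k IH]; first by rewrite addn0 expn0 !mul1n.
rewrite addnS !factS expnS.
have -> : (n.+1 * n.+1 ^ k * (k.+1 * k`! * n`!) = n.+1 * k.+1 * (n.+1 ^ k * (k`! * n`!)))%N by lia.
by apply: leq_mul => //; lia.
Qed.

Section Mixture.
Context {R : realType} {A : nat}.
Implicit Types (s : 'I_A -> R) (xs : seq 'I_A).

Definition emp xs : 'I_A -> R := fun d => (count_mem d xs)%:R / (size xs)%:R.

(* Likelihood ratio, with respect to iid sampling from s, of Laplace's
   sequential predictor (count + 1) / (n + A). *)
Definition mixlik s xs : R :=
  ((\prod_d (count_mem d xs)`!) * A.-1`!)%:R / (size xs + A.-1)`!%:R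
    / \prod_d s d ^+ count_mem d xs.

Lemma mixlik_ge0 s xs : (forall d, 0 <= s d) -> 0 <= mixlik s xs.
Proof.
move=> s0; rewrite /mixlik !mulr_ge0 // invr_ge0 //.
by apply: prodr_ge0 => d _; rewrite exprn_ge0.
Qed.

Lemma mixlik_nil s : mixlik s [::] = 1.
Proof.
rewrite /mixlik /= !big1 // mul1n add0n divr1 divff //.
Qed.

Lemma mixlik_rcons s xs x : mixlik s (rcons xs x) =
  mixlik s xs * ((count_mem x xs).+1%:R / (size xs + A)%:R / s x).
Proof.
have A0 : (0 < A)%N by case: A x => // -[].
have E d : count_mem d (rcons xs x) = (count_mem d xs + (x == d))%N.
  by rewrite -cats1 count_cat /= addn0.
have E1 : (\prod_d (count_mem d (rcons xs x))`! = (count_mem x xs).+1 * \prod_d (count_mem d xs)`!)%N.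
  rewrite (bigD1 x) //= E eqxx addn1 factS [in RHS](bigD1 x) //= mulnA; congr muln.
  by apply: eq_bigr => d /negbTE dx; rewrite E eq_sym dx addn0.
have E2 : \prod_d s d ^+ count_mem d (rcons xs x) = s x * \prod_d s d ^+ count_mem d xs.
  rewrite (bigD1 x) //= E eqxx addn1 exprS [in RHS](bigD1 x) //= mulrA; congr (_ * _).
  by apply: eq_bigr => d /negbTE dx; rewrite E eq_sym dx addn0.
rewrite /mixlik size_rcons E1 E2 addSn factS -addnS prednK // !natrM !invfM; ring.
Qed.

Lemma sum_count xs : (\sum_d count_mem d xs)%N = size xs.
Proof.
elim: xs => [|x xs IH] /=; first by rewrite big1.
rewrite big_split /= IH (bigD1 x) //= eqxx big1 ?addn0 //.
by move=> d /negbTE; rewrite eq_sym => ->.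
Qed.

(** The left side is the likelihood ratio of the empirical law, the best iid law for [xs].
    [multinomial_bound] and [factD_le] show that Laplace's predictor loses at most
    [(n + 1) ^ (A - 1)] against it. *)
Lemma expR_dkl_le s xs : (forall d, d \in xs -> 0 < s d) ->
  expR ((size xs)%:R * dkl (emp xs) s) <= (size xs).+1%:R ^+ A * mixlik s xs.
Proof.
move=> s0; case: xs s0 => [|x xs'] s0.
  by rewrite mul0r expR0 mixlik_nil mulr1 expr1n.
move: s0; set xs := x :: xs' => s0; have n0 : 0 < (size xs)%:R :> R by rewrite ltr0n.
have A0 : (0 < A)%N by case: A x {xs s0 n0} => // -[].
set n := size xs in n0 *.
have E : expR (n%:R * dkl (emp xs) s) =
    (\prod_d (count_mem d xs ^ count_mem d xs)%N)%:R / n%:R ^+ n / \prod_d s d ^+ count_mem d xs.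
  have -> : n%:R ^+ n = \prod_d n%:R ^+ count_mem d xs :> R by rewrite prodrXr sum_count.
  rewrite /dkl mulr_sumr expR_sum natr_prod -!prodf_div.
  apply: eq_bigr => d _; rewrite /emp -/n.
  have [->|cd] := posnP (count_mem d xs); first by rewrite !mul0r mulr0 expR0 !expr0 !divr1 expn0.
  have sd : 0 < s d by apply: s0; rewrite -has_pred1 has_count.
  have cn0 : 0 < (count_mem d xs)%:R / n%:R / s d :> R by rewrite !divr_gt0 // ltr0n.
  rewrite mulrA [n%:R * _]mulrC divfK ?gt_eqF // expRM_natl lnK ?posrE //.
  by rewrite !exprMn !exprVn natrX.
rewrite E /mixlik mulrA.
have [P0|P0] := eqVneq (\prod_d s d ^+ count_mem d xs) 0.
  by rewrite P0 invr0 !mulr0.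
have P_gt0 : 0 < \prod_d s d ^+ count_mem d xs.
  rewrite lt0r P0; apply: prodr_ge0 => d _.
  have [->|cd] := posnP (count_mem d xs); first by rewrite expr0.
  by rewrite exprn_ge0 // ltW // s0 // -has_pred1 has_count.
rewrite ler_pM2r ?invr_gt0 // mulrA ler_pdivrMr ?exprn_gt0 // mulrAC ler_pdivlMr; last first.
  by rewrite ltr0n fact_gt0.
rewrite -!natrX -!natrM ler_nat -/n.
have H1 := @multinomial_bound _ (index_enum 'I_A) (fun d => count_mem d xs).
rewrite sum_count -/n in H1.
have H2 := factD_le n A.-1.
set p := (\prod_d _ ^ _)%N in H1 *; set q := (\prod_d _`!)%N in H1 *.
apply: (@leq_trans (p * (n.+1 ^ A.-1 * (A.-1`! * n`!)))); first by rewrite leq_mul2l H2 orbT.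
have -> : (p * (n.+1 ^ A.-1 * (A.-1`! * n`!)) = p * n`! * (n.+1 ^ A.-1 * A.-1`!))%N by lia.
have -> : (n.+1 ^ A * (q * A.-1`!) * n ^ n = n ^ n * q * (n.+1 ^ A * A.-1`!))%N by lia.
apply: leq_mul => //; rewrite leq_mul2r; apply/orP; right.
by rewrite leq_pexp2l // leq_pred.
Qed.

End Mixture.

(** * Expectation over iid outcomes *)

Section Expectation.
Context {R : realType} {M : nat}.
Variable pstar : 'I_M -> R.
Hypothesis dstar : is_dist pstar.

(** Peels off the first outcome, as [run] does, so that inductions over rounds need no measure
    theory. *)
Fixpoint Ex T (f : seq 'I_M -> R) : R :=
  if T is T'.+1 then \sum_j pstar j * Ex T' (fun w => f (j :: w)) else f [::].

Lemma Ex_ffun T f :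
  \sum_(w : {ffun 'I_T -> 'I_M}) (\prod_(t < T) pstar (w t)) * f [seq w t | t <- enum 'I_T] = Ex T f.
Proof.
elim: T f => [|T IH] f.
  under eq_bigr => w _ do rewrite big_ord0 mul1r enum_ord0 /=.
  by rewrite sumr_const card_ffun !card_ord expn0.
pose phi (x : 'I_M * {ffun 'I_T -> 'I_M}) : {ffun 'I_T.+1 -> 'I_M} :=
  [ffun t => oapp x.2 x.1 (unlift ord0 t)].
pose psi (w : {ffun 'I_T.+1 -> 'I_M}) := (w ord0, [ffun t => w (lift ord0 t)] : {ffun 'I_T -> 'I_M}).
have phi0 x : phi x ord0 = x.1 by rewrite ffunE unlift_none.
have phiS x t : phi x (lift ord0 t) = x.2 t by rewrite ffunE liftK.
have phiK : cancel phi psi.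
  move=> [j w]; rewrite /psi phi0; congr pair; apply/ffunP => t.
  by rewrite ffunE phiS.
have psiK : cancel psi phi.
  move=> w; apply/ffunP => t; rewrite ffunE.
  by case: unliftP => [t' ->|->] /=; rewrite ?ffunE.
rewrite (reindex phi) /=; last by exists psi => x _; [exact: phiK | exact: psiK].
rewrite -(pair_big xpredT xpredT (fun j w => (\prod_t pstar (phi (j, w) t)) *
  f [seq phi (j, w) t | t <- enum 'I_T.+1])) /=.
apply: eq_bigr => j _; rewrite -IH mulr_sumr; apply: eq_bigr => w _.
rewrite big_ord_recl phi0 /= -mulrA; congr (_ * (_ * f _)).
  by apply: eq_bigr => t _; rewrite phiS.
rewrite enum_ordSl /= phi0; congr (_ :: _).
by rewrite -map_comp; apply: eq_map => t /=; rewrite phiS.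
Qed.

Lemma Ex_le T f g : (forall w, size w = T -> all (fun j => 0 < pstar j) w -> f w <= g w) ->
  Ex T f <= Ex T g.
Proof.
elim: T f g => [|T IH] f g H /=; first exact: H.
apply: ler_sum => j _; have := dstar.1 j; rewrite le0r => /orP[/eqP ->|pj].
  by rewrite !mul0r.
rewrite ler_pM2l //; apply: IH => w sw pw; apply: H => /=; first by rewrite sw.
by rewrite pj.
Qed.

Lemma Ex_affine T f (x y : R) : Ex T (fun w => x + y * f w) = x + y * Ex T f.
Proof.
elim: T f => [//|T IH] f /=.
under eq_bigr => j _ do rewrite IH mulrDr mulrCA.
by rewrite big_split /= -mulr_suml dstar.2 mul1r -mulr_sumr.
Qed.

End Expectation.

(** * A supermartingale jointly over the actions *)

Section Supermartingale.
Context {R : realType} {N M A : nat}.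
Variables (h : 'I_N -> 'I_M -> 'I_A) (pstar : 'I_M -> R).
Hypothesis dstar : is_dist pstar.
Implicit Types (i k : 'I_N) (hs : history N A) (xs : seq 'I_A).

Local Notation star i := (Sq h i pstar).

Definition stack i hs : seq 'I_A := [seq x.2 | x <- hs & x.1 == i].

Lemma stack_cat i hs hs' : stack i (hs ++ hs') = stack i hs ++ stack i hs'.
Proof. by rewrite /stack filter_cat map_cat. Qed.

Lemma stack_rcons k hs x :
  stack k (rcons hs x) = if x.1 == k then rcons (stack k hs) x.2 else stack k hs.
Proof. by rewrite /stack filter_rcons; case: ifP => _; rewrite ?map_rcons. Qed.

Lemma size_stack i hs : size (stack i hs) = Ncnt hs i.
Proof. by rewrite size_map size_filter. Qed.

Lemma phat_stack i hs : phat R hs i = emp (stack i hs).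
Proof.
apply: funext => d; rewrite /phat /emp size_stack; congr (_%:R / _).
rewrite /stack count_map count_filter; apply: eq_count => x /=.
by rewrite andbC.
Qed.

Lemma sum_symbols i (F : 'I_A -> R) : \sum_j pstar j * F (h i j) = \sum_d star i d * F d.
Proof.
rewrite /Sq; under [RHS]eq_bigr => d _ do rewrite mulr_suml.
rewrite exchange_big /=; apply: eq_bigr => m _.
rewrite (bigD1 (h i m)) //= mxE eqxx mul1r big1 ?addr0 // => d /negbTE.
by rewrite mxE eq_sym => ->; rewrite !mul0r.
Qed.

(** The predictive probabilities sum to 1; equality can fail because a symbol of probability 0 loses
    its predicted mass. *)
Lemma mixlik_step i xs :
  \sum_j pstar j * mixlik (star i) (rcons xs (h i j)) <= mixlik (star i) xs.
Proof.
have [s0 _] := Sq_dist h i dstar.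
rewrite (sum_symbols i (fun d => mixlik (star i) (rcons xs d))).
apply: (@le_trans _ _ (\sum_d mixlik (star i) xs * ((count_mem d xs).+1%:R / (size xs + A)%:R))).
  apply: ler_sum => d _; rewrite mixlik_rcons mulrCA ler_wpM2l ?mixlik_ge0 //.
  have := s0 d; rewrite le0r => /orP[/eqP ->|sd]; first by rewrite mul0r divr_ge0.
  by rewrite mulrCA divff ?gt_eqF // mulr1.
rewrite -mulr_sumr -mulr_suml -natr_sum.
have -> : (\sum_(d < A) (count_mem d xs).+1 = size xs + A)%N.
  under eq_bigr => d _ do rewrite -addn1.
  by rewrite big_split /= sum_count sum_nat_const card_ord muln1.
rewrite -[leRHS]mulr1 ler_wpM2l ?mixlik_ge0 //.
have [->|n0] := posnP (size xs + A); first by rewrite mul0r ler01.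
by rewrite divff // pnatr_eq0 -lt0n.
Qed.

Variables (g : nat -> R) (T : nat).
Hypothesis g_ge0 : forall n, 0 <= g n.

(** [take n] freezes the ratio after [n] samples, so each summand is a stopped supermartingale and
    all sample sizes are handled at once. *)
Definition weight i xs : R := \sum_(n < T.+1) g n * mixlik (star i) (take n xs).

Lemma weight_ge0 i xs : 0 <= weight i xs.
Proof.
apply: sumr_ge0 => n _; rewrite mulr_ge0 // mixlik_ge0 //.
by have [] := Sq_dist h i dstar.
Qed.

Lemma weight_step i xs : \sum_j pstar j * weight i (rcons xs (h i j)) <= weight i xs.
Proof.
under eq_bigr => j _ do rewrite mulr_sumr.
rewrite exchange_big /=; apply: ler_sum => n _.
under eq_bigr => j _ do rewrite mulrCA.
rewrite -mulr_sumr ler_wpM2l //; have [le|gt] := leqP n (size xs).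
  under eq_bigr => j _ do rewrite -cats1 takel_cat //.
  by rewrite -mulr_suml dstar.2 mul1r.
under eq_bigr => j _ do rewrite take_oversize ?size_rcons //.
by rewrite [take n xs]take_oversize ?mixlik_step // ltnW.
Qed.

Definition total_weight hs : R := \prod_i weight i (stack i hs).

(** Whichever way the action was selected, the round adds a fresh symbol to its factor only; the
    other factors are constants. *)
Lemma total_weight_step i hs :
  \sum_j pstar j * total_weight (rcons hs (i, h i j)) <= total_weight hs.
Proof.
have E j : total_weight (rcons hs (i, h i j)) =
    weight i (rcons (stack i hs) (h i j)) * \prod_(k | k != i) weight k (stack k hs).
  rewrite /total_weight (bigD1 i) //= stack_rcons eqxx; congr (_ * _).
  by apply: eq_bigr => k /negbTE ki; rewrite stack_rcons eq_sym ki.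
under eq_bigr => j _ do rewrite E mulrA.
rewrite -mulr_suml /total_weight [leRHS](bigD1 i) //= ler_wpM2r ?weight_step //.
by apply: prodr_ge0 => k _; exact: weight_ge0.
Qed.

Variables (L : 'M[R]_(N, M)) (a b c : R).
Variables (psel : nat -> history N A -> 'I_M -> R) (isel : nat -> history N A -> 'I_N).
Variables (rsel : nat -> history N A -> option ('I_N -> R)) (ordr : seq 'I_N) (i0 : 'I_N).

Local Notation final := (final L h a b c psel isel rsel ordr i0).

Lemma Ex_total_weight t s : Ex pstar t (fun w => total_weight (st_hist (final s w))) <=
  total_weight (st_hist s).
Proof.
elim: t s => [//|t IH] s /=.
apply: le_trans (total_weight_step (cur_action i0 s) (st_hist s)).
apply: ler_sum => j _; rewrite ler_wpM2l ?dstar.1 //; apply: le_trans (IH _) _.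
by rewrite hist_step.
Qed.

Lemma total_weight_nil : total_weight [::] = (\sum_(n < T.+1) g n) ^+ N.
Proof.
rewrite /total_weight /weight; under eq_bigr => i _.
  under eq_bigr => n _ do rewrite /stack /= mixlik_nil mulr1.
  over.
by rewrite prodr_const card_ord.
Qed.

End Supermartingale.

(** * Counting bad rounds on one path *)

Section BadCount.
Context {R : realType} {N M A : nat}.
Variables (L : 'M[R]_(N, M)) (h : 'I_N -> 'I_M -> 'I_A) (pstar : 'I_M -> R) (i1 : 'I_N).
Hypothesis dstar : is_dist pstar.
Variable ropt : 'I_N -> R.
Hypothesis ropt0 : forall k, 0 <= ropt k.
Variables (a b c : R).
Hypotheses (b0 : 0 < b) (c0 : 0 < c).
Variables (psel : nat -> history N A -> 'I_M -> R) (isel : nat -> history N A -> 'I_N).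
Variables (rsel : nat -> history N A -> option ('I_N -> R)) (ordr : seq 'I_N).
Hypothesis ordr_perm : perm_eq ordr (enum 'I_N).
Variable C : nat.

Local Notation star i := (Sq h i pstar).
Local Notation stp := (step L h a b c psel isel rsel ordr i1).
Local Notation subr := (subr L h a b c psel isel rsel i1).
Local Notation sched := (sched L h a b c psel isel rsel i1).
Local Notation charged := (charged L h pstar i1 a b c psel isel rsel C).
Local Notation final := (final L h a b c psel isel rsel ordr i1).
Local Notation trace := (trace L h a b c psel isel rsel ordr i1).
Local Notation init := (init_state A ordr).

(** The exponent is [n * f n]. The power combines the loss [A] of [expR_dkl_le] with the order
    [n ^ 4] of rounds that one inaccurate estimate may cost. *)
Definition gw (n : nat) : R := n.+1%:R ^+ (A + 4) * expR (- (b * Num.sqrt n%:R)).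

Lemma gw_ge0 n : 0 <= gw n.
Proof. by rewrite /gw mulr_ge0 ?exprn_ge0 // expR_ge0. Qed.

Lemma gw0 : gw 0 = 1.
Proof. by rewrite /gw expr1n mul1r sqrtr0 mulr0 oppr0 expR0. Qed.

Lemma mulr_fexp n : n%:R * fexp b n = b * Num.sqrt n%:R.
Proof.
rewrite /fexp; case: n => [|n]; first by rewrite mul0r sqrtr0 mulr0.
have s0 : 0 < Num.sqrt n.+1%:R :> R by rewrite sqrtr_gt0 ltr0n.
have : Num.sqrt n.+1%:R ^+ 2 = n.+1%:R :> R by rewrite sqr_sqrtr.
by move: s0; move: (Num.sqrt _) => x x0 <-; field; rewrite gt_eqF.
Qed.

Lemma expR_excess_le (s : 'I_A -> R) xs : (forall d, d \in xs -> 0 < s d) ->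
  (size xs).+1%:R ^+ 4 * expR ((size xs)%:R * (dkl (emp xs) s - fexp b (size xs)))
  <= gw (size xs) * mixlik s xs.
Proof.
move=> s0; rewrite mulrBr mulr_fexp expRD /gw exprD.
have := expR_dkl_le s0; set n := size xs; move: (expR (n%:R * _)) => x Hx.
have -> : n.+1%:R ^+ A * n.+1%:R ^+ 4 * expR (- (b * Num.sqrt n%:R)) * mixlik s xs =
  n.+1%:R ^+ 4 * (n.+1%:R ^+ A * mixlik s xs * expR (- (b * Num.sqrt n%:R))) by ring.
by rewrite ler_wpM2l ?exprn_ge0 // ler_wpM2r // expR_ge0.
Qed.

Lemma final_hist s o : exists hs, st_hist (final s o) = st_hist s ++ hs /\ size hs = size o.
Proof.
elim: o s => [|j o IH] s /=; first by exists [::]; rewrite cats0.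
have [hs [E sz]] := IH (stp s j); exists ((cur_action i1 s, h (cur_action i1 s) j) :: hs).
by rewrite E hist_step cat_rcons /= sz.
Qed.

Lemma final_possible s o : possible h pstar (st_hist s) -> all (fun j => 0 < pstar j) o ->
  possible h pstar (st_hist (final s o)).
Proof.
elim: o s => [//|j o IH] s /= Hs /andP[pj po]; apply: IH => //.
rewrite hist_step /possible all_rcons /= -/(possible h pstar _) Hs andbT.
exact: lt_le_trans pj (Sq_ge h _ j dstar).
Qed.

Lemma final_wf s o : wf s -> wf (final s o).
Proof. by elim: o s => [//|j o IH] s /= Ws; apply: IH; exact: wf_step. Qed.

Lemma trace_map s o : trace s o = [seq final s (take t o) | t <- iota 0 (size o)].
Proof.
elim: o s => [//|j o IH] s /=; rewrite IH; congr cons.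
by rewrite -[1%N]addn0 iotaDl -map_comp.
Qed.

Lemma trace_count s o P : count P (trace s o) = (\sum_(t < size o) P (final s (take t o)))%N.
Proof.
rewrite trace_map count_map -sum1_count big_mkcond -[size o]subn0 -/(index_iota 0 (size o)) big_mkord.
by rewrite subn0; apply: eq_bigr => t _ /=; case: (P _).
Qed.

Lemma sum_ltn_le n m : (\sum_(t < n) (t < m) <= m)%N.
Proof.
rewrite -(big_mkord xpredT (fun t => (t < m)%N : nat)) /=; apply: (@leq_trans (minn n m)); last exact: geq_minr.
elim: n => [|n IH]; first by rewrite big_geq.
rewrite big_nat_recr //=; move: IH; move: (\sum_(0 <= _ < n) _)%N => S.
by case: (ltnP n m) => /= nm; lia.
Qed.

(** A condition of the form [t <= v] holds in at most [v] rounds, so a likelihood ratio bounds a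
    number of rounds directly, without tail estimates. *)
Lemma sum_le_real n (v : R) : 0 <= v -> (\sum_(t < n) (t.+1%:R <= v)%R)%:R <= v.
Proof.
move=> v0; rewrite -(big_mkord xpredT (fun t => nat_of_bool (t.+1%:R <= v)%R)) /=.
elim: n => [|n IH]; first by rewrite big_geq.
rewrite big_nat_recr //=; have [nv|_] := boolP (n.+1%:R <= v); last by rewrite addn0.
apply: le_trans nv; rewrite ler_nat addn1 ltnS.
rewrite -[leqRHS]muln1 -[X in (X * _)%N]subn0 -sum_nat_const_nat.
by apply: leq_sum => t _; case: (_ <= _).
Qed.

Variable w : seq 'I_M.
Hypothesis w_pos : all (fun j => 0 < pstar j) w.

Let T := size w.
Let st t := final init (take t w).
Let Hf := st_hist (final init w).

Lemma size_hist_st t : (t <= T)%N -> size (st_hist (st t)) = t.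
Proof.
move=> tT; have [hs [-> sz]] := final_hist init (take t w).
by rewrite /= sz size_takel.
Qed.

(** Observations at time [t] are a prefix of the final ones, so every charge can be read off the
    final history. *)
Lemma stack_st t i : stack i (st_hist (st t)) = take (cnt i (st t)) (stack i Hf).
Proof.
have [hs [E _]] := final_hist (st t) (drop t w).
have -> : Hf = st_hist (st t) ++ hs.
  by rewrite -E /st /final -foldl_cat cat_take_drop.
by rewrite stack_cat /cnt -size_stack take_size_cat.
Qed.

Lemma Hf_pos i d : d \in stack i Hf -> 0 < star i d.
Proof.
have : possible h pstar Hf by apply: final_possible.
move=> /allP H /mapP[x]; rewrite mem_filter => /andP[/eqP <- /H ? ->].
by [].
Qed.

Lemma cnt_le t i : (t <= T)%N -> (cnt i (st t) <= T)%N.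
Proof.
by move=> tT; apply: leq_trans (count_size _ _) _; rewrite size_hist_st.
Qed.

Local Notation G i n := (gw n * mixlik (star i) (take n (stack i Hf))).
Local Notation Y := (total_weight h pstar gw T Hf).

Lemma G_ge0 i n : 0 <= G i n.
Proof. by rewrite mulr_ge0 ?gw_ge0 // mixlik_ge0 //; have [] := Sq_dist h i dstar. Qed.

(** Due to the term [n = 0]; it makes each single weight at most the product of all of them. *)
Lemma weight_ge1 i : 1 <= weight h pstar gw T i (stack i Hf).
Proof.
rewrite /weight big_ord_recl /= gw0 take0 mixlik_nil mul1r lerDl.
by apply: sumr_ge0 => n _; exact: G_ge0.
Qed.

Lemma weight_le_total i : weight h pstar gw T i (stack i Hf) <= Y.
Proof.
rewrite /total_weight (bigD1 i) //= ler_peMr //; first exact: le_trans ler01 (weight_ge1 i).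
elim/big_ind : _ => // [x y x1 y1|k _]; last exact: weight_ge1.
by rewrite -[1]mulr1 ler_pM.
Qed.

Lemma G_term i n : let xs := take n (stack i Hf) in size xs = n ->
  n.+1%:R ^+ 4 * expR (n%:R * (dkl (emp xs) (star i) - fexp b n)) <= G i n.
Proof.
move=> xs sz; have := @expR_excess_le (star i) xs; rewrite sz; apply.
by move=> d /mem_take; exact: Hf_pos.
Qed.

Definition scheduled_at k m s := [&& ~~ st_init s, sched k s & cnt k s == m].

(** The size test says that this path actually reaches [n] samples of [i]. *)
Definition inaccurate i n : bool :=
  (size (take n (stack i Hf)) == n) && (fexp b n <= dkl (emp (take n (stack i Hf))) (star i)).

Lemma sum_inaccurate i :
  (\sum_(n < T.+1) inaccurate i n * n.+1 ^ 4)%:R <= weight h pstar gw T i (stack i Hf).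
Proof.
rewrite natr_sum; apply: ler_sum => n _; rewrite natrM.
have [/andP[/eqP sz Hn]|_] := boolP (inaccurate i n); last by rewrite mul0r G_ge0.
rewrite mul1r natrX; apply: le_trans (G_term sz); rewrite ler_peMr ?exprn_ge0 //.
by rewrite -expR0 ler_expR mulr_ge0 // subr_ge0.
Qed.

Lemma leq_sum_term (I : finType) (F : I -> nat) x : (F x <= \sum_y F y)%N.
Proof. by rewrite (bigD1 x) //= leq_addr. Qed.

Variables (e : R) (k : 'I_N) (t0 M0 : nat).
Hypotheses (e0 : 0 < e) (ki : k != i1).
Hypothesis Hcharged : forall t, (t0 <= t)%N -> forall s : state N A,
  (size (st_hist s)).+1 = t -> (forall i, 0 < cnt i s)%N -> possible h pstar (st_hist s) ->
  forall k, k != i1 -> k \in subr s -> ~~ ((cnt k s)%:R < (ropt k + e) * ln t%:R) ->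
  charged s.
Hypothesis HM0 : c * Num.sqrt (ln T%:R) <= M0%:R.

(** The threshold uses the horizon [T], since [cnt_final_le] needs a constant; it dominates the
    thresholds of all earlier rounds. *)
Definition bad_round s := [&& ~~ st_init s, k \in subr s & ~~ ((cnt k s)%:R < (ropt k + e) * ln T%:R)].

Lemma bad_round_le t : (t < T)%N -> (bad_round (st t) <= (t < t0) +
  \sum_(i < N) \sum_(m < M0) scheduled_at i m (st t) +
  \sum_(i < N) \sum_(k' < N) \sum_(n < T.+1) \sum_(m < (C * n.+1 ^ 4).+1)
     inaccurate i n * scheduled_at k' m (st t) +
  \sum_(v : {ffun 'I_N -> 'I_T.+1}) (t.+1%:R <= \prod_i G i (v i))%R)%N.
Proof.
move=> tT; have [/and3P[ni ks kB]|//] := boolP (bad_round (st t)).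
have [//|tt0] := ltnP t t0; rewrite add0n.
have sz := size_hist_st (ltnW tT).
have Ws : wf (st t) by apply: final_wf; exact: wf_init.
have n0 i : (0 < cnt i (st t))%N by have [_ _] := Ws; rewrite (negbTE ni) => -[].
have ok : possible h pstar (st_hist (st t)).
  by apply: final_possible => //; apply/allP => j /mem_take; exact: (allP w_pos).
have lnT : ln t.+1%:R <= ln T%:R :> R.
  by rewrite ler_ln ?posrE ?ltr0n ?ler_nat // (leq_ltn_trans _ tT).
have kB' : ~~ ((cnt k (st t))%:R < (ropt k + e) * ln t.+1%:R).
  apply: contra kB => /lt_le_trans; apply; rewrite ler_wpM2l // addr_ge0 //; exact: ltW.
have := Hcharged (leqW tt0) (congr1 S sz) n0 ok ki ks kB'.
rewrite /charged sz => -[[i [si Hi]]|[i [k' [Hi sk Hk']]]|Ht].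
- have im : (cnt i (st t) < M0)%N.
    rewrite -(ltr_nat R); apply: lt_le_trans Hi _; apply: le_trans HM0.
    by rewrite ler_pM2l //; exact: ler_wsqrtr.
  rewrite -addnA; apply: leq_trans (leq_addr _ _); apply: leq_trans (leq_sum_term _ i).
  apply: leq_trans (leq_sum_term _ (Ordinal im)).
  by rewrite /scheduled_at ni si /= eqxx.
- rewrite addnAC; apply: leq_trans (leq_addl _ _).
  apply: leq_trans (leq_sum_term _ i); apply: leq_trans (leq_sum_term _ k').
  have cT : (cnt i (st t) < T.+1)%N by rewrite ltnS; apply: cnt_le; exact: ltnW.
  apply: leq_trans (leq_sum_term _ (Ordinal cT)).
  apply: leq_trans (leq_sum_term _ (Ordinal (n := (C * (cnt i (st t)).+1 ^ 4).+1) Hk')) => /=.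
  rewrite /scheduled_at ni sk eqxx /inaccurate -stack_st size_stack eqxx /=.
  by rewrite -phat_stack Hi.
- apply: leq_trans (leq_addl _ _).
  (* An accurate action has excess 0; recording size 0 for it gives the neutral factor
     [G i 0 = 1]. *)
  pose v i := if fexp b (cnt i (st t)) <= dkl (phat R (st_hist (st t)) i) (star i) then cnt i (st t) else 0%N.
  have vT i : (v i < T.+1)%N.
    by rewrite /v; case: ifP => // _; rewrite ltnS; apply: cnt_le; exact: ltnW.
  apply: leq_trans (leq_sum_term _ [ffun i => Ordinal (vT i)]).
  rewrite (_ : _ <= _) //; apply: le_trans Ht _; apply: ler_prod => i _.
  rewrite expR_ge0 /= ffunE /= /v; case: ifP => Hi; last first.
    rewrite take0 mixlik_nil gw0 mulr1 /excess max_r ?mulr0 ?expR0 //.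
    by rewrite subr_le0 ltW // ltNge Hi.
  rewrite /excess max_l ?subr_ge0 // phat_stack stack_st.
  have sz' : size (take (cnt i (st t)) (stack i Hf)) = cnt i (st t).
    by rewrite -stack_st size_stack.
  apply: le_trans (G_term sz'); rewrite ler_peMl ?expR_ge0 //.
  by rewrite exprn_ege1 // ler1n.
Qed.

(** After exchanging sums, [trace_sched] bounds each scheduling term, and the sum of products over
    all [v] factors into [Y]. *)
Lemma bad_count : (count bad_round (trace init w))%:R <=
  t0%:R + (N * M0 * (2 * N + 2))%:R + (N * N * (C.+1 * (2 * N + 2)) + 1)%:R * Y.
Proof.
have sch i m : (\sum_(t < T) scheduled_at i m (st t) <= 2 * N + 2)%N.
  by rewrite -trace_count; apply: trace_sched => //; exact: wf_init.
rewrite trace_count; apply: le_trans (_ : (\sum_(t < T) _)%:R <= _).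
  by rewrite ler_nat; apply: leq_sum => t _; exact: bad_round_le.
rewrite !big_split /= !natrD [_%:R + 1%:R]addrC mulrDl mul1r !addrA.
rewrite [X in _ <= X]addrAC; apply: lerD; last first.
  rewrite exchange_big /= natr_sum.
  rewrite /total_weight /weight bigA_distr_bigA /=; apply: ler_sum => v _.
  by apply: sum_le_real; apply: prodr_ge0 => i _; exact: G_ge0.
apply: lerD; first apply: lerD.
- by rewrite ler_nat sum_ltn_le.
- rewrite ler_nat exchange_big /= -[(N * M0)%N]/(N * M0)%N.
  apply: (@leq_trans (\sum_(i < N) M0 * (2 * N + 2))); last first.
    by rewrite sum_nat_const card_ord mulnA.
  apply: leq_sum => i _; rewrite exchange_big /=.
  apply: (@leq_trans (\sum_(m < M0) (2 * N + 2))); last by rewrite sum_nat_const card_ord.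
  by apply: leq_sum => m _; exact: sch.
- apply: (@le_trans _ _ (\sum_(i < N) \sum_(k' < N) (C.+1 * (2 * N + 2))%:R * Y)); last first.
    rewrite !sumr_const !card_ord -mulrnA -[leLHS]mulr_natl mulrA.
    by rewrite -natrM.
  rewrite exchange_big /= natr_sum; apply: ler_sum => i _.
  rewrite exchange_big /= natr_sum; apply: ler_sum => k' _.
  apply: (@le_trans _ _ ((C.+1 * (2 * N + 2))%:R * weight h pstar gw T i (stack i Hf))); last first.
    by rewrite ler_wpM2l // weight_le_total.
  apply: (@le_trans _ _ ((C.+1 * (2 * N + 2))%:R * (\sum_(n < T.+1) inaccurate i n * n.+1 ^ 4)%:R)); last first.
    by rewrite ler_wpM2l // sum_inaccurate.
  rewrite -natrM ler_nat exchange_big /= big_distrr /=; apply: leq_sum => n _.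
  rewrite exchange_big /=.
  (* The [C * n.+1 ^ 4 + 1] possible sizes of the scheduled action are at most [C.+1 * n.+1 ^ 4], a
     power that [gw] provides. *)
  apply: (@leq_trans (\sum_(m < (C * n.+1 ^ 4).+1) inaccurate i n * (2 * N + 2))).
    apply: leq_sum => m _; rewrite -big_distrr /= leq_mul2l; apply/orP; right; exact: sch.
  rewrite sum_nat_const card_ord.
  have : (0 < n.+1 ^ 4)%N by rewrite expn_gt0.
  case: (inaccurate i n); rewrite ?mul0n ?muln0 // !mul1n; nia.
Qed.

End BadCount.

(** * Summability of the weights *)

Section Summability.
Context {R : realType} {A : nat}.

Lemma gw_le (b : R) : 0 < b -> exists K, 0 <= K /\ forall n, @gw R A b n <= K / (n.+1%:R * n.+2%:R).
Proof.
move=> b0; pose m := (A + 6)%N.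
(* [m] exceeds [A + 4] by the two powers needed for summability. At [u = b * sqrt n] the bound reads
   [(2 * n) ^ m <= expR u], and [n + 1 <= 2 * n]. *)
have [B [B0 HB]] := expR_ge_pow ((2 / b ^+ 2) ^+ m) (2 * m).
have [n0 Hn0] : exists n0 : nat, forall n, (n0 <= n)%N -> (0 < n)%N /\ B <= b * Num.sqrt n%:R.
  exists (Num.truncn ((B / b) ^+ 2)).+1 => n Hn; split; first exact: leq_trans Hn.
  have Bb : 0 <= B / b by rewrite divr_ge0 // ltW.
  rewrite mulrC -ler_pdivrMr // -[leLHS](ger0_norm Bb) -sqrtr_sqr; apply: ler_wsqrtr.
  apply: ltW; apply: lt_le_trans (truncnS_gt _) _; by rewrite ler_nat.
have tail n : (n0 <= n)%N -> gw (A := A) b n <= 2 / (n.+1%:R * n.+2%:R).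
  move=> /Hn0[n_gt0 Bn]; have := HB _ Bn; set E := expR _ => HE.
  have E0 : 0 < E by exact: expR_gt0.
  have H1 : n.+1%:R ^+ m <= E.
    apply: le_trans HE; rewrite exprM -exprMn lerXn2r ?nnegrE //.
      by rewrite mulr_ge0 ?divr_ge0 ?exprn_ge0 ?mulr_ge0 ?sqrtr_ge0 // ltW.
    rewrite exprMn sqr_sqrtr // mulrA divfK ?expf_neq0 ?gt_eqF // -natrM ler_nat; lia.
  rewrite /gw expRN -/E ler_pdivrMr // mulrAC ler_pdivlMr ?mulr_gt0 //.
  apply: (@le_trans _ _ (n.+1%:R ^+ (A + 4) * (2 * n.+1%:R ^+ 2))).
    rewrite ler_wpM2l ?exprn_ge0 // expr2 mulrCA ler_wpM2l // -natrM ler_nat; lia.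
  by rewrite mulrCA -exprD -addnA ler_wpM2l.
pose K0 := \sum_(n < n0) gw (A := A) b n * (n.+1%:R * n.+2%:R).
have K00 : 0 <= K0.
  by apply: sumr_ge0 => n _; rewrite mulr_ge0 ?gw_ge0.
exists (K0 + 2); split; first by rewrite addr_ge0.
move=> n; have [/tail|nn0] := leqP n0 n.
  move=> /le_trans; apply; rewrite ler_wpM2r ?invr_ge0 ?mulr_ge0 //; lra.
rewrite ler_pdivlMr ?mulr_gt0 //.
have : gw (A := A) b n * (n.+1%:R * n.+2%:R) <= K0.
  rewrite /K0 (bigD1 (Ordinal nn0)) //= lerDl; apply: sumr_ge0 => i _.
  by rewrite mulr_ge0 ?gw_ge0.
lra.
Qed.

(** The majorant telescopes as a difference of consecutive reciprocals. *)
Lemma gw_sum_le (b : R) : 0 < b -> exists G, 0 <= G /\ forall T, \sum_(n < T) @gw R A b n <= G.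
Proof.
move=> /gw_le[K [K0 HK]]; exists K; split=> // T.
suff H : \sum_(n < T) @gw R A b n <= K * (1 - T.+1%:R^-1).
  by apply: le_trans H _; rewrite -[leRHS]mulr1 ler_wpM2l // gerBl invr_ge0.
elim: T => [|T IH]; first by rewrite big_ord0 invr1 subrr mulr0.
rewrite big_ord_recr /=; apply: le_trans (lerD IH (HK T)) _.
rewrite -mulrDr ler_wpM2l // le_eqVlt; apply/orP; left; apply/eqP.
have h1 : T%:R + 1 != 0 :> R by rewrite natr1 pnatr_eq0.
have h2 : T%:R + 2 != 0 :> R by rewrite -natrD pnatr_eq0 addn2.
have -> : T.+1%:R = T%:R + 1 :> R by rewrite natr1.
have -> : T.+2%:R = T%:R + 2 :> R by rewrite -natrD addn2.
field; by rewrite h1 h2.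
Qed.

End Summability.

(** * Regret in terms of the final counts *)

Section RegretIdentity.
Context {R : realType} {N M A : nat}.
Variables (L : 'M[R]_(N, M)) (h : 'I_N -> 'I_M -> 'I_A) (a b c : R).
Variables (psel : nat -> history N A -> 'I_M -> R) (isel : nat -> history N A -> 'I_N).
Variables (rsel : nat -> history N A -> option ('I_N -> R)) (ordr : seq 'I_N) (i0 : 'I_N).

Lemma run_hist s o : [seq x.1 | x <- st_hist (final L h a b c psel isel rsel ordr i0 s o)] =
  [seq x.1 | x <- st_hist s] ++ run L h a b c psel isel rsel ordr i0 s o.
Proof.
elim: o s => [|j o IH] s /=; first by rewrite cats0.
by rewrite IH hist_step map_rcons cat_rcons.
Qed.

Lemma sum_actions (F : 'I_N -> R) w :
  \sum_(i <- actions L h a b c psel isel rsel ordr i0 w) F i =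
  \sum_k F k * (cnt k (final L h a b c psel isel rsel ordr i0 (init_state A ordr) w))%:R.
Proof.
rewrite /actions -[run _ _ _ _ _ _ _ _ _ _ _ _]cat0s -(run_hist (init_state A ordr) w) /cnt.
elim: (st_hist _) => [|x hs IH] /=; first by rewrite big_nil big1 // => k _; rewrite mulr0.
rewrite big_cons IH (bigD1 x.1) //= [in RHS](bigD1 x.1) //= eqxx natrD mulrDr mulr1 addrA; congr (_ + _).
by apply: eq_bigr => k /negbTE; rewrite eq_sym => ->.
Qed.

End RegretIdentity.

Theorem theorem3 (R : realType) (N M A : nat)
  (L : 'M[R]_(N, M)) (h : 'I_N -> 'I_M -> 'I_A)
  (pstar : 'I_M -> R) (i1 : 'I_N) :
  is_dist pstar ->
  globally_observable L h ->
  (forall i, i != i1 -> lossv L i1 pstar < lossv L i pstar) ->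
  (* regularity condition (1) *)
  (exists r, Rstar L h i1 pstar (fun i => Sq h i pstar) (fun _ => 0) = [set r]) ->
  (* regularity condition (2) *)
  (exists d0 : R, 0 < d0 /\ forall d : R, 0 <= d -> d < d0 ->
     relcl (relint (Ccomp L i1) `&` Sdelta h i1 pstar d)
     = relcl (relcl (Ccomp L i1) `&` Sdelta h i1 pstar d)) ->
  forall (a b c : R), 0 < a -> 0 < b -> 0 < c ->
  forall (ordr : seq 'I_N)
         (psel : nat -> history N A -> ('I_M -> R))
         (isel : nat -> history N A -> 'I_N)
         (rsel : nat -> history N A -> option ('I_N -> R)),
  perm_eq ordr (enum 'I_N) ->
  psel_ok h b psel ->
  isel_ok L psel isel ->
  rsel_ok L h b psel isel rsel ->
  forall eps : R, 0 < eps ->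
  \forall T \near \oo,
    ((expected_regret L h pstar i1 a b c psel isel rsel ordr T)%:E
     <= (Cval L h i1 pstar (fun i => Sq h i pstar) (fun _ => 0%R) + eps%:E)
        * (ln (T%:R : R))%:E)%E.
Proof.
move=> dstar GO opt [ropt Ropt] [d0 [d0_gt0 reg]] a b c a0 b0 c0 ordr psel isel rsel
  ordr_perm psel_spec isel_spec rsel_spec eps eps0.
have reg2 := reg 0 (lexx 0) d0_gt0.
have ropt0 := ropt_ge0 Ropt.
have [_ CE] : Rstar L h i1 pstar (fun i => Sq h i pstar) (fun _ => 0) ropt by rewrite Ropt.
pose D k := gap L pstar i1 k.
have D0 k : 0 <= D k.
  by rewrite /D /gap subr_ge0; have [->|/opt/ltW] := eqVneq k i1.
pose DS := \sum_k D k; have DS0 : 0 <= DS by apply: sumr_ge0.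
(* Half of [eps] pays for the slack [e] in the rates, the other half for the lower-order terms. *)
pose e := eps / (2 * (DS + 1)).
have e0 : 0 < e by rewrite divr_gt0 // mulr_gt0 // ltr_wpDl.
have De : DS * e <= eps / 2.
  have d1 : 0 < DS + 1 by lra.
  have -> : DS * e = eps / 2 * (DS / (DS + 1)) by rewrite /e; field; rewrite gt_eqF.
  rewrite -[leRHS]mulr1 ler_wpM2l ?divr_ge0 ?(ltW eps0) // ler_pdivrMr // mul1r; lra.
pose C := (Num.truncn (c^-1 ^+ 4 + 1)).+1.
have HC : c^-1 ^+ 4 + 1 <= C%:R by exact: ltW (truncnS_gt _).
have [t0 _ Ht0] := near_charged dstar GO opt Ropt reg2 a0 b0 c0 psel_spec isel_spec rsel_spec HC e0.
have [G [G0 HG]] := @gw_sum_le R A b b0.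
pose K : R := (N * N * (C.+1 * (2 * N + 2)) + 1)%:R.
pose Q : R := (N * (2 * N + 2))%:R.
(* [P1] collects what stays bounded in [T], [P2] the coefficient of [sqrt (ln T)] caused by
   undersampling. *)
pose P1 := DS * (2 + t0%:R + Q) + DS * K * G ^+ N.
pose P2 := DS * Q * c.
have P1_ge0 : 0 <= P1 by rewrite addr_ge0 // !mulr_ge0 ?addr_ge0 // exprn_ge0.
have P2_ge0 : 0 <= P2 by rewrite !mulr_ge0 // ltW.
apply: filterS2 (near_ln_ge (1 : R)) (near_ln_ge (((P1 + P2) / (eps / 2)) ^+ 2)) => T lnT1 lnT2.
have lnT0 : 0 <= ln T%:R :> R by exact: le_trans ler01 lnT1.
rewrite -CE -EFinD -EFinM lee_fin /expected_regret.
rewrite (Ex_ffun pstar T (fun w => \sum_(i <- actions L h a b c psel isel rsel ordr i1 w) gap L pstar i1 i)).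
(* Up to the horizon [T], an undersampled action has fewer than [M0] samples. *)
pose M0 := (Num.truncn (c * Num.sqrt (ln T%:R : R))).+1.
have HM0 : c * Num.sqrt (ln T%:R) <= M0%:R by exact: ltW (truncnS_gt _).
have HM0' : M0%:R <= c * Num.sqrt (ln T%:R) + 1.
  rewrite /M0 -natr1 lerD2r truncn_le // mulr_ge0 ?sqrtr_ge0 //; exact: ltW.
pose X := costr L i1 pstar ropt * ln T%:R + DS * e * ln T%:R + DS * (2 + t0%:R + Q * M0%:R).
pose Y w := total_weight h pstar (@gw R A b) T
  (st_hist (final L h a b c psel isel rsel ordr i1 (init_state A ordr) w)).
(* The bound holds on every path of positive probability, and [Y w] is its only random part. *)
apply: (@le_trans _ _ (Ex pstar T (fun w => X + DS * K * Y w))).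
  apply: Ex_le => // w sw pw; rewrite sum_actions.
  have Hk k : gap L pstar i1 k * (cnt k (final L h a b c psel isel rsel ordr i1 (init_state A ordr) w))%:R
     <= (if k != i1 then ropt k * D k else 0) * ln T%:R + D k * (e * ln T%:R)
        + D k * (2 + t0%:R + Q * M0%:R) + D k * (K * Y w).
    have [->|ki] /= := eqVneq k i1.
      by rewrite /D /gap subrr !mul0r !addr0.
    have B0 : 0 <= (ropt k + e) * ln T%:R by rewrite mulr_ge0 // addr_ge0 // ltW.
    have Wi := @wf_init N A ordr i1 ordr_perm.
    have Hi : (cnt k (init_state A ordr) + pend k (init_state A ordr))%:R <= (ropt k + e) * ln T%:R + 2 + 0%:R.
      by rewrite total_init // addr0; lra.
    have Hc := cnt_final_le L h a b c psel isel rsel i1 ordr_perm w B0 Wi Hi.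
    have HM0w : c * Num.sqrt (ln (size w)%:R) <= M0%:R by rewrite sw.
    have := bad_count dstar ropt0 b0 c0 ordr_perm pw e0 ki Ht0 HM0w.
    rewrite /bad_round sw => Hb.
    have : (cnt k (final L h a b c psel isel rsel ordr i1 (init_state A ordr) w))%:R <=
       (ropt k + e) * ln T%:R + 2 + (t0%:R + Q * M0%:R + K * Y w).
      have QE : Q * M0%:R = (N * M0 * (2 * N + 2))%:R by rewrite /Q -natrM mulnAC.
      move: Hc Hb; rewrite natrD QE addr0 => Hc Hb.
      have : 0 <= (pend k (final L h a b c psel isel rsel ordr i1 (init_state A ordr) w))%:R :> R by [].
      rewrite /K /Y; lra.
    move=> /(ler_wpM2l (D0 k)) /le_trans; apply; rewrite /D; lra.
  apply: le_trans (ler_sum _ (fun k _ => Hk k)) _.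
  rewrite !big_split /= -!mulr_suml -big_mkcond /=.
  rewrite -/DS -[\sum_(i | i != i1) _]/(costr L i1 pstar ropt) le_eqVlt; apply/orP; left; apply/eqP.
  rewrite /X; ring.
rewrite Ex_affine //.
have EY : Ex pstar T Y <= G ^+ N.
  apply: le_trans (Ex_total_weight h dstar T (@gw_ge0 R A b) L a b c psel isel rsel ordr i1 T (init_state A ordr)) _.
  rewrite total_weight_nil lerXn2r ?nnegrE //; apply: sumr_ge0 => n _; exact: gw_ge0.
have : DS * K * Ex pstar T Y <= DS * K * G ^+ N by rewrite ler_wpM2l // mulr_ge0.
have s1 : 1 <= Num.sqrt (ln T%:R : R) by rewrite -[leLHS]sqrtr1; exact: ler_wsqrtr.
have s2 : (P1 + P2) / (eps / 2) <= Num.sqrt (ln T%:R).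
  have z0 : 0 <= (P1 + P2) / (eps / 2) by apply: divr_ge0; [exact: addr_ge0 | rewrite divr_ge0 // ltW].
  by rewrite -[leLHS](ger0_norm z0) -sqrtr_sqr; exact: ler_wsqrtr.
have s3 : Num.sqrt (ln T%:R) ^+ 2 = ln T%:R :> R by rewrite sqr_sqrtr.
have s4 : P1 + P2 * Num.sqrt (ln T%:R) <= eps / 2 * Num.sqrt (ln T%:R) ^+ 2.
  move: s1 s2; move: (Num.sqrt _) => x x1; rewrite ler_pdivrMr ?divr_gt0 // => x2.
  have x0 : 0 <= x by lra.
  have h1 : (P1 + P2) * x <= x * (eps / 2) * x by rewrite ler_wpM2r.
  have h2 : P1 <= P1 * x by rewrite ler_peMr.
  apply: (@le_trans _ _ ((P1 + P2) * x)); first by rewrite mulrDl lerD2r.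
  by rewrite expr2 mulrCA mulrA.
rewrite s3 in s4.
have s5 : DS * (Q * M0%:R) <= DS * Q * (c * Num.sqrt (ln T%:R) + 1).
  by rewrite mulrA ler_wpM2l // mulr_ge0.
have s6 : DS * e * ln T%:R <= eps / 2 * ln T%:R by rewrite ler_wpM2r.
move: s4 s5 s6; rewrite /X /P1 /P2; lra.
Qed.
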